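(* Let $\lambda(N)\in\mathbb{GT}_N$ be a regular sequence of signatures with $m[\lambda(N)]\to\mathbf m$ weakly. Then for every fixed $k\ge2$, uniformly over an open complex neighborhood of $(x_1,\dots,x_k)=(1^k)$, $$\lim_{N\to\infty}\partial_1\partial_2\log\frac{s_{\lambda(N)}(x_1,\dots,x_k,1^{N-k})}{s_{\lambda(N)}(1^N)}=\partial_1\partial_2\log\Big(1-(x_1-1)(x_2-1)\frac{x_1H'_{\mathbf m}(x_1)-x_2H'_{\mathbf m}(x_2)}{x_1-x_2}\Big),$$ and, for $k\ge3$, $$\lim_{N\to\infty}\partial_1\partial_2\partial_3\log\frac{s_{\lambda(N)}(x_1,\dots,x_k,1^{N-k})}{s_{\lambda(N)}(1^N)}=0.$$
   Context: $\mathbb{GT}_N$: signatures $\lambda_1\ge\dots\ge\lambda_N$ of integers; $s_\lambda$ the Schur function; $m[\lambda]=\frac1N\sum_{i=1}^N\delta(\frac{\lambda_i+N-i}N)$. Regular sequence: there are a piecewise-continuous $f$ on $[0,1]$ and $C$ with $\lim_N\frac1N\sum_j|\lambda_j(N)/N-f(j/N)|=0$ and $|\lambda_j(N)/N-f(j/N)|<C$ for all $j,N$. For a compactly supported probability measure $\mathbf m$: $C_{\mathbf m}(z)=\int\frac{d\mathbf m(x)}{z-x}$, $C^{(-1)}_{\mathbf m}$ its functional inverse near $0$, $H'_{\mathbf m}(z)=\frac{C^{(-1)}_{\mathbf m}(\log z)}z-\frac1{z-1}$ (holomorphic near $1$). *)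

(* Defs.v *)
From HB Require Import structures.
From mathcomp Require Import all_boot all_order all_algebra.
From mathcomp Require Import complex.
From mathcomp Require Import all_classical all_reals all_analysis.

Set Implicit Arguments.
Unset Strict Implicit.
Unset Printing Implicit Defensive.

Import Order.TTheory GRing.Theory Num.Theory.
Import numFieldNormedType.Exports.
Local Open Scope classical_set_scope.
Local Open Scope ring_scope.

Section Defs.
Variable R : realType.
(* the complex numbers, viewed as a numClosedFieldType, so that the
   topology / normed structure of MathComp-Analysis applies *)
Local Notation C := (R[i] : numClosedFieldType).

Definition GT (N : nat) (l : seq int) : Prop :=
  size l = N /\ sorted (fun a b : int => b <= a) l.

Definition int_range (a b : int) : seq int :=
  [seq a + (i%:Z) | i <- iota 0 (absz (b - a)).+1].

Fixpoint interlace (l : seq int) : seq (seq int) :=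
  match l with
  | [::] => [::]
  | [:: _] => [:: [::]]
  | a :: ((b :: _) as t) =>
      [seq m :: mu | m <- int_range b a, mu <- interlace t]
  end.

Definition sumz (l : seq int) : int := \sum_(i <- l) i.

(* Schur (Laurent) polynomial s_l(x_1,...,x_N) through the branching rule
   (sum over Gelfand-Tsetlin patterns):
   s_l(x_1,..,x_N) = sum_{mu interlacing l} x_1^{|l|-|mu|} s_mu(x_2,..,x_N). *)
Fixpoint schur (x : seq C) (l : seq int) : C :=
  match x with
  | [::] => if l is [::] then 1 else 0
  | y :: xs => \sum_(mu <- interlace l) y ^ (sumz l - sumz mu) * schur xs mu
  end.

(* integral of f against m[l] = (1/N) sum_i delta((l_i + N - i)/N) *)
Definition emp_integral (l : seq int) (f : R -> R) : R :=
  (size l)%:R^-1 *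
  \sum_(i < size l) f (((nth 0 l i)%:~R + (size l)%:R - (i.+1)%:R) / (size l)%:R).

Definition weak_conv (lam : nat -> seq int) (m : probability R R) : Prop :=
  forall f : R -> R, continuous f -> (exists M : R, forall x, `|f x| <= M) ->
    (fun N => emp_integral (lam N) f) @ \oo --> Rintegral m setT f.

Definition piecewise_continuous (f : R -> R) : Prop :=
  exists t : seq R, [/\ sorted <%R t, head 1 t = 0, last 0 t = 1 &
    forall i, (i.+1 < size t)%N ->
      exists g : R -> R,
        {within `[nth 0 t i, nth 0 t i.+1], continuous g} /\
        forall x, nth 0 t i < x < nth 0 t i.+1 -> f x = g x].

Definition regular (lam : nat -> seq int) : Prop :=
  exists f : R -> R, piecewise_continuous f /\
  exists Cst : R,
    (fun N : nat => N%:R^-1 * \sum_(j < N)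
        `|(nth 0 (lam N) j)%:~R / N%:R - f ((j.+1)%:R / N%:R)|) @ \oo --> 0
    /\ forall (N j : nat), (j < N)%N ->
        `|(nth 0 (lam N) j)%:~R / N%:R - f ((j.+1)%:R / N%:R)| < Cst.

Definition cabs (z : C) : R := Num.sqrt (complex.Re z ^+ 2 + complex.Im z ^+ 2).

(* principal logarithm on the half-plane Re z > 0 (only used near z = 1) *)
Definition Logc (z : C) : C :=
  Complex (ln (cabs z)) (atan (complex.Im z / complex.Re z)).

(* Cauchy transform C_m(z) = int dm(x) / (z - x), written via its real and
   imaginary parts: 1/(z-x) = ((a-x) - i b)/((a-x)^2+b^2), z = a + i b *)
Definition Cauchy (m : probability R R) (z : C) : C :=
  let a := complex.Re z in let b := complex.Im z in
  Complex (Rintegral m setT (fun x => (a - x) / ((a - x) ^+ 2 + b ^+ 2)))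
          (Rintegral m setT (fun x => - b / ((a - x) ^+ 2 + b ^+ 2))).

(* Ci is (a representative of the germ at 0 of) the functional inverse of
   C_m near 0: C_m(z) ~ 1/z at infinity, so the inverse is the branch with
   Ci(w) -> infinity as w -> 0 and C_m(Ci w) = w for small w <> 0. *)
Definition Cauchy_inverse (m : probability R R) (Ci : C -> C) : Prop :=
  (forall M : R, exists2 d : R, 0 < d &
     forall w : C, 0 < cabs w < d -> M < cabs (Ci w)) /\
  (exists2 d : R, 0 < d & forall w : C, 0 < cabs w < d -> Cauchy m (Ci w) = w).

(* Hp is (a representative near 1 of) H'_m(z) = Ci(log z)/z - 1/(z-1),
   extended holomorphically (i.e. by continuity) to z = 1 *)
Definition Hprime (m : probability R R) (Hp : C -> C) : Prop :=
  exists Ci : C -> C, [/\ Cauchy_inverse m Ci,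
    (exists2 rho : R, 0 < rho & forall z : C, 0 < cabs (z - 1) < rho ->
        Hp z = Ci (Logc z) / z - (z - 1)^-1) &
    {for 1, continuous Hp}].

Definition upd (k : nat) (x : 'I_k -> C) (i : 'I_k) (t : C) : 'I_k -> C :=
  fun j => if j == i then t else x j.

Definition pd (k : nat) (i : 'I_k) (F : ('I_k -> C) -> C) (x : 'I_k -> C) : C :=
  derive1 (fun t : C => F (upd x i t)) (x i).

(* d_i d_j log F  =  d_i (d_j F / F) *)
Definition dlog2 (k : nat) (i j : 'I_k) (F : ('I_k -> C) -> C) :=
  pd i (fun y => pd j F y / F y).

(* d_i d_j d_l log F  =  d_i d_j (d_l F / F) *)
Definition dlog3 (k : nat) (i j l : 'I_k) (F : ('I_k -> C) -> C) :=
  pd i (pd j (fun y => pd l F y / F y)).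

Definition schur_ratio (lam : nat -> seq int) (k N : nat) (x : 'I_k -> C) : C :=
  schur ([seq x i | i <- enum 'I_k] ++ nseq (N - k) 1) (lam N)
  / schur (nseq N 1) (lam N).

(* (z H(z) - w H(w)) / (z - w), extended holomorphically to the diagonal *)
Definition divdiff (Hp : C -> C) (z w : C) : C :=
  if z == w then derive1 (fun u : C => u * Hp u) z
  else (z * Hp z - w * Hp w) / (z - w).

Definition Phi (k : nat) (i1 i2 : 'I_k) (Hp : C -> C) (x : 'I_k -> C) : C :=
  1 - (x i1 - 1) * (x i2 - 1) * divdiff Hp (x i1) (x i2).

Definition unif_conv_near1 (k : nat) (FN : nat -> ('I_k -> C) -> C)
    (G : ('I_k -> C) -> C) : Prop :=
  exists2 eps : R, 0 < eps &
    forall delta : R, 0 < delta -> exists N0 : nat, forall N : nat, (N0 <= N)%N ->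
      forall x : 'I_k -> C, (forall i, cabs (x i - 1) < eps) ->
        cabs (FN N x - G x) < delta.

End Defs.

(* Main.v *)
(* Write s_k(x) for the Schur function at (x_1, ..., x_k, 1, ..., 1) and s_1 for its one-variable
   version.  With the nodes l_j = lambda_j + N - j, weights w_j = 1/prod_{m <> j} (l_j - l_m) and
   F(y) = sum_j w_j exp(l_j y), the branching rule expresses s_k as a k x k determinant in the
   derivatives F^(q)(log x_i), and s_1 through F itself.  Hence, up to a constant,
   s_k(x) / prod_i s_1(x_i) is prod_{i<j} (1 - x_i)(1 - x_j)/(x_i - x_j) times the determinant of
   F^(q)(y_i) / (N^q F(y_i)) with y_i = log x_i.

   F and the divided differences G_i of exp(y .) at the nodes with l_i doubled satisfy a linear
   differential system; comparing it with a polynomial fixed point and applying Gronwall's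
   inequality along rays bounds N G_i / F near 0, uniformly in N, and shows that F does not vanish
   there.  So u(y) = y F'(y) / (N F(y)) is analytic near 0 and, up to O(1/N), solves
   mean_i 1/(u - y l_i/N) = 1, which is the equation C_m(u / y) = y in the limit: u tends to
   y C_m^(-1)(y).  Moreover y^q F^(q) / (N^q F) = u^q + O(1/N), so that the determinant becomes a
   Vandermonde determinant and s_k / prod_i s_1(x_i) tends, up to constants, to the product over
   pairs of Phi(x_i, x_j), where Phi is the argument of the logarithm in the statement.

   This limit is first obtained where the x_i are separated from each other and from 1.  A torus of
   distinct radii lies in that region, and a maximum principle carries the convergence to the full
   polydisc, where it passes to derivatives.  The one-variable factors s_1(x_i) do not contribute to
   mixed logarithmic derivatives, and every factor Phi(x_i, x_j) other than Phi(x_1, x_2) misses x_1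
   or x_2; every factor misses one of x_1, x_2, x_3.

   Analyticity enters only as uniform approximability by polynomials, for which averaging over
   roots of unity replaces Cauchy's integral formula. *)
Require Import Defs.
From HB Require Import structures.
From mathcomp Require Import all_boot all_order all_algebra.
From mathcomp Require Import complex.
From mathcomp Require Import all_classical all_reals all_analysis.
From mathcomp Require Import measurable_realfun perm cyclic separable cyclotomic.
From mathcomp Require Import ring lra zify.
Import Order.TTheory GRing.Theory Num.Theory.
Import numFieldNormedType.Exports.
Local Open Scope classical_set_scope.
Local Open Scope ring_scope.
Set Implicit Arguments.
Unset Strict Implicit.
Unset Printing Implicit Defensive.

(** Uniformity in N is the obstacle: F has a zero of order N - 1 at the origin. The quotients rho_i
    = N G_i / F satisfy y rho_i' + (N - 1) rho_i = N (y + a_i y rho_i - mean_j(a_j rho_j) rho_i)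
    with a_i = l_i / N. Inverting the left side divides the coefficient of y^k by k + N - 1, and N /
    (k + N - 1) <= 1 for k >= 1; so the system becomes a contraction on a disc whose radius depends
    only on a bound for the a_i.

    No regularity of the given [Ci] and [Hp] is known in advance: [Ci] is a right inverse of the
    Cauchy transform that tends to infinity, and [Hp] is continuous at 1. The limit is identified
    through the quantitative injectivity of u -> mean_i 1 / (u - b_i). The analyticity of [Phi],
    including its values on x_i = x_j and x_i = 1, is read off from the limit of two-variable Schur
    functions instead of an inverse function theorem.

    The constants relating determinants to Schur functions are never computed: they drop out of
    logarithmic derivatives. *)

Section ComplexModulus.
Variable R : realType.
Local Notation C := (R[i] : numClosedFieldType).
Implicit Types (x y z : C).

Lemma cabs_norm z : (cabs z)%:C%C = `|z|.
Proof. by rewrite normc_def. Qed.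

Lemma cabs_ge0 z : 0 <= cabs z. Proof. exact: sqrtr_ge0. Qed.

Lemma cabsM x y : cabs (x * y) = cabs x * cabs y.
Proof. by apply: complexI; rewrite rmorphM /= !cabs_norm normrM. Qed.

Lemma cabsD x y : cabs (x + y) <= cabs x + cabs y.
Proof. by rewrite -lecR rmorphD /= !cabs_norm ler_normD. Qed.

Lemma cabsN x : cabs (- x) = cabs x.
Proof. by apply: complexI; rewrite !cabs_norm normrN. Qed.

Lemma cabsBC x y : cabs (x - y) = cabs (y - x).
Proof. by rewrite -cabsN opprB. Qed.

Lemma cabs0 : cabs (0 : C) = 0.
Proof. by apply: complexI; rewrite cabs_norm normr0. Qed.

Lemma cabs1 : cabs (1 : C) = 1.
Proof. by apply: complexI; rewrite cabs_norm normr1. Qed.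

Lemma cabs_eq0 x : (cabs x == 0) = (x == 0).
Proof.
rewrite -(normr_eq0 x) -cabs_norm; apply/eqP/eqP => [->//|h].
by apply: complexI; rewrite h.
Qed.

Lemma cabs_gt0 x : (0 < cabs x) = (x != 0).
Proof. by rewrite lt_neqAle cabs_ge0 andbT eq_sym cabs_eq0. Qed.

Lemma cabsV x : cabs x^-1 = (cabs x)^-1.
Proof. by apply: complexI; rewrite fmorphV /= !cabs_norm normfV. Qed.

Lemma cabsX x n : cabs (x ^+ n) = cabs x ^+ n.
Proof. by apply: complexI; rewrite rmorphXn /= !cabs_norm normrX. Qed.

Lemma cabs_real (a : R) : cabs (a%:C%C : C) = `|a|.
Proof. by rewrite /cabs /= expr0n addr0 sqrtr_sqr. Qed.

Lemma cabs_nat n : cabs (n%:R : C) = n%:R.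
Proof. by apply: complexI; rewrite cabs_norm rmorph_nat normr_nat. Qed.

Lemma cabs_sum (I : Type) (r : seq I) (P : pred I) (F : I -> C) :
  cabs (\sum_(i <- r | P i) F i) <= \sum_(i <- r | P i) cabs (F i).
Proof.
elim/big_rec2: _ => [|i a b _ le]; first by rewrite cabs0.
exact: le_trans (cabsD _ _) (lerD (lexx _) le).
Qed.

Lemma cabsB_le x y : cabs (x - y) <= cabs x + cabs y.
Proof. by rewrite -[cabs y]cabsN cabsD. Qed.

Lemma cabs_lb x y : cabs x - cabs y <= cabs (x + y).
Proof. by have := cabsD (x + y) (- y); rewrite addrK cabsN; lra. Qed.

Lemma cabs_lbB x y : cabs x - cabs y <= cabs (x - y).
Proof. by have := cabsD (x - y) y; rewrite subrK; lra. Qed.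

Lemma cabs_tri y x z : cabs (x - z) <= cabs (x - y) + cabs (y - z).
Proof. by have := cabsD (x - y) (y - z); rewrite addrA subrK. Qed.

Lemma cabs_Re z : `|complex.Re z| <= cabs z.
Proof. by rewrite -sqrtr_sqr ler_wsqrtr // lerDl sqr_ge0. Qed.

Lemma cabs_Im z : `|complex.Im z| <= cabs z.
Proof. by rewrite -sqrtr_sqr ler_wsqrtr // lerDr sqr_ge0. Qed.

Lemma cabs_ReIm z : cabs z <= `|complex.Re z| + `|complex.Im z|.
Proof.
have -> : z = (complex.Re z)%:C%C + 'i%C * (complex.Im z)%:C%C by exact: complexE.
apply: le_trans (cabsD _ _) _; rewrite cabsM !cabs_real.
have -> : cabs 'i%C = 1 :> R by rewrite /cabs /= expr0n /= add0r expr1n sqrtr1.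
by rewrite mul1r; case: z => a b /=; rewrite !(mulr0,mul0r,mul1r,addr0,subr0,add0r).
Qed.

Lemma eq_cabs_le0 x y : (forall e, 0 < e -> cabs (x - y) <= e) -> x = y.
Proof.
move=> h; apply/eqP; rewrite -subr_eq0 -cabs_eq0 eq_le cabs_ge0 andbT.
by apply/ler_addgt0Pr => e e0; rewrite add0r; exact: h.
Qed.

Lemma ccauchy_cvg (u : nat -> C) :
  (forall e, 0 < e -> exists N, forall n m, (N <= n)%N -> (N <= m)%N ->
     cabs (u n - u m) <= e) ->
  exists l : C, forall e, 0 < e -> exists N, forall n, (N <= n)%N -> cabs (u n - l) <= e.
Proof.
have key (f : C -> R) : (forall z w, `|f z - f w| <= cabs (z - w)) ->
  (forall e, 0 < e -> exists N, forall n m, (N <= n)%N -> (N <= m)%N ->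
     cabs (u n - u m) <= e) ->
  exists l : R, forall e, 0 < e -> exists N, forall n, (N <= n)%N -> `|f (u n) - l| <= e.
  move=> hf hu.
  have /cauchy_cvgP hc : cauchy (f \o u @ \oo).
    apply: cauchy_exP => e e0; have e2 : 0 < e / 2 by lra.
    have [N hN] := hu _ e2.
    exists (f (u N)); exists N => //= n hn; rewrite -ball_normE /=.
    apply: le_lt_trans (hf _ _) _; apply: (@le_lt_trans _ _ (e / 2)); last by lra.
    by apply: hN.
  exists (lim (f \o u @ \oo)) => e e0.
  have /cvgrPdist_le/(_ e e0) [N _ hN] := hc.
  by exists N => n hn; rewrite distrC; exact: hN.
move=> hu.
have [a ha] : exists l : R, forall e, 0 < e -> exists N, forall n, (N <= n)%N -> `|complex.Re (u n) - l| <= e.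
  apply: (key (fun z => complex.Re z)) => // z w; apply: le_trans (cabs_Re _).
  by case: z w => [? ?] [? ?].
have [b hb] : exists l : R, forall e, 0 < e -> exists N, forall n, (N <= n)%N -> `|complex.Im (u n) - l| <= e.
  apply: (key (fun z => complex.Im z)) => // z w; apply: le_trans (cabs_Im _).
  by case: z w => [? ?] [? ?].
exists (Complex a b) => e e0; have e2 : 0 < e / 2 by lra.
have [N1 h1] := ha _ e2; have [N2 h2] := hb _ e2.
exists (maxn N1 N2) => n; rewrite geq_max => /andP[/h1 k1 /h2 k2].
apply: le_trans (cabs_ReIm _) _; case: (u n) k1 k2 => [c d] /=; lra.
Qed.

End ComplexModulus.

(** * Complex derivatives in epsilon-delta form *)

Section ComplexDerivative.
Variable R : realType.
Local Notation C := (R[i] : numClosedFieldType).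
Implicit Types (f g : C -> C) (z h d : C).

(** Unlike [derive1], a limit whose value is arbitrary when it does not exist, this asserts
    differentiability, and its moduli are real; [cder_derive1] links the two. *)
Definition cder f z d := forall e : R, 0 < e -> exists2 dl : R, 0 < dl &
  forall h, cabs h < dl -> cabs (f (z + h) - f z - d * h) <= e * cabs h.

Lemma cder_local f g z d (r : R) : 0 < r ->
  (forall w, cabs (w - z) < r -> f w = g w) -> cder f z d -> cder g z d.
Proof.
move=> r0 fg cf e e0; have [dl dl0 hd] := cf e e0.
exists (Num.min dl r) => [|h]; first by rewrite lt_min dl0.
rewrite lt_min => /andP[h1 h2]; rewrite -!fg ?subrr ?cabs0 //; first exact: hd.
by rewrite addrC addKr.
Qed.

Lemma cder_cst (c : C) z : cder (fun=> c) z 0.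
Proof. by move=> e e0; exists 1 => // h _; rewrite subrr mul0r subrr cabs0 mulr_ge0 ?cabs_ge0 // ltW. Qed.

Lemma cder_id z : cder (fun w => w) z 1.
Proof.
move=> e e0; exists 1 => // h _; have -> : z + h - z - 1 * h = 0 by ring.
by rewrite cabs0 mulr_ge0 ?cabs_ge0 // ltW.
Qed.

Lemma cderD f g z d d' : cder f z d -> cder g z d' ->
  cder (fun w => f w + g w) z (d + d').
Proof.
move=> cf cg e e0; have e2 : 0 < e / 2 by lra.
have [a a0 ha] := cf _ e2; have [b b0 hb] := cg _ e2.
exists (Num.min a b) => [|h]; first by rewrite lt_min a0.
rewrite lt_min => /andP[/ha k1 /hb k2].
have -> : f (z + h) + g (z + h) - (f z + g z) - (d + d') * h =
  (f (z + h) - f z - d * h) + (g (z + h) - g z - d' * h) by ring.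
by apply: le_trans (cabsD _ _) _; lra.
Qed.

Lemma cder_lip f z d : cder f z d -> exists2 dl : R, 0 < dl &
  forall h, cabs h < dl -> cabs (f (z + h) - f z) <= (cabs d + 1) * cabs h.
Proof.
move=> cf; have [dl dl0 hd] := cf 1 ltr01; exists dl => // h /hd k.
rewrite -[f _ - f z](subrK (d * h)); apply: le_trans (cabsD _ _) _.
by rewrite cabsM; lra.
Qed.

Lemma cderM f g z d d' : cder f z d -> cder g z d' ->
  cder (fun w => f w * g w) z (d * g z + f z * d').
Proof.
move=> cf cg e e0.
pose K := cabs (g z) + cabs (f z) + (cabs d + 1) * (cabs d' + 1) + 1.
have D0 := cabs_ge0 d; have D0' := cabs_ge0 d'.
have G0 := cabs_ge0 (g z); have F0 := cabs_ge0 (f z).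
have P0 : 0 <= (cabs d + 1) * (cabs d' + 1) by apply: mulr_ge0; lra.
have K0 : 0 < K by rewrite /K; lra.
have eK : 0 < e / K by rewrite divr_gt0.
have [a a0 ha] := cf _ eK; have [b b0 hb] := cg _ eK.
have [a' a0' ha'] := cder_lip cf; have [b' b0' hb'] := cder_lip cg.
exists (Num.min (Num.min a b) (Num.min (Num.min a' b') (e / K))) => [|h].
  by rewrite !lt_min a0 b0 a0' b0' eK.
rewrite !lt_min => /andP[/andP[/ha k1 /hb k2] /andP[/andP[/ha' k3 /hb' k4] k5]].
have -> : f (z + h) * g (z + h) - f z * g z - (d * g z + f z * d') * h =
  (f (z + h) - f z - d * h) * g z + f z * (g (z + h) - g z - d' * h)
  + (f (z + h) - f z) * (g (z + h) - g z) by ring.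
have h0 := cabs_ge0 h.
apply: (@le_trans _ _ (e / K * cabs h * cabs (g z) + cabs (f z) * (e / K * cabs h) +
   (cabs d + 1) * cabs h * ((cabs d' + 1) * cabs h))).
  apply: le_trans (cabsD _ _) _; apply: lerD.
    apply: le_trans (cabsD _ _) _; rewrite !cabsM; apply: lerD.
      by rewrite ler_wpM2r.
    by rewrite ler_wpM2l.
  by rewrite cabsM ler_pM ?cabs_ge0.
have -> : e * cabs h = e / K * cabs h * cabs (g z) + cabs (f z) * (e / K * cabs h) +
  (cabs d + 1) * (cabs d' + 1) * (e / K * cabs h) + e / K * cabs h.
  have -> : e / K * cabs h * cabs (g z) + cabs (f z) * (e / K * cabs h) +
  (cabs d + 1) * (cabs d' + 1) * (e / K * cabs h) + e / K * cabs h = e / K * K * cabs h by rewrite /K; ring.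
  by rewrite divfK // gt_eqF.
have eh0 : 0 <= e / K * cabs h by rewrite mulr_ge0 // ltW.
suff t3 : (cabs d + 1) * cabs h * ((cabs d' + 1) * cabs h) <=
    (cabs d + 1) * (cabs d' + 1) * (e / K * cabs h) by lra.
have -> : (cabs d + 1) * cabs h * ((cabs d' + 1) * cabs h) =
  ((cabs d + 1) * (cabs d' + 1)) * (cabs h * cabs h) by ring.
by rewrite ler_wpM2l // ler_wpM2r // ltW.
Qed.

Lemma cderV f z d : f z != 0 -> cder f z d ->
  cder (fun w => (f w)^-1) z (- d / f z ^+ 2).
Proof.
move=> fz cf e e0.
have F0 : 0 < cabs (f z) by rewrite cabs_gt0.
have D0 := cabs_ge0 d.
have [a a0 ha] := cder_lip cf.
pose m := cabs (f z).
have m2 : 0 < m / 2 by rewrite /m; lra.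
have e1 : 0 < e * m ^+ 2 / 4 by rewrite divr_gt0 // mulr_gt0 // exprn_gt0.
have [b b0 hb] := cf _ e1.
have ab1 : 0 < m / 2 / (cabs d + 1) by rewrite divr_gt0 //; lra.
have ab2 : 0 < e * m ^+ 3 / 4 / (cabs d + 1) ^+ 2.
  by rewrite !(divr_gt0, mulr_gt0, exprn_gt0) //; lra.
exists (Num.min (Num.min a b) (Num.min (m / 2 / (cabs d + 1)) (e * m ^+ 3 / 4 / (cabs d + 1) ^+ 2))) => [|h].
  by rewrite !lt_min a0 b0 ab1 ab2.
rewrite !lt_min => /andP[/andP[/ha k1 /hb k2] /andP[k3 k4]].
have dp : 0 < cabs d + 1 by lra.
have h0 := cabs_ge0 h.
have s1 : (cabs d + 1) * cabs h <= m / 2.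
  by move: k3; rewrite ltr_pdivlMr // mulrC => /ltW.
have s2 : (cabs d + 1) ^+ 2 * cabs h <= e * m ^+ 3 / 4.
  by move: k4; rewrite ltr_pdivlMr ?exprn_gt0 // mulrC => /ltW.
have lb : m / 2 <= cabs (f (z + h)).
  have := cabs_lb (f z) (f (z + h) - f z); rewrite [f z + _]addrC subrK -/m; lra.
have fh : f (z + h) != 0 by rewrite -cabs_gt0; lra.
have -> : (f (z + h))^-1 - (f z)^-1 - - d / f z ^+ 2 * h =
  - (f z * (f (z + h) - f z - d * h) - d * h * (f (z + h) - f z)) / (f z ^+ 2 * f (z + h)).
  by field; apply/andP.
rewrite cabsM cabsN cabsV cabsM cabsX -/m.
have M0 : 0 < m ^+ 2 * cabs (f (z + h)).
  by apply: mulr_gt0; [exact: exprn_gt0|lra].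
rewrite ler_pdivrMr //.
apply: (@le_trans _ _ (e * cabs h * (m ^+ 2 * (m / 2)))); last first.
  by rewrite ler_wpM2l ?ler_wpM2l ?sqr_ge0 // mulr_ge0 // ltW.
apply: le_trans (cabsB_le _ _) _; rewrite !cabsM -/m.
have t1 : m * cabs (f (z + h) - f z - d * h) <= m * (e * m ^+ 2 / 4 * cabs h).
  by rewrite ler_wpM2l // ltW.
have t2 : cabs d * cabs h * cabs (f (z + h) - f z) <= (e * m ^+ 3 / 4) * cabs h.
  apply: (@le_trans _ _ ((cabs d + 1) ^+ 2 * cabs h * cabs h)); last by rewrite ler_wpM2r.
  apply: (@le_trans _ _ ((cabs d + 1) * cabs h * ((cabs d + 1) * cabs h))); last by rewrite le_eqVlt; apply/orP; left; apply/eqP; ring.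
  by apply: ler_pM; rewrite ?cabs_ge0 ?mulr_ge0 // ler_wpM2r //; lra.
have -> : e * cabs h * (m ^+ 2 * (m / 2)) = m * (e * m ^+ 2 / 4 * cabs h) + (e * m ^+ 3 / 4) * cabs h by field.
exact: lerD.
Qed.

Lemma cderN f z d : cder f z d -> cder (fun w => - f w) z (- d).
Proof.
move=> /(cderM (cder_cst (-1) z)) h.
have -> : - d = 0 * f z + (-1) * d by ring.
by apply: cder_local ltr01 _ h => w _; rewrite mulN1r.
Qed.

Lemma cderB f g z d d' : cder f z d -> cder g z d' ->
  cder (fun w => f w - g w) z (d - d').
Proof. by move=> cf cg; apply: cderD => //; exact: cderN. Qed.

Lemma cderZ (c : C) f z d : cder f z d -> cder (fun w => c * f w) z (c * d).
Proof. by move=> /(cderM (cder_cst c z)); rewrite mul0r add0r. Qed.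

Lemma cder_sum (I : Type) (r : seq I) (P : pred I) (F : I -> C -> C) (D : I -> C) z :
  (forall i, P i -> cder (F i) z (D i)) ->
  cder (fun w => \sum_(i <- r | P i) F i w) z (\sum_(i <- r | P i) D i).
Proof.
move=> h; elim: r => [|i r IH].
  rewrite big_nil; apply: cder_local ltr01 _ (cder_cst 0 z) => w _.
  by rewrite big_nil.
rewrite big_cons; case: ifP => Pi.
  apply: cder_local ltr01 _ (cderD (h i Pi) IH) => w _.
  by rewrite big_cons Pi.
by apply: cder_local ltr01 _ IH => w _; rewrite big_cons Pi.
Qed.

Lemma cder_horner (p : {poly C}) z : cder (fun w => p.[w]) z p^`().[z].
Proof.
elim/poly_ind: p => [|p c IH].
  rewrite linear0 horner0; apply: cder_local ltr01 _ (cder_cst 0 z) => w _.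
  by rewrite horner0.
have := cderD (cderM IH (cder_id z)) (cder_cst c z).
rewrite derivD derivM derivX derivC addr0 mulr1 !hornerE.
by apply: cder_local ltr01 _ => w _; rewrite !hornerE.
Qed.

Lemma cder_scale (c : C) f z d : cder f (c * z) d -> cder (fun w => f (c * w)) z (c * d).
Proof.
move=> cf e e0; have c1 : 0 < cabs c + 1 by have := cabs_ge0 c; lra.
have [a a0 ha] := cf (e / (cabs c + 1)) (divr_gt0 e0 c1).
exists (a / (cabs c + 1)); first exact: divr_gt0.
move=> h; rewrite ltr_pdivlMr // => hh.
have h0 := cabs_ge0 h.
have -> : c * d * h = d * (c * h) by ring.
rewrite mulrDr; apply: le_trans (ha _ _) _.
  by rewrite cabsM mulrC; apply: le_lt_trans hh; rewrite ler_wpM2l //; lra.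
rewrite cabsM mulrA ler_wpM2r // -[leRHS](divfK (lt0r_neq0 c1)) ler_wpM2l ?divr_ge0 ?ltW //.
by lra.
Qed.

Lemma cder_shift (a : C) f z d : cder f (a + z) d -> cder (fun w => f (a + w)) z d.
Proof.
move=> cf e e0; have [b b0 hb] := cf e e0; exists b => // h /hb.
by rewrite addrA.
Qed.

Lemma cder_derive1 f z d : cder f z d -> derive1 f z = d.
Proof.
move=> cf; rewrite /derive1; apply: cvg_lim => //.
apply/cvgrPdist_le => e e0.
have [er eE] : exists er : R, e = er%:C%C.
  by have /ger0_Im/= e1 := ltW e0; exists (complex.Re e); case: e e1 {e0} => a b /= ->.
move: e0; rewrite eE ltcR => er0.
have [a a0 ha] := cf _ er0.
exists a%:C%C => /=; first by rewrite ltcR.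
move=> h /=; rewrite sub0r normrN -cabs_norm ltcR => hh h0.
have ch : 0 < cabs h by rewrite cabs_gt0.
rewrite -cabs_norm lecR.
have -> : d - h^-1 *: (f (h + z) - f z) = - (f (z + h) - f z - d * h) * h^-1.
  by rewrite [h + z]addrC /GRing.scale /=; field.
by rewrite cabsM cabsN cabsV ler_pdivrMr //; exact: ha.
Qed.

Lemma derive1_local f g z (r : R) : 0 < r ->
  (forall w, cabs (w - z) < r -> f w = g w) -> derive1 f z = derive1 g z.
Proof.
move=> r0 fg; rewrite !derive1E; apply: near_eq_derive.
exists r%:C%C; rewrite /= ?ltcR // => w /=; rewrite -cabs_norm ltcR cabsBC; exact: fg.
Qed.

End ComplexDerivative.

(** * Functions uniformly approximable by polynomials on a disc *)

Section PolynomialBounds.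
Variable R : realType.
Local Notation C := (R[i] : numClosedFieldType).
Implicit Types (p q : {poly C}) (z w a b d : C) (f g : C -> C).

Lemma closed_prim_root_exists n : (0 < n)%N -> exists w : C, n.-primitive_root w.
Proof.
move=> n0; have [r Dp] := closed_field_poly_normal ('X^n - 1 : {poly C}).
rewrite (monicP _) ?monicXnsubC // scale1r in Dp.
have rn1 : all n.-unity_root r by apply/allP => z; rewrite -root_prod_XsubC -Dp.
have sz : (n < (size r).+1)%N by rewrite -(size_prod_XsubC r id) -Dp size_XnsubC.
have [|z] := hasP (has_prim_root n0 rn1 _ sz); last by exists z.
by rewrite -separable_prod_XsubC -Dp separable_Xn_sub_1 // pnatr_eq0 -lt0n.
Qed.

Lemma prim_root_sum n (w : C) m : n.-primitive_root w ->
  \sum_(j < n) (w ^+ m) ^+ j = if (n %| m)%N then n%:R else 0.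
Proof.
move=> hw; rewrite (prim_order_dvd hw); case: eqP => [->|/eqP h].
  by under eq_bigr do rewrite expr1n; rewrite sumr_const card_ord.
apply/eqP; have : w ^+ m - 1 != 0 by rewrite subr_eq0.
move=> /mulfI h2; apply/eqP; apply: h2; rewrite mulr0 -subrX1.
by rewrite exprAC (prim_expr_order hw) expr1n subrr.
Qed.

(** Discrete Cauchy estimate: averaging p(r w^j) w^(-jk) over the n-th roots of unity isolates the
    coefficient of index k exactly, once n is large. *)
Lemma coef_bound p (r M : R) k : 0 < r ->
  (forall z, cabs z = r -> cabs p.[z] <= M) -> cabs p`_k * r ^+ k <= M.
Proof.
move=> r0 hM.
have rc : cabs (r%:C%C : C) = r by rewrite cabs_real gtr0_norm.
have [kp|kp] := leqP (size p) k.
  by rewrite nth_default // cabs0 mul0r; apply: le_trans (cabs_ge0 _) (hM _ rc).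
(* For this n and m < size p, the exponent m + n - k is a multiple of n only when m = k. *)
pose n := (size p + k).+1.
have n0 : (0 < n)%N by [].
have [w hw] := closed_prim_root_exists n0.
have cw : cabs w = 1.
  apply/eqP; rewrite -(@pexpr_eq1 _ _ n) ?cabs_ge0 // -cabsX.
  by rewrite (prim_expr_order hw) cabs1.
have cwX m : cabs (w ^+ m) = 1 by rewrite cabsX cw expr1n.
have E : \sum_(j < n) p.[r%:C%C * w ^+ j] * w ^+ (j * (n - k)) = n%:R * (p`_k * r%:C%C ^+ k).
  transitivity (\sum_(j < n) \sum_(m < size p) (p`_m * r%:C%C ^+ m) * (w ^+ (m + (n - k))) ^+ j).
    apply: eq_bigr => j _; rewrite horner_coef mulr_suml; apply: eq_bigr => m _.
    by rewrite exprMn -!exprM -!mulrA -exprD mulnDl [(m * j)%N]mulnC [((n - k) * j)%N]mulnC.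
  rewrite exchange_big /= (bigD1 (Ordinal kp)) //= [X in _ + X]big1 ?addr0; last first.
    move=> m mk; rewrite -mulr_sumr (prim_root_sum _ hw).
    case: ifP => [|_]; last by rewrite mulr0.
    have mp : (m < size p)%N := ltn_ord m.
    have {}mk : m <> k :> nat by move=> mk'; move: mk; rewrite -val_eqE /= mk' eqxx.
    move=> /dvdnP[[|[|c]]]; rewrite /n; [lia|lia|].
    have : (2 * (size p + k).+1 <= c.+2 * (size p + k).+1)%N by rewrite leq_mul2r.
    by move: (c.+2 * _)%N => t h1 h2; exfalso; lia.
  rewrite -mulr_sumr (prim_root_sum _ hw) subnKC; last by rewrite /n; lia.
  by rewrite dvdnn mulrC.
have : cabs (n%:R * (p`_k * r%:C%C ^+ k)) <= n%:R * M.
  rewrite -E; apply: le_trans (cabs_sum _ _ _) _.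
  apply: le_trans (ler_sum _ (_ : forall i, _ -> _ <= M)) _.
    move=> j _; rewrite cabsM cwX mulr1; apply: hM.
    by rewrite cabsM rc cwX mulr1.
  by rewrite sumr_const card_ord mulr_natl.
by rewrite !cabsM cabs_nat cabsX rc ler_pM2l.
Qed.

Lemma geom_le2 (t : R) n : 0 <= t -> t <= 2^-1 -> \sum_(j < n) t ^+ j <= 2.
Proof.
move=> t0 t1; have := subrX1 t n; set S := \sum_(_ < _) _ => h.
have tn : 0 <= t ^+ n by exact: exprn_ge0.
have : (1 - t) * S <= 1 by lra.
have S0 : 0 <= S by apply: sumr_ge0 => i _; exact: exprn_ge0.
nra.
Qed.

(** The coefficient bounds make the tail a geometric series of ratio at most 1/2, whence the factor
    2. The case k = 0 serves as a maximum principle, the case k = 2 as a Taylor estimate. *)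
Lemma poly_tail p (r M : R) z k : 0 < r ->
  (forall z, cabs z = r -> cabs p.[z] <= M) -> cabs z <= r / 2 ->
  cabs (p.[z] - \sum_(i < k) p`_i * z ^+ i) <= 2 * M * (cabs z / r) ^+ k.
Proof.
move=> r0 hM hz.
have M0 : 0 <= M.
  by apply: le_trans (cabs_ge0 _) (hM r%:C%C _); rewrite cabs_real gtr0_norm.
rewrite (@horner_coef_wide _ (k + size p)) ?leq_addl // big_split_ord /= addrAC subrr add0r.
have t0 : 0 <= cabs z / r by rewrite divr_ge0 ?cabs_ge0 // ltW.
apply: le_trans (cabs_sum _ _ _) _.
apply: (@le_trans _ _ (\sum_(i < size p) M * (cabs z / r) ^+ k * (cabs z / r) ^+ i)).
  apply: ler_sum => i _; rewrite -mulrA -exprD cabsM cabsX expr_div_n mulrCA.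
  rewrite [leLHS]mulrC ler_wpM2l ?exprn_ge0 ?cabs_ge0 //.
  by rewrite ler_pdivlMr ?exprn_gt0 //; exact: coef_bound.
have -> : 2 * M * (cabs z / r) ^+ k = M * (cabs z / r) ^+ k * 2 by ring.
rewrite -mulr_sumr ler_wpM2l ?mulr_ge0 ?exprn_ge0 //.
by apply: geom_le2 => //; rewrite ler_pdivrMr //; lra.
Qed.

Lemma poly_bounded p (r : R) : exists2 M : R, 0 <= M & forall z, cabs z <= r -> cabs p.[z] <= M.
Proof.
have [r0|r0] := leP 0 r; last first.
  by exists 0 => // z /(le_trans (cabs_ge0 z)) /(lt_le_trans r0); rewrite ltxx.
exists (\sum_(i < size p) cabs p`_i * r ^+ i).
  by apply: sumr_ge0 => i _; rewrite mulr_ge0 ?cabs_ge0 ?exprn_ge0.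
move=> z hz; rewrite horner_coef; apply: le_trans (cabs_sum _ _ _) _.
apply: ler_sum => i _; rewrite cabsM cabsX ler_wpM2l ?cabs_ge0 //.
by rewrite lerXn2r ?nnegrE ?cabs_ge0.
Qed.

Lemma small_pow (q K e : R) : 0 <= q -> q < 1 -> 0 < e -> exists n, K * q ^+ n <= e.
Proof.
move=> q0 q1 e0; have [K0|K0] := leP K 0.
  exists 0; rewrite expr0 mulr1; exact: le_trans K0 (ltW e0).
have qn : `|q| < 1 by rewrite ger0_norm.
have /cvgrPdist_le/(_ (e / K) (divr_gt0 e0 K0)) [n _ /(_ n (leqnn n))] := cvg_expr qn.
rewrite sub0r normrN ger0_norm ?exprn_ge0 // => h; exists n.
by rewrite mulrC -ler_pdivlMr.
Qed.

Definition an (a : C) (r : R) f := forall e : R, 0 < e -> exists p,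
  forall z, cabs (z - a) <= r -> cabs (f z - p.[z - a]) <= e.

Lemma an_lim a r f : (forall e : R, 0 < e -> exists2 g, an a r g &
  forall z, cabs (z - a) <= r -> cabs (f z - g z) <= e) -> an a r f.
Proof.
move=> h e e0; have e2 : 0 < e / 2 by lra.
have [g /(_ _ e2)[p hp] hg] := h _ e2; exists p => z hz.
by apply: le_trans (cabs_tri (g z) _ _) _; have := hp z hz; have := hg z hz; lra.
Qed.

Lemma an_ext a r f g : (forall z, cabs (z - a) <= r -> f z = g z) -> an a r f -> an a r g.
Proof.
by move=> fg hf e e0; have [p hp] := hf _ e0; exists p => z hz; rewrite -fg // hp.
Qed.

Lemma an_poly a r p : an a r (fun z => p.[z]).
Proof.
move=> e e0; exists (p \Po ('X + a%:P)) => z _.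
by rewrite horner_comp !hornerE subrK subrr cabs0 ltW.
Qed.

Lemma an_cst a r c : an a r (fun=> c).
Proof. by apply: an_ext (an_poly a r c%:P) => z _; rewrite hornerC. Qed.

Lemma an_id a r : an a r (fun z => z).
Proof. by apply: an_ext (an_poly a r 'X) => z _; rewrite hornerX. Qed.

Lemma an_bounded a r f : an a r f ->
  exists2 M : R, 0 <= M & forall z, cabs (z - a) <= r -> cabs (f z) <= M.
Proof.
move=> /(_ 1 ltr01)[p hp]; have [M M0 hM] := poly_bounded p r.
exists (M + 1) => [|z hz]; first lra.
rewrite -[f z](subrK p.[z - a]); apply: le_trans (cabsD _ _) _.
by have := hp z hz; have := hM _ hz; lra.
Qed.

Lemma anD a r f g : an a r f -> an a r g -> an a r (fun z => f z + g z).
Proof.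
move=> hf hg e e0; have e2 : 0 < e / 2 by lra.
have [p hp] := hf _ e2; have [q hq] := hg _ e2; exists (p + q) => z hz.
rewrite hornerD opprD addrACA; apply: le_trans (cabsD _ _) _.
by have := hp z hz; have := hq z hz; lra.
Qed.

Lemma anM a r f g : an a r f -> an a r g -> an a r (fun z => f z * g z).
Proof.
move=> hf hg e e0.
have [M M0 hM] := an_bounded hf; have [M' M0' hM'] := an_bounded hg.
pose K := M + M' + 2; have K0 : 0 < K by rewrite /K; lra.
pose e1 := Num.min 1 (e / K).
have e10 : 0 < e1 by rewrite lt_min ltr01 divr_gt0.
have e11 : e1 <= 1 by rewrite ge_min lexx.
have eK : e1 * K <= e by rewrite -ler_pdivlMr // ge_min lexx orbT.
have [p hp] := hf _ e10; have [q hq] := hg _ e10; exists (p * q) => z hz.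
rewrite hornerM.
have -> : f z * g z - p.[z - a] * q.[z - a] = f z * (g z - q.[z - a]) + (f z - p.[z - a]) * g z
  - (f z - p.[z - a]) * (g z - q.[z - a]) by ring.
apply: le_trans (cabsB_le _ _) _.
have h1 := hp z hz; have h2 := hq z hz; have h3 := hM z hz; have h4 := hM' z hz.
have k1 : cabs (f z * (g z - q.[z - a])) <= M * e1 by rewrite cabsM ler_pM ?cabs_ge0.
have k2 : cabs ((f z - p.[z - a]) * g z) <= e1 * M' by rewrite cabsM ler_pM ?cabs_ge0.
have k3 : cabs ((f z - p.[z - a]) * (g z - q.[z - a])) <= e1 * 1.
  by rewrite cabsM ler_pM ?cabs_ge0 // (le_trans h2).
have k4 := cabsD (f z * (g z - q.[z - a])) ((f z - p.[z - a]) * g z).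
apply: le_trans eK; rewrite /K; lra.
Qed.

Lemma an_sum (I : Type) (s : seq I) (P : pred I) (F : I -> C -> C) a r :
  (forall i, P i -> an a r (F i)) -> an a r (fun z => \sum_(i <- s | P i) F i z).
Proof.
move=> h; elim: s => [|i s IH].
  by apply: an_ext (an_cst a r 0) => z _; rewrite big_nil.
case Pi : (P i); last by apply: an_ext IH => z _; rewrite big_cons Pi.
by apply: an_ext (anD (h i Pi) IH) => z _; rewrite big_cons Pi.
Qed.

Lemma an_exp a r f n : an a r f -> an a r (fun z => f z ^+ n).
Proof.
move=> hf; elim: n => [|n IH]; first exact: an_cst.
by apply: an_ext (anM hf IH) => z _; rewrite exprS.
Qed.

Lemma anN a r f : an a r f -> an a r (fun z => - f z).
Proof. by move=> /(anM (an_cst a r (-1))); apply: an_ext => z _; rewrite mulN1r. Qed.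

Lemma anB a r f g : an a r f -> an a r g -> an a r (fun z => f z - g z).
Proof. by move=> hf /anN; apply: anD. Qed.

Lemma anZ a r c f : an a r f -> an a r (fun z => c * f z).
Proof. by apply: anM; exact: an_cst. Qed.

Lemma geom_inverse (x : C) (q : R) n : q < 1 -> cabs (1 - x) <= q ->
  cabs (x^-1 - \sum_(j < n) (1 - x) ^+ j) <= (1 - q)^-1 * q ^+ n.
Proof.
move=> q1 hx; have q0 : 0 <= q := le_trans (cabs_ge0 _) hx.
have lb : 1 - q <= cabs x.
  by have := cabs_lbB 1 (1 - x); rewrite cabs1 subKr; lra.
have x0 : x != 0 by rewrite -cabs_gt0; lra.
have -> : \sum_(j < n) (1 - x) ^+ j = (1 - (1 - x) ^+ n) / x.
  have -> : 1 - (1 - x) ^+ n = x * \sum_(j < n) (1 - x) ^+ j.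
    have -> : 1 - (1 - x) ^+ n = - ((1 - x) ^+ n - 1) by ring.
    by rewrite subrX1 -mulNr; congr (_ * _); ring.
  by rewrite mulrC mulKf.
have -> : x^-1 - (1 - (1 - x) ^+ n) / x = x^-1 * (1 - x) ^+ n by field.
rewrite cabsM cabsV cabsX ler_pM ?invr_ge0 ?cabs_ge0 ?exprn_ge0 ?cabs_ge0 //.
  by rewrite lef_pV2 // posrE; lra.
by rewrite lerXn2r ?nnegrE ?cabs_ge0.
Qed.

Lemma an_inv a r f (q : R) : q < 1 -> an a r f ->
  (forall z, cabs (z - a) <= r -> cabs (1 - f z) <= q) -> an a r (fun z => (f z)^-1).
Proof.
move=> q1 hf hq; apply: an_lim => e e0.
have [q0|q0] := ltP q 0.
  exists (fun=> 0); first exact: an_cst.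
  by move=> z /hq /(le_trans (cabs_ge0 _)) /(le_lt_trans) /(_ q0); rewrite ltxx.
have [n hn] := small_pow (1 - q)^-1 q0 q1 e0.
exists (fun z => \sum_(j < n) (1 - f z) ^+ j).
  by apply: an_sum => j _; apply: an_exp; apply: anB => //; exact: an_cst.
by move=> z hz; apply: le_trans hn; apply: geom_inverse => //; exact: hq.
Qed.

(** Nonvanishing suffices, without the closeness to 1 of [an_inv]: the polynomial splits, and for a
    root b outside the disc (z - b) / (a - b) stays within r / |b - a| < 1 of 1. *)
Lemma an_poly_inv a (r : R) p : (forall z, cabs (z - a) <= r -> p.[z] != 0) ->
  an a r (fun z => p.[z]^-1).
Proof.
move=> hp; have [r0|r0] := leP 0 r; last first.
  apply: an_ext (an_cst a r 0) => z /(le_trans (cabs_ge0 _)) /(lt_le_trans r0).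
  by rewrite ltxx.
have [s Ds] := closed_field_poly_normal p.
have hs z : p.[z] = lead_coef p * \prod_(b <- s) (z - b).
  rewrite {1}Ds hornerZ horner_prod; congr (_ * _).
  by apply: eq_bigr => b _; rewrite !hornerE.
have sb : forall b, b \in s -> r < cabs (b - a).
  move=> b bs; rewrite ltNge; apply/negP => /hp; rewrite hs.
  by rewrite (big_rem b) //= subrr mul0r mulr0 eqxx.
suff H : an a r (fun z => (lead_coef p)^-1 * \prod_(b <- s) (z - b)^-1).
  by apply: an_ext H => z _; rewrite hs invfM prodfV.
apply: anZ; elim: s {Ds hs} sb => [|b s IH] sb.
  by apply: an_ext (an_cst a r 1) => z _; rewrite big_nil.
suff H : an a r (fun z => (z - b)^-1).
  apply: an_ext (anM H (IH _)) => [z _|c cs]; first by rewrite big_cons.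
  by apply: sb; rewrite inE cs orbT.
have rb : r < cabs (b - a) by apply: sb; rewrite inE eqxx.
have b0 : 0 < cabs (b - a) by exact: le_lt_trans r0 rb.
have ba : b - a != 0 by rewrite -cabs_gt0.
have q1 : r / cabs (b - a) < 1 by rewrite ltr_pdivrMr // mul1r.
have H : an a r (fun z => ((a - b)^-1 * (z - b))^-1).
  apply: (an_inv q1); first by apply: anZ; apply: anB; [exact: an_id|exact: an_cst].
  move=> z hz; have -> : 1 - (a - b)^-1 * (z - b) = (z - a) / (b - a).
    by field; rewrite ba -opprB oppr_eq0 ba.
  by rewrite cabsM cabsV ler_wpM2r // invr_ge0 cabs_ge0.
apply: an_ext (anZ (a - b)^-1 H) => z _.
by rewrite invfM invrK mulrA mulVf ?mul1r // -opprB oppr_eq0.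
Qed.

Lemma an_recenter a b (r r' : R) f : cabs (b - a) + r' <= r -> an a r f -> an b r' f.
Proof.
move=> hr hf e e0; have [p hp] := hf _ e0.
exists (p \Po ('X + (b - a)%:P)) => z hz.
rewrite horner_comp hornerD hornerX hornerC.
have -> : z - b + (b - a) = z - a by ring.
by apply: hp; apply: le_trans (cabs_tri b _ _) _; lra.
Qed.

Lemma an_shrink a (r r' : R) f : r' <= r -> an a r f -> an a r' f.
Proof. by move=> h; apply: an_recenter; rewrite subrr cabs0 add0r. Qed.

(** A maximum principle on the half disc with the constant 2, weaker than the sharp one but a
    consequence of coefficient bounds alone. *)
Lemma an_circle a (r M : R) f z : 0 < r -> an a r f ->
  (forall z, cabs (z - a) = r -> cabs (f z) <= M) -> cabs (z - a) <= r / 2 ->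
  cabs (f z) <= 2 * M.
Proof.
move=> r0 hf hM hz; apply/ler_addgt0Pr => e' e0'.
have e3 : 0 < e' / 3 by lra.
have [p hp] := hf _ e3.
have hpM w : cabs w = r -> cabs p.[w] <= M + e' / 3.
  move=> hw; have wa : cabs (w + a - a) = r by rewrite addrK.
  have := hM _ wa; have := hp _ (_ : cabs (w + a - a) <= r); rewrite wa lexx addrK => /(_ isT).
  by have := cabs_lb p.[w] (f (w + a) - p.[w]); rewrite [p.[w] + _]addrC subrK; lra.
have := poly_tail 0 r0 hpM hz; rewrite big_ord0 subr0 expr0 mulr1.
have := hp z; have -> : cabs (z - a) <= r by lra.
move=> /(_ isT).
by have := cabsD (f z - p.[z - a]) p.[z - a]; rewrite subrK; lra.
Qed.

(** The derivative d is the limit of the linear coefficients of approximating polynomials, a Cauchy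
    sequence by [coef_bound]; the estimate is [poly_tail] for k = 2, passed to the limit. *)
Lemma an_quad a (r M : R) f : 0 < r -> an a r f ->
  (forall z, cabs (z - a) = r -> cabs (f z) <= M) ->
  exists2 d, cabs d * r <= M & forall z, cabs (z - a) <= r / 2 ->
    cabs (f z - f a - d * (z - a)) <= 2 * M * (cabs (z - a) / r) ^+ 2.
Proof.
move=> r0 hf hM.
have [en en0 hinv] : exists2 en : nat -> R, forall n, 0 < en n &
    forall e, 0 < e -> exists N : nat, forall n, (N <= n)%N -> en n <= e.
  exists (fun n => n.+1%:R^-1) => [n|e e0]; first by rewrite invr_gt0 ltr0n.
  exists (Num.truncn e^-1) => n hn.
  rewrite -[e]invrK lef_pV2 ?posrE ?invr_gt0 ?ltr0n //.
  apply: ltW; apply: lt_le_trans (truncnS_gt _) _.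
  by rewrite ler_nat.
have /choice[p hp] : forall n, exists p, forall z, cabs (z - a) <= r -> cabs (f z - p.[z - a]) <= en n.
  by move=> n; apply: hf.
have hpM n w : cabs w = r -> cabs (p n).[w] <= M + en n.
  move=> hw; have wa : cabs (w + a - a) = r by rewrite addrK.
  have := hM _ wa; have := hp n (w + a); rewrite wa lexx addrK => /(_ isT).
  by have := cabs_lb (p n).[w] (f (w + a) - (p n).[w]); rewrite [(p n).[w] + _]addrC subrK; lra.
have [d hd] : exists d : C, forall e, 0 < e -> exists N, forall n, (N <= n)%N -> cabs ((p n)`_1 - d) <= e.
  apply: ccauchy_cvg => e e0.
  have er : 0 < e * r / 2 by rewrite !(divr_gt0, mulr_gt0).
  have [N hN] := hinv _ er; exists N => n m hn hm.
  have := @coef_bound (p n - p m) r (e * r) 1 r0; rewrite coefB expr1 ler_pM2r //; apply.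
  move=> w hw; rewrite hornerD hornerN.
  have wa : cabs (w + a - a) <= r by rewrite addrK hw.
  have := hp n _ wa; have := hp m _ wa; rewrite addrK.
  have -> : (p n).[w] - (p m).[w] = (f (w + a) - (p m).[w]) - (f (w + a) - (p n).[w]) by ring.
  have := hN n hn; have := hN m hm.
  have := cabsB_le (f (w + a) - (p m).[w]) (f (w + a) - (p n).[w]); lra.
exists d.
  apply/ler_addgt0Pr => e e0.
  have r1 : 0 < e / 2 / r by rewrite !divr_gt0.
  have e2 : 0 < e / 2 by lra.
  have [N hN] := hd _ r1; have [N' hN'] := hinv _ e2.
  have k1 := hN (maxn N N') (leq_maxl _ _); have k2 := hN' (maxn N N') (leq_maxr _ _).
  have := coef_bound 1 r0 (hpM (maxn N N')); rewrite expr1.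
  have : cabs d * r <= cabs (p (maxn N N'))`_1 * r + e / 2.
    rewrite -[e / 2](divfK (lt0r_neq0 r0)) -mulrDl ler_wpM2r ?(ltW r0) //.
    have := cabs_lbB d (d - (p (maxn N N'))`_1); rewrite subKr [cabs (d - _)]cabsBC; lra.
  lra.
move=> z hz; apply/ler_addgt0Pr => e e0.
have e1 : 0 < Num.min (e / 8) (e / 4 / r).
  by rewrite lt_min; apply/andP; split; rewrite !divr_gt0.
have [N hN] := hd _ e1; have [N' hN'] := hinv _ e1.
have k1 := hN (maxn N N') (leq_maxl _ _); have k2 := hN' (maxn N N') (leq_maxr _ _).
have := poly_tail 2 r0 (hpM (maxn N N')) hz.
move: k1 k2; set n := maxn N N'; rewrite !le_min => /andP[_ k1] /andP[k2 _].
rewrite !big_ord_recl big_ord0 /= addr0 expr0 mulr1 expr1.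
have za : cabs (z - a) <= r by lra.
have aa : cabs (a - a) <= r by rewrite subrr cabs0 ltW.
have := hp n _ za; have := hp n _ aa; rewrite subrr horner_coef0.
set P := (p n).[_]; set P0 := (p n)`_0; set P1 := (p n)`_1 => h1 h2 h3.
have -> : f z - f a - d * (z - a) = (f z - P) - (f a - P0) + (P - (P0 + P1 * (z - a))) + (P1 - d) * (z - a) by ring.
apply: le_trans (cabsD _ _) _.
have h4 : cabs ((P1 - d) * (z - a)) <= e / 4.
  rewrite cabsM -[e / 4](divfK (lt0r_neq0 r0)).
  by apply: ler_pM; rewrite ?cabs_ge0.
have h5 := cabsD (f z - P - (f a - P0)) (P - (P0 + P1 * (z - a))).
have h6 := cabsB_le (f z - P) (f a - P0).
have h7 : 2 * (M + en n) * (cabs (z - a) / r) ^+ 2 <= 2 * M * (cabs (z - a) / r) ^+ 2 + 2 * en n.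
  have t0 : 0 <= cabs (z - a) / r by rewrite divr_ge0 ?cabs_ge0 // ltW.
  have t1 : cabs (z - a) / r <= 1 by rewrite ler_pdivrMr // mul1r.
  have t2 : (cabs (z - a) / r) ^+ 2 <= 1 by exact: exprn_ile1.
  have := ltW (en0 n); move: t2 (sqr_ge0 (cabs (z - a) / r)); set T := _ ^+ 2; nra.
lra.
Qed.

Lemma an_cder a (r : R) f z : cabs (z - a) < r -> an a r f -> exists d, cder f z d.
Proof.
move=> hz hf; pose r' := r - cabs (z - a).
have r0 : 0 < r' by rewrite /r'; lra.
have hf' : an z r' f by apply: an_recenter hf; rewrite /r'; lra.
have [M M0 hM] := an_bounded hf'.
have hM' w : cabs (w - z) = r' -> cabs (f w) <= M by move=> hw; apply: hM; rewrite hw.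
have [d _ hd] := an_quad r0 hf' hM'.
exists d => e e0.
pose K := 2 * M / r' ^+ 2 + 1.
have K0 : 0 < K.
  by apply: ltr_wpDl => //; apply: divr_ge0; [exact: mulr_ge0|exact: sqr_ge0].
exists (Num.min (r' / 2) (e / K)) => [|h].
  by rewrite lt_min !divr_gt0.
rewrite lt_min => /andP[h1 h2].
have := hd (z + h); rewrite [z + h]addrC addrK => /(_ (ltW h1)) /le_trans; apply.
have -> : 2 * M * (cabs h / r') ^+ 2 = (2 * M / r' ^+ 2) * cabs h * cabs h.
  by field; rewrite gt_eqF.
rewrite ler_wpM2r ?cabs_ge0 //.
move: h2; rewrite ltr_pdivlMr // => /ltW; apply: le_trans.
by rewrite mulrC ler_wpM2l ?cabs_ge0 // lerDl.
Qed.

Lemma an_cder1 a (r : R) f z : cabs (z - a) < r -> an a r f -> cder f z (derive1 f z).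
Proof. by move=> h1 /(an_cder h1)[d hd]; rewrite (cder_derive1 hd). Qed.

Lemma an_der_bound a (r M : R) f z : 0 < r -> an a r f ->
  (forall z, cabs (z - a) <= r -> cabs (f z) <= M) -> cabs (z - a) <= r / 2 ->
  cabs (derive1 f z) <= 2 * M / r.
Proof.
move=> r0 hf hM hz; have r2 : 0 < r / 2 by lra.
have hf' : an z (r / 2) f by apply: an_recenter hf; lra.
have hM' w : cabs (w - z) = r / 2 -> cabs (f w) <= M.
  by move=> hw; apply: hM; apply: le_trans (cabs_tri z _ _) _; lra.
have [d h1 h2] := an_quad r2 hf' hM'.
suff -> : derive1 f z = d by rewrite ler_pdivlMr //; lra.
apply: cder_derive1 => e e0.
have M0 : 0 <= M by apply: le_trans (cabs_ge0 _) (hM z _); lra.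
pose K := 2 * M / (r / 2) ^+ 2 + 1.
have K0 : 0 < K.
  by apply: ltr_wpDl => //; apply: divr_ge0; [exact: mulr_ge0|exact: sqr_ge0].
exists (Num.min (r / 2 / 2) (e / K)) => [|h].
  by rewrite lt_min !divr_gt0.
rewrite lt_min => /andP[k1 k2].
have := h2 (z + h); rewrite [z + h]addrC addrK => /(_ (ltW k1)) /le_trans; apply.
have -> : 2 * M * (cabs h / (r / 2)) ^+ 2 = (2 * M / (r / 2) ^+ 2) * cabs h * cabs h.
  by field; rewrite gt_eqF.
rewrite ler_wpM2r ?cabs_ge0 //.
move: k2; rewrite ltr_pdivlMr // => /ltW; apply: le_trans.
by rewrite mulrC ler_wpM2l ?cabs_ge0 // lerDl.
Qed.

Lemma an_derive1 a (r : R) f : 0 < r -> an a r f -> an a (r / 2) (derive1 f).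
Proof.
move=> r0 hf e e0.
have er : 0 < e * r / 2 by rewrite !(divr_gt0, mulr_gt0).
have [p hp] := hf _ er; exists p^`() => z hz.
have zr : cabs (z - a) < r by lra.
have H : an a r (fun z => f z - p.[z - a]).
  apply: anB => //; apply: an_ext (an_poly a r (p \Po ('X - a%:P))) => w _.
  by rewrite horner_comp !hornerE.
have := an_der_bound r0 H hp hz.
have -> : 2 * (e * r / 2) / r = e by field; rewrite gt_eqF.
suff -> : derive1 (fun z => f z - p.[z - a]) z = derive1 f z - p^`().[z - a] by [].
apply: cder_derive1; apply: cderB; first exact: an_cder1 hf.
have := @cder_shift _ (- a) (fun w => p.[w]) z p^`().[z - a].
rewrite addrC => /(_ (cder_horner p _)).
by apply: cder_local ltr01 _ => w _; rewrite addrC.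
Qed.

(** Points at distance at most r / 4 are compared through [an_quad] centred at one of them, on a
    disc of radius r / 2; for the others the crude bound 2 M is enough. *)
Lemma an_lip a (r M : R) f z w : 0 < r -> an a r f ->
  (forall z, cabs (z - a) <= r -> cabs (f z) <= M) ->
  cabs (z - a) <= r / 2 -> cabs (w - a) <= r / 2 ->
  cabs (f z - f w) <= 8 * M / r * cabs (z - w).
Proof.
move=> r0 hf hM hz hw.
have M0 : 0 <= M by apply: le_trans (cabs_ge0 _) (hM z _); lra.
have [h|h] := leP (cabs (z - w)) (r / 4); last first.
  apply: (@le_trans _ _ (2 * M)).
    apply: le_trans (cabsB_le _ _) _.
    have zr : cabs (z - a) <= r by lra.
    have wr : cabs (w - a) <= r by lra.
    by have := hM z zr; have := hM w wr; lra.
  have -> : 2 * M = 8 * M / r * (r / 4) by field; rewrite gt_eqF.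
  by rewrite ler_wpM2l ?(ltW h) // !mulr_ge0 ?invr_ge0 ?(ltW r0).
have r2 : 0 < r / 2 by lra.
have hf' : an w (r / 2) f by apply: an_recenter hf; lra.
have hM' v : cabs (v - w) = r / 2 -> cabs (f v) <= M.
  by move=> hv; apply: hM; apply: le_trans (cabs_tri w _ _) _; lra.
have [d h1 h2] := an_quad r2 hf' hM'.
have zw : cabs (z - w) <= r / 2 / 2 by lra.
have := h2 z zw => h3.
have -> : f z - f w = (f z - f w - d * (z - w)) + d * (z - w) by ring.
apply: le_trans (cabsD _ _) _; rewrite cabsM.
have h4 : cabs d <= 2 * M / r by rewrite ler_pdivlMr //; lra.
have h5 : 2 * M * (cabs (z - w) / (r / 2)) ^+ 2 <= 2 * M / r * cabs (z - w).
  have -> : 2 * M * (cabs (z - w) / (r / 2)) ^+ 2 = 2 * M / r * cabs (z - w) * (4 * (cabs (z - w) / r)).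
    by field; rewrite gt_eqF.
  rewrite ler_piMr ?mulr_ge0 ?invr_ge0 ?cabs_ge0 ?(ltW r0) //.
  have : cabs (z - w) / r <= 4^-1 by rewrite ler_pdivrMr //; lra.
  lra.
have h6 : cabs d * cabs (z - w) <= 2 * M / r * cabs (z - w) by rewrite ler_wpM2r ?cabs_ge0.
have h7 : 0 <= 2 * M / r * cabs (z - w) by rewrite !mulr_ge0 ?invr_ge0 ?cabs_ge0 ?(ltW r0).
have -> : 8 * M / r = 4 * (2 * M / r) by ring.
lra.
Qed.

End PolynomialBounds.

(** * Several variables: uniform approximation on polydiscs around (1, ..., 1) *)

Section Polydiscs.
Variables (R : realType) (k : nat).
Local Notation C := (R[i] : numClosedFieldType).
Implicit Types (x y : 'I_k -> C) (f g : ('I_k -> C) -> C) (r : R) (i j l : 'I_k).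

Definition pdisc r x := forall i, cabs (x i - 1) <= r.
Definition opdisc r x := forall i, cabs (x i - 1) < r.

Lemma upd_same x i t : upd x i t i = t. Proof. by rewrite /upd eqxx. Qed.

Lemma upd_neq x i j t : j != i -> upd x i t j = x j.
Proof. by rewrite /upd => /negbTE ->. Qed.

Lemma upd_id x i : upd x i (x i) = x.
Proof. by apply/funext => j; rewrite /upd; case: eqP => [->|]. Qed.

Lemma upd_comm x i j s t : i != j -> upd (upd x i s) j t = upd (upd x j t) i s.
Proof.
move=> ij; apply/funext => l; rewrite /upd; case: (eqVneq l j) => [->|//].
by rewrite eq_sym (negbTE ij).
Qed.

Lemma pdisc_upd r x i t : pdisc r x -> cabs (t - 1) <= r -> pdisc r (upd x i t).
Proof. by move=> hx ht j; rewrite /upd; case: eqP. Qed.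

Lemma opdisc_upd r x i t : opdisc r x -> cabs (t - 1) < r -> opdisc r (upd x i t).
Proof. by move=> hx ht j; rewrite /upd; case: eqP. Qed.

Lemma pdisc_le r r' x : r' <= r -> pdisc r' x -> pdisc r x.
Proof. by move=> h hx i; exact: le_trans (hx i) h. Qed.

Lemma pdisc_opdisc r r' x : r' < r -> pdisc r' x -> opdisc r x.
Proof. by move=> h hx i; exact: le_lt_trans (hx i) h. Qed.

Lemma opdisc_pdisc r x : opdisc r x -> pdisc r x.
Proof. by move=> h i; exact: ltW. Qed.

(** Polynomial functions as an inductive closure, so that slices, partial derivatives and bounds all
    follow by induction. *)
Inductive mpf : (('I_k -> C) -> C) -> Prop :=
| mpf_cst (c : C) : mpf (fun=> c)
| mpf_var i : mpf (fun x => x i)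
| mpf_add f g : mpf f -> mpf g -> mpf (fun x => f x + g x)
| mpf_mul f g : mpf f -> mpf g -> mpf (fun x => f x * g x).

Lemma mpf_slice g x i : mpf g -> exists p : {poly C}, forall t, g (upd x i t) = p.[t].
Proof.
elim=> {g} [c|j|f g _ [p hp] _ [q hq]|f g _ [p hp] _ [q hq]].
- by exists c%:P => t; rewrite hornerC.
- case: (eqVneq j i) => [->|ji].
    by exists 'X => t; rewrite hornerX upd_same.
  by exists (x j)%:P => t; rewrite hornerC upd_neq.
- by exists (p + q) => t; rewrite hornerD hp hq.
- by exists (p * q) => t; rewrite hornerM hp hq.
Qed.

Lemma mpf_cder g i : mpf g -> exists2 g', mpf g' &
  forall x, cder (fun t => g (upd x i t)) (x i) (g' x).
Proof.
elim=> {g} [c|j|f g mf [f' mf' hf] mg [g' mg' hg]|f g mf [f' mf' hf] mg [g' mg' hg]].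
- by exists (fun=> 0) => [|x]; [exact: mpf_cst|exact: cder_cst].
- case: (eqVneq j i) => [->|ji].
    exists (fun=> 1) => [|x]; first exact: mpf_cst.
    by apply: cder_local ltr01 _ (cder_id _) => w _; rewrite upd_same.
  exists (fun=> 0) => [|x]; first exact: mpf_cst.
  by apply: cder_local ltr01 _ (cder_cst (x j) _) => w _; rewrite upd_neq.
- exists (fun x => f' x + g' x) => [|x]; first exact: mpf_add.
  exact: cderD.
- exists (fun x => f' x * g x + f x * g' x) => [|x].
    by apply: mpf_add; exact: mpf_mul.
  by have := cderM (hf x) (hg x); rewrite upd_id.
Qed.

Lemma mpf_bounded g r : 0 <= r -> mpf g ->
  exists2 M : R, 0 <= M & forall x, pdisc r x -> cabs (g x) <= M.
Proof.
move=> r0; elim=> {g} [c|j|f g _ [M M0 hM] _ [M' M0' hM']|f g _ [M M0 hM] _ [M' M0' hM']].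
- by exists (cabs c) => //; exact: cabs_ge0.
- exists (r + 1) => [|x /(_ j) h]; first lra.
  by have := cabsD (x j - 1) 1; rewrite subrK cabs1; lra.
- exists (M + M') => [|x hx]; first lra.
  by apply: le_trans (cabsD _ _) _; exact: lerD (hM _ hx) (hM' _ hx).
- exists (M * M') => [|x hx]; first exact: mulr_ge0.
  by rewrite cabsM ler_pM ?cabs_ge0 ?hM ?hM'.
Qed.

Definition man r f := forall e : R, 0 < e -> exists2 g, mpf g &
  forall x, pdisc r x -> cabs (f x - g x) <= e.

Lemma man_lim r f : (forall e : R, 0 < e -> exists2 g, man r g &
  forall x, pdisc r x -> cabs (f x - g x) <= e) -> man r f.
Proof.
move=> h e e0; have e2 : 0 < e / 2 by lra.
have [g /(_ _ e2)[p mp hp] hg] := h _ e2; exists p => // x hx.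
by apply: le_trans (cabs_tri (g x) _ _) _; have := hp x hx; have := hg x hx; lra.
Qed.

Lemma man_ext r f g : (forall x, pdisc r x -> f x = g x) -> man r f -> man r g.
Proof.
by move=> fg hf e e0; have [p mp hp] := hf _ e0; exists p => // x hx; rewrite -fg // hp.
Qed.

Lemma man_shrink r r' f : r' <= r -> man r f -> man r' f.
Proof.
by move=> h hf e e0; have [p mp hp] := hf _ e0; exists p => // x /(pdisc_le h); exact: hp.
Qed.

Lemma man_mpf r g : mpf g -> man r g.
Proof. by move=> mg e e0; exists g => // x _; rewrite subrr cabs0 ltW. Qed.

Lemma man_cst r c : man r (fun=> c). Proof. exact/man_mpf/mpf_cst. Qed.

Lemma man_var r i : man r (fun x => x i). Proof. exact/man_mpf/mpf_var. Qed.

Lemma man_bounded r f : 0 <= r -> man r f ->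
  exists2 M : R, 0 <= M & forall x, pdisc r x -> cabs (f x) <= M.
Proof.
move=> r0 /(_ 1 ltr01)[p mp hp]; have [M M0 hM] := mpf_bounded r0 mp.
exists (M + 1) => [|x hx]; first lra.
rewrite -[f x](subrK (p x)); apply: le_trans (cabsD _ _) _.
by have := hp x hx; have := hM _ hx; lra.
Qed.

Lemma manD r f g : man r f -> man r g -> man r (fun x => f x + g x).
Proof.
move=> hf hg e e0; have e2 : 0 < e / 2 by lra.
have [p mp hp] := hf _ e2; have [q mq hq] := hg _ e2.
exists (fun x => p x + q x) => [|x hx]; first exact: mpf_add.
rewrite opprD addrACA; apply: le_trans (cabsD _ _) _.
by have := hp x hx; have := hq x hx; lra.
Qed.

Lemma manM r f g : 0 <= r -> man r f -> man r g -> man r (fun x => f x * g x).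
Proof.
move=> r0 hf hg e e0.
have [M M0 hM] := man_bounded r0 hf; have [M' M0' hM'] := man_bounded r0 hg.
pose K := M + M' + 2; have K0 : 0 < K by rewrite /K; lra.
pose e1 := Num.min 1 (e / K).
have e10 : 0 < e1 by rewrite lt_min ltr01 divr_gt0.
have e11 : e1 <= 1 by rewrite ge_min lexx.
have eK : e1 * K <= e by rewrite -ler_pdivlMr // ge_min lexx orbT.
have [p mp hp] := hf _ e10; have [q mq hq] := hg _ e10.
exists (fun x => p x * q x) => [|x hx]; first exact: mpf_mul.
have -> : f x * g x - p x * q x = f x * (g x - q x) + (f x - p x) * g x
  - (f x - p x) * (g x - q x) by ring.
apply: le_trans (cabsB_le _ _) _.
have h1 := hp x hx; have h2 := hq x hx; have h3 := hM x hx; have h4 := hM' x hx.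
have k1 : cabs (f x * (g x - q x)) <= M * e1 by rewrite cabsM ler_pM ?cabs_ge0.
have k2 : cabs ((f x - p x) * g x) <= e1 * M' by rewrite cabsM ler_pM ?cabs_ge0.
have k3 : cabs ((f x - p x) * (g x - q x)) <= e1 * 1.
  by rewrite cabsM ler_pM ?cabs_ge0 // (le_trans h2).
have k4 := cabsD (f x * (g x - q x)) ((f x - p x) * g x).
apply: le_trans eK; rewrite /K; lra.
Qed.

Lemma man_sum (I : Type) (s : seq I) (P : pred I) (F : I -> ('I_k -> C) -> C) r :
  (forall n, P n -> man r (F n)) -> man r (fun x => \sum_(n <- s | P n) F n x).
Proof.
move=> h; elim: s => [|i s IH].
  by apply: man_ext (man_cst r 0) => x _; rewrite big_nil.
case Pi : (P i); last by apply: man_ext IH => x _; rewrite big_cons Pi.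
by apply: man_ext (manD (h i Pi) IH) => x _; rewrite big_cons Pi.
Qed.

Lemma man_prod (I : Type) (s : seq I) (P : pred I) (F : I -> ('I_k -> C) -> C) r : 0 <= r ->
  (forall n, P n -> man r (F n)) -> man r (fun x => \prod_(n <- s | P n) F n x).
Proof.
move=> r0 h; elim: s => [|i s IH].
  by apply: man_ext (man_cst r 1) => x _; rewrite big_nil.
case Pi : (P i); last by apply: man_ext IH => x _; rewrite big_cons Pi.
by apply: man_ext (manM r0 (h i Pi) IH) => x _; rewrite big_cons Pi.
Qed.

Lemma man_exp r f n : 0 <= r -> man r f -> man r (fun x => f x ^+ n).
Proof.
move=> r0 hf; elim: n => [|n IH]; first exact: man_cst.
by apply: man_ext (manM r0 hf IH) => x _; rewrite exprS.
Qed.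

Lemma manN r f : man r f -> man r (fun x => - f x).
Proof.
move=> hf e e0; have [g mg hg] := hf e e0.
exists (fun x => (-1) * g x) => [|x /hg]; first exact: mpf_mul (mpf_cst _) mg.
by rewrite mulN1r -cabsN opprB opprK addrC.
Qed.

Lemma manB r f g : man r f -> man r g -> man r (fun x => f x - g x).
Proof. by move=> hf /manN; apply: manD. Qed.

Lemma manZ r c f : 0 <= r -> man r f -> man r (fun x => c * f x).
Proof. by move=> r0; apply: manM => //; exact: man_cst. Qed.

Lemma man_inv r f (q : R) : 0 <= r -> q < 1 -> man r f ->
  (forall x, pdisc r x -> cabs (1 - f x) <= q) -> man r (fun x => (f x)^-1).
Proof.
move=> r0 q1 hf hq; apply: man_lim => e e0.
have q0 : 0 <= q.
  by apply: le_trans (cabs_ge0 _) (hq (fun=> 1) _) => i; rewrite subrr cabs0.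
have [n hn] := small_pow (1 - q)^-1 q0 q1 e0.
exists (fun x => \sum_(j < n) (1 - f x) ^+ j).
  by apply: man_sum => j _; apply: man_exp => //; apply: manB => //; exact: man_cst.
by move=> x hx; apply: le_trans hn; apply: geom_inverse => //; exact: hq.
Qed.

Lemma man_one r i (h : C -> C) : 0 <= r -> an 1 r h -> man r (fun x => h (x i)).
Proof.
move=> r0 hh; apply: man_lim => e e0; have [p hp] := hh e e0.
exists (fun x => p.[x i - 1]); last by move=> x hx; exact: hp.
elim/poly_ind: p {hp} => [|p c IH].
  by apply: man_ext (man_cst r 0) => x _; rewrite horner0.
have H := manD (manM r0 IH (manB (man_var r i) (man_cst r 1))) (man_cst r c).
by apply: man_ext H => x _; rewrite !hornerE.
Qed.

Lemma man_slice r f x i : man r f -> pdisc r x -> an 1 r (fun t => f (upd x i t)).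
Proof.
move=> hf hx; apply: an_lim => e e0; have [g mg hg] := hf e e0.
exists (fun t => g (upd x i t)) => [|t ht]; last exact/hg/pdisc_upd.
have [p hp] := mpf_slice x i mg.
by apply: an_ext (an_poly 1 r p) => t _; rewrite hp.
Qed.

Lemma man_cder r f x i : man r f -> opdisc r x ->
  cder (fun t => f (upd x i t)) (x i) (pd i f x).
Proof.
by move=> hf hx; apply: an_cder1 (hx i) _; exact: man_slice (opdisc_pdisc hx).
Qed.

Lemma pd_cder f x i d : cder (fun t => f (upd x i t)) (x i) d -> pd i f x = d.
Proof. exact: cder_derive1. Qed.

(** Cauchy's estimate for a slice of f - g. It gives both the stability of [man] under partial
    derivatives and the passage of uniform convergence to derivatives, each at half the radius. *)
Lemma pd_diff_bound r f g x i (e : R) : 0 < r -> man r f -> man r g ->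
  (forall y, pdisc r y -> cabs (f y - g y) <= e) -> pdisc (r / 2) x ->
  cabs (pd i f x - pd i g x) <= 2 * e / r.
Proof.
move=> r0 hf hg he hx.
have hxr : pdisc r x by apply: pdisc_le hx; lra.
have hxo : opdisc r x by apply: pdisc_opdisc hx; lra.
have H := man_slice i (manB hf hg) hxr.
have := an_der_bound r0 H (fun t ht => he _ (pdisc_upd i hxr ht)) (hx i).
rewrite (@cder_derive1 _ _ _ (pd i f x - pd i g x)) //.
exact: cderB (man_cder i hf hxo) (man_cder i hg hxo).
Qed.

Lemma man_pd r f i : 0 < r -> man r f -> man (r / 2) (pd i f).
Proof.
move=> r0 hf e e0.
have er : 0 < e * r / 2 by rewrite !(divr_gt0, mulr_gt0).
have [g mg hg] := hf _ er; have [g' mg' hg'] := mpf_cder i mg; exists g' => // x hx.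
have := pd_diff_bound i r0 hf (man_mpf r mg) hg hx.
rewrite (pd_cder (hg' x)).
by have -> : 2 * (e * r / 2) / r = e by field; rewrite gt_eqF.
Qed.

(** [an_circle] is applied to one coordinate after the other, each time trading a circle for the
    disc of half its radius at the cost of a factor 2. The radii may differ, which [man_generic]
    exploits. *)
Lemma man_torus r f (rho : 'I_k -> R) (M : R) : man r f ->
  (forall i, 0 < rho i <= r) ->
  (forall x, (forall i, cabs (x i - 1) = rho i) -> cabs (f x) <= M) ->
  forall x, (forall i, cabs (x i - 1) <= rho i / 2) -> cabs (f x) <= 2 ^+ k * M.
Proof.
move=> hf hr hM.
suff H m : (m <= k)%N -> forall x, (forall i : 'I_k, (i < m)%N -> cabs (x i - 1) <= rho i / 2) ->
    (forall i : 'I_k, (m <= i)%N -> cabs (x i - 1) = rho i) -> cabs (f x) <= 2 ^+ m * M.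
  move=> x hx; apply: (H k (leqnn k) x) => i hi; first exact: hx.
  by move: hi; rewrite leqNgt ltn_ord.
elim: m => [_ x _ hx|m IH hm x h1 h2]; first by rewrite expr0 mul1r; apply: hM => i; exact: hx.
pose i0 := Ordinal hm; have /andP[p1 p2] := hr i0.
rewrite exprS -mulrA -(upd_id x i0).
have hx : pdisc r x.
  move=> i; have /andP[q1 q2] := hr i; case: (ltnP i m.+1) => hi.
    by have := h1 i hi; lra.
  by rewrite h2.
have H := an_shrink p2 (man_slice i0 hf hx).
apply: (an_circle (z := x i0) p1 H) => [t ht|]; last by apply: h1; rewrite /=.
apply: (IH (ltnW hm)) => i hi.
  rewrite upd_neq; first by apply: h1; exact: leq_trans hi _.
  by apply/eqP => ii; move: hi; rewrite ii /= ltnn.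
case: (eqVneq i i0) => [->|ii0]; first by rewrite upd_same.
rewrite upd_neq //; apply: h2; rewrite ltn_neqAle hi andbT.
by apply: contra ii0 => /eqP mi; apply/eqP/val_inj.
Qed.

Definition uconv r (F : nat -> ('I_k -> C) -> C) f := forall e : R, 0 < e ->
  exists N0, forall N, (N0 <= N)%N -> forall x, pdisc r x -> cabs (F N x - f x) <= e.

Definition eman r (F : nat -> ('I_k -> C) -> C) :=
  exists N0, forall N, (N0 <= N)%N -> man r (F N).

Lemma uconv_shrink r r' F f : r' <= r -> uconv r F f -> uconv r' F f.
Proof.
move=> h hf e e0; have [N0 hN] := hf _ e0; exists N0 => N /hN H x hx.
by apply: H; exact: pdisc_le hx.
Qed.

Lemma uconv_man r F f : eman r F -> uconv r F f -> man r f.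
Proof.
move=> [N1 h1] h2; apply: man_lim => e e0; have [N0 hN] := h2 _ e0.
exists (F (maxn N1 N0)); first exact/h1/leq_maxl.
by move=> x hx; rewrite cabsBC; apply: hN => //; exact: leq_maxr.
Qed.

Lemma uconv_pd r F f i : 0 < r -> eman r F -> uconv r F f ->
  uconv (r / 2) (fun N => pd i (F N)) (pd i f).
Proof.
move=> r0 mF cF e e0; have mf := uconv_man mF cF.
have er : 0 < e * r / 2 by rewrite !(divr_gt0, mulr_gt0).
have [N0 h0] := cF _ er; have [N1 h1] := mF; exists (maxn N0 N1) => N.
rewrite geq_max => /andP[/h0 k0 /h1 k1] x hx.
have := pd_diff_bound i r0 k1 mf k0 hx.
by have -> : 2 * (e * r / 2) / r = e by field; rewrite gt_eqF.
Qed.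

Lemma ucauchy_uconv r F :
  (forall e : R, 0 < e -> exists N0, forall N M, (N0 <= N)%N -> (N0 <= M)%N ->
     forall x, pdisc r x -> cabs (F N x - F M x) <= e) -> exists f, uconv r F f.
Proof.
move=> h.
have /choice[f hf] : forall x, exists l : C, pdisc r x ->
    forall e, 0 < e -> exists N, forall n, (N <= n)%N -> cabs (F n x - l) <= e.
  move=> x; case: (pselect (pdisc r x)) => hx; last by exists 0.
  have [l hl] : exists l : C, forall e, 0 < e -> exists N, forall n, (N <= n)%N -> cabs (F n x - l) <= e.
    apply: ccauchy_cvg => e e0; have [N0 hN] := h _ e0.
    by exists N0 => n m hn hm; exact: hN.
  by exists l.
exists f => e e0; have e2 : 0 < e / 2 by lra.
have [N0 hN] := h _ e2; exists N0 => N hNN x hx.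
have [N1 h1] := hf x hx _ e2.
have := h1 _ (leq_maxr N0 N1); have := hN N _ hNN (leq_maxl N0 N1) x hx.
by have := cabs_tri (F (maxn N0 N1) x) (F N x) (f x); lra.
Qed.

Lemma near_inv_bound (z w : C) (c : R) : 0 < c -> c <= cabs z -> cabs (w - z) <= c / 2 ->
  c / 2 <= cabs w.
Proof. by move=> c0 hz; have := cabs_lbB z (z - w); rewrite subKr [cabs (z - w)]cabsBC; lra. Qed.

Lemma uconv_div r F G f g (M c : R) : 0 < c ->
  (forall x, pdisc r x -> cabs (f x) <= M) -> (forall x, pdisc r x -> c <= cabs (g x) <= M) ->
  uconv r F f -> uconv r G g -> uconv r (fun N x => F N x / G N x) (fun x => f x / g x).
Proof.
move=> c0 hf hg cF cG e e0.
have [M0|M0] := ltP M 0.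
  by exists 0 => N _ x /hf /(le_trans (cabs_ge0 _)) /le_lt_trans /(_ M0); rewrite ltxx.
pose K := 2 * M + 1; have K0 : 0 < K by rewrite /K; lra.
pose e1 := e * (c * (c / 2)) / K.
have e10 : 0 < e1 by rewrite !(divr_gt0, mulr_gt0).
have e20 : 0 < Num.min (c / 2) e1 by rewrite lt_min e10 divr_gt0.
have [N0 h0] := cF _ e10; have [N1 h1] := cG _ e20; exists (maxn N0 N1) => N.
rewrite geq_max => /andP[/h0 k0 /h1 k1] x hx.
have := k1 x hx; rewrite le_min => /andP[k2 k3]; have k4 := k0 x hx.
have /andP[g1 g2] := hg x hx; have f1 := hf x hx.
have g3 := near_inv_bound c0 g1 k2.
have gx : g x != 0 by rewrite -cabs_gt0; lra.
have Gx : G N x != 0 by rewrite -cabs_gt0; lra.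
have -> : F N x / G N x - f x / g x =
  ((F N x - f x) * g x - f x * (G N x - g x)) / (g x * G N x).
  by field; rewrite gx Gx.
rewrite cabsM cabsV cabsM.
have p0 : 0 < cabs (g x) * cabs (G N x) by apply: mulr_gt0; rewrite cabs_gt0.
rewrite ler_pdivrMr //.
apply: (@le_trans _ _ (e * (c * (c / 2)))); last first.
  rewrite ler_wpM2l ?(ltW e0) //; apply: ler_pM => //; lra.
have -> : e * (c * (c / 2)) = e1 * K by rewrite /e1 divfK // gt_eqF.
apply: le_trans (cabsB_le _ _) _; rewrite !cabsM.
have t1 : cabs (F N x - f x) * cabs (g x) <= e1 * M by apply: ler_pM; rewrite ?cabs_ge0.
have t2 : cabs (f x) * cabs (G N x - g x) <= M * e1 by apply: ler_pM; rewrite ?cabs_ge0.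
rewrite /K; lra.
Qed.

Lemma pd_local r f g x i : opdisc r x -> (forall y, opdisc r y -> f y = g y) ->
  pd i f x = pd i g x.
Proof.
move=> hx fg; apply: (@derive1_local _ _ _ _ (r - cabs (x i - 1))).
  by rewrite subr_gt0.
move=> w hw; apply: fg; apply: opdisc_upd => //.
by apply: le_lt_trans (cabs_tri (x i) _ _) _; rewrite -ltrBrDr.
Qed.

Definition indep i f := forall x t, f (upd x i t) = f x.

Lemma pd_indep i f x : indep i f -> pd i f x = 0.
Proof.
move=> hf; apply: pd_cder; apply: cder_local ltr01 _ (cder_cst (f x) _) => w _.
by rewrite hf.
Qed.

Lemma indep_pd i j f : i != j -> indep i f -> indep i (pd j f).
Proof.
move=> ij hf x t; rewrite /pd upd_neq; last by rewrite eq_sym.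
have E : (fun s => f (upd (upd x i t) j s)) = (fun s => f (upd x j s)).
  by apply/funext => s; rewrite upd_comm // hf.
exact: (congr1 (fun h : C -> C => derive1 h (x j)) E).
Qed.

Lemma indep_div i f g : indep i f -> indep i g -> indep i (fun x => f x / g x).
Proof. by move=> hf hg x t; rewrite hf hg. Qed.

Lemma derive1_addc (h : C -> C) (c z : C) : derive1 (fun t => h t + c) z = derive1 h z.
Proof.
rewrite /derive1.
have -> : (fun t : C => t^-1 *: (h (t + z) + c - (h z + c))) = (fun t : C => t^-1 *: (h (t + z) - h z)).
  by apply/funext => t; congr (_ *: _); rewrite opprD addrACA subrr addr0.
by [].
Qed.

Lemma pd_add_indep i f g x : indep i g -> pd i (fun y => f y + g y) x = pd i f x.
Proof.
move=> hg; rewrite /pd -(derive1_addc (fun t => f (upd x i t)) (g x)).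
have E : (fun t => f (upd x i t) + g (upd x i t)) = (fun t => f (upd x i t) + g x).
  by apply/funext => t; rewrite hg.
exact: (congr1 (fun h : C -> C => derive1 h (x i)) E).
Qed.

Lemma logM_quotient (a b u v : C) : u != 0 -> v != 0 ->
  (a * v + u * b) / (u * v) = a / u + b / v.
Proof. by move=> u0 v0; field; rewrite u0 v0. Qed.

Lemma pd_logM r f g x i : man r f -> man r g -> opdisc r x -> f x != 0 -> g x != 0 ->
  pd i (fun y => f y * g y) x / (f x * g x) = pd i f x / f x + pd i g x / g x.
Proof.
move=> mf mg hx fx gx; rewrite (pd_cder (cderM (man_cder i mf hx) (man_cder i mg hx))).
by rewrite upd_id; exact: logM_quotient.
Qed.

(** Logarithmic derivatives are additive: d_j kills log b at once, and d_j log a is still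
    independent of x_i. *)
Lemma dlog2_mul_indep r f a b i j x : i != j -> 0 <= r -> man r f -> man r a -> man r b ->
  (forall y, opdisc r y -> [/\ f y != 0, a y != 0 & b y != 0]) ->
  indep i a -> indep j b -> opdisc r x ->
  dlog2 i j (fun y => f y * (a y * b y)) x = dlog2 i j f x.
Proof.
move=> ij r0 mf ma mb nz ia ib hx.
have E y : opdisc r y -> pd j (fun y => f y * (a y * b y)) y / (f y * (a y * b y)) =
    pd j f y / f y + pd j a y / a y.
  move=> hy; have [h1 h2 h3] := nz y hy.
  have ab : man r (fun y => a y * b y) := manM r0 ma mb.
  have H1 := @pd_logM r f (fun y => a y * b y) y j mf ab hy h1 (mulf_neq0 h2 h3).
  have H2 := @pd_logM r a b y j ma mb hy h2 h3.
  rewrite (pd_indep y ib) mul0r addr0 in H2.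
  by apply: (etrans H1); congr (_ + _).
rewrite /dlog2 (pd_local i hx E); apply: pd_add_indep.
exact: indep_div (indep_pd ij ia) ia.
Qed.

(** The bound 1/4 puts [F N] within 1/2 of 1 for large N, hence makes it invertible by a geometric
    series. Each differentiation halves the radius. *)
Lemma dlog2_conv r F f i j : 0 < r -> eman r F -> uconv r F f ->
  (forall x, pdisc r x -> cabs (1 - f x) <= 4^-1) ->
  uconv (r / 2) (fun N y => pd j (F N) y / F N y) (fun y => pd j f y / f y) /\
  eman (r / 2) (fun N y => pd j (F N) y / F N y) /\
  uconv (r / 2 / 2) (fun N => dlog2 i j (F N)) (dlog2 i j f).
Proof.
move=> r0 mF cF hf; have mf := uconv_man mF cF.
have r2 : 0 < r / 2 by lra.
have lr : r / 2 <= r by lra.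
have [M M0 hM] := man_bounded (ltW r2) (man_pd j r0 mf).
have A : uconv (r / 2) (fun N y => pd j (F N) y / F N y) (fun y => pd j f y / f y).
  apply: (@uconv_div _ _ _ _ _ (M + 2) 2^-1) => [|x /hM|x /(pdisc_le lr) /hf h||]; first lra.
  - by move=> h; apply: le_trans h _; lra.
  - have := cabs_lbB 1 (1 - f x); rewrite subKr cabs1 => h1.
    have := cabsB_le 1 (1 - f x); rewrite subKr cabs1 => h2.
    by apply/andP; split; lra.
  - exact: uconv_pd.
  - exact: uconv_shrink cF.
have B : eman (r / 2) (fun N y => pd j (F N) y / F N y).
  have [N1 h1] := mF; have [N0 h0] := cF 4^-1 (ltac:(lra)).
  exists (maxn N0 N1) => N; rewrite geq_max => /andP[/h0 k0 /h1 k1].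
  apply: manM (ltW r2) (man_pd j r0 k1) _.
  apply: (@man_inv _ _ 2^-1) => //; [lra|lra|exact: man_shrink k1|].
  move=> x /(pdisc_le lr) hx; have := k0 x hx; have := hf x hx.
  by have := cabs_tri (f x) 1 (F N x); rewrite [cabs (f x - _)]cabsBC; lra.
by split=> //; split=> //; exact: uconv_pd.
Qed.

Lemma dlog3_conv r F f i j l : 0 < r -> eman r F -> uconv r F f ->
  (forall x, pdisc r x -> cabs (1 - f x) <= 4^-1) ->
  uconv (r / 2 / 2 / 2) (fun N => dlog3 i j l (F N)) (dlog3 i j l f).
Proof.
move=> r0 mF cF hf; have r2 : 0 < r / 2 by lra.
have r4 : 0 < r / 2 / 2 by lra.
have [h1 [h2 h3]] := dlog2_conv j l r0 mF cF hf.
apply: uconv_pd => //.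
by have [N0 hN] := h2; exists N0 => N /hN; exact: man_pd.
Qed.

End Polydiscs.

(** * The complex exponential and the principal logarithm near 1 *)

Section ComplexExponential.
Variable R : realType.
Local Notation C := (R[i] : numClosedFieldType).
Implicit Types (x y z h : C).

Definition cexp z : C :=
  Complex (expR (complex.Re z) * cos (complex.Im z)) (expR (complex.Re z) * sin (complex.Im z)).

Lemma cexpD x y : cexp (x + y) = cexp x * cexp y.
Proof.
case: x y => [a b] [c d]; rewrite /cexp /= expRD cosD sinD.
by apply/eqP; rewrite eq_complex /=; apply/andP; split; apply/eqP; ring.
Qed.

Lemma cexp0 : cexp 0 = 1.
Proof. by rewrite /cexp /= expR0 cos0 sin0 mulr1 mulr0. Qed.

Lemma cexp_neq0 z : cexp z != 0.
Proof.
apply/eqP => h; have := cexpD z (- z); rewrite subrr cexp0 h mul0r.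
by move/eqP; rewrite oner_eq0.
Qed.

Lemma cexpN z : cexp (- z) = (cexp z)^-1.
Proof.
apply: (mulfI (cexp_neq0 z)); rewrite -cexpD subrr cexp0 divff //.
exact: cexp_neq0.
Qed.

Lemma cexp_int z (l : int) : cexp (l%:~R * z) = cexp z ^ l.
Proof.
have nat_case (n : nat) : cexp (n%:R * z) = cexp z ^+ n.
  elim: n => [|n IH]; first by rewrite mul0r cexp0 expr0.
  by rewrite -natr1 mulrDl mul1r cexpD IH exprSr.
case: l => n; first exact: nat_case.
by rewrite NegzE mulrNz mulNr cexpN nat_case.
Qed.

Lemma is_derive_eps (f : R -> R) (x d e : R) : is_derive x 1 f d -> 0 < e ->
  exists2 dl : R, 0 < dl & forall t : R, `|t| < dl -> `|f (x + t) - f x - d * t| <= e * `|t|.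
Proof.
move=> hf e0; have hd := @ex_derive _ _ _ _ _ _ _ hf; have hv := @derive_val _ _ _ _ _ _ _ hf.
move: hd; rewrite /derivable => /cvgP; rewrite -/(derive f x 1) hv.
move=> /cvgrPdist_le /(_ e e0) [dl /= dl0 hdl].
exists dl => // h hh; have [->|h0] := eqVneq h 0.
  by rewrite addr0 subrr mulr0 subrr normr0 mulr0.
have := hdl h; rewrite /ball_ /= sub0r normrN => /(_ hh h0).
rewrite scaler1 [h + x]addrC => k.
rewrite -ler_pdivrMr ?normr_gt0 // -normfV -normrM; apply: le_trans k.
rewrite -normrN le_eqVlt; apply/orP; left; apply/eqP; congr (`|_|).
by rewrite /GRing.scale /=; field.
Qed.

Lemma cder_cexp0 : cder cexp 0 1.
Proof.
move=> e e0.
(* [e1 <= 1] keeps exp(Re h) below 3; the errors of the two coordinates then add up to at most 9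
   [e1] |h|. *)
have [e1 [e10 e11 e1e]] : exists e1 : R, [/\ 0 < e1, e1 <= 1 & e1 * 10 <= e].
  exists (Num.min 1 (e / 10)); split; first by rewrite lt_min ltr01 divr_gt0.
    by rewrite ge_min lexx.
  by rewrite -ler_pdivlMr // ge_min lexx orbT.
have [a a0 ha] := is_derive_eps (is_derive_expR 0) e10.
have [b b0 hb] := is_derive_eps (is_derive_cos 0) e10.
have [c c0 hc] := is_derive_eps (is_derive_sin 0) e10.
exists (Num.min e1 (Num.min a (Num.min b c))).
  by rewrite !lt_min e10 a0 b0 c0.
move=> h; rewrite !lt_min => /andP[k1 /andP[k2 /andP[k3 k4]]].
have r1 := cabs_Re h; have r2 := cabs_Im h.
have := ha _ (le_lt_trans r1 k2); have := hb _ (le_lt_trans r2 k3); have := hc _ (le_lt_trans r2 k4).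
rewrite add0r cexp0 mul1r !add0r expR0 cos0 sin0 oppr0 mul0r !subr0 !mul1r.
case: h k1 r1 r2 {k2 k3 k4} => [u v] /=; set H := cabs _ => k1 r1 r2 s1 s2 s3.
rewrite addr0 in s1; apply: (le_trans (cabs_ReIm _)); rewrite /= subr0.
set E := expR u in s3 *; set S := sin v in s1 *; set K := cos v in s2 *.
have E3 : `|E| <= 3.
  have -> : E = (E - 1 - u) + (1 + u) by ring.
  apply: le_trans (ler_normD _ _) _.
  have := ler_normD 1 u; rewrite normr1.
  have : e1 * `|u| <= 1 by nra.
  lra.
have EE : `|E - 1| <= 2 * `|u|.
  have -> : E - 1 = (E - 1 - u) + u by ring.
  apply: le_trans (ler_normD _ _) _.
  have : e1 * `|u| <= 1 * `|u| by rewrite ler_wpM2r.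
  lra.
have A : `|E * K - 1 - u| <= e1 * `|u| + 3 * (e1 * `|v|).
  have -> : E * K - 1 - u = (E - 1 - u) + E * (K - 1) by ring.
  apply: le_trans (ler_normD _ _) _; apply: lerD => //.
  by rewrite normrM; apply: ler_pM.
have B : `|E * S - v| <= 3 * (e1 * `|v|) + 2 * (e1 * `|v|).
  have -> : E * S - v = E * (S - v) + (E - 1) * v by ring.
  apply: le_trans (ler_normD _ _) _; apply: lerD.
    by rewrite normrM; apply: ler_pM.
  rewrite normrM mulrA ler_wpM2r //; apply: le_trans EE _.
  rewrite ler_pM2l //; lra.
have H0 : 0 <= H := cabs_ge0 _.
have P1 : e1 * `|u| <= e1 * H by rewrite ler_wpM2l // ltW.
have P2 : e1 * `|v| <= e1 * H by rewrite ler_wpM2l // ltW.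
have P3 : e1 * 10 * H <= e * H by rewrite ler_wpM2r.
have P4 : 0 <= e1 * H by rewrite mulr_ge0 // ltW.
by apply: le_trans (lerD A B) _; lra.
Qed.

Lemma cder_cexp z : cder cexp z (cexp z).
Proof.
have := @cder_shift _ (- z) cexp z 1; rewrite addNr => /(_ cder_cexp0) /(cderZ (cexp z)).
rewrite mulr1; apply: cder_local ltr01 _ => w _.
by rewrite -cexpD addrA subrr add0r.
Qed.

Lemma cexp_sub1_le : exists2 dl : R, 0 < dl &
  forall z, cabs z < dl -> cabs (cexp z - 1) <= 2 * cabs z.
Proof.
have [dl dl0 hd] := cder_lip cder_cexp0; exists dl => // z /hd.
by rewrite add0r cexp0 cabs1.
Qed.

Lemma Re_gt0_near1 x : cabs (x - 1) < 1 -> 0 < complex.Re x.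
Proof.
move=> h; have := le_lt_trans (cabs_Re _) h; case: x {h} => a b /=.
by rewrite ltr_norml => /andP[]; lra.
Qed.

Lemma cexp_Logc x : cabs (x - 1) < 1 -> cexp (Logc x) = x.
Proof.
move=> /Re_gt0_near1; case: x => a b /= a0.
rewrite /cexp /Logc /=; set r := cabs _; set v := b / a.
have v2 : 0 < 1 + v ^+ 2 by rewrite ltr_pwDl // sqr_ge0.
have rE : r = a * Num.sqrt (1 + v ^+ 2).
  rewrite /r /cabs /= -[a in RHS]ger0_norm ?(ltW a0) // -sqrtr_sqr -sqrtrM ?sqr_ge0 //.
  by congr Num.sqrt; rewrite /v; field; rewrite gt_eqF.
have s0 : 0 < Num.sqrt (1 + v ^+ 2) by rewrite sqrtr_gt0.
have r0 : 0 < r by rewrite rE mulr_gt0.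
have cE : cos (atan v) = (Num.sqrt (1 + v ^+ 2))^-1 := cos_atan v.
have sE : sin (atan v) = v * cos (atan v).
  have c0 : cos (atan v) != 0 by rewrite cE gt_eqF // invr_gt0.
  by rewrite -[LHS](divfK c0); congr (_ * _); exact: atanK v.
rewrite sE cE lnK ?posrE // rE; congr Complex.
  by rewrite mulfK // gt_eqF.
by rewrite /v; field; rewrite !gt_eqF.
Qed.

Lemma Logc_le : exists2 dl : R, 0 < dl < 1 / 2 &
  forall x, cabs (x - 1) < dl -> cabs (Logc x) <= 6 * cabs (x - 1).
Proof.
have [a a0 ha] := is_derive_eps (is_derive1_ln ltr01) ltr01.
have [b b0 hb] := is_derive_eps (is_derive1_atan 0) ltr01.
(* Within 1/4 of 1 the slope Im x / Re x is at most 2 |x - 1|; within a and b, the functions ln(1 +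
   .) and atan at most double their argument. This gives 2 + 4 = 6. *)
exists (Num.min (1 / 4) (Num.min a (b / 2))).
  rewrite !lt_min a0 divr_gt0 // gt_min; apply/andP; split; first by rewrite divr_gt0.
  by apply/orP; left; lra.
move=> x; rewrite !lt_min => /andP[h1 /andP[h2 h3]].
have c1 : `|cabs x - 1| <= cabs (x - 1).
  rewrite ler_norml; have := cabs_lbB x 1; have := cabs_lbB 1 x.
  by rewrite cabs1 [cabs (1 - x)]cabsBC => u v; apply/andP; split; lra.
have := ha (cabs x - 1) (le_lt_trans c1 h2).
rewrite [1 + _]addrC subrK ln1 subr0 invr1 !mul1r => l1.
have rx : 1 / 2 <= complex.Re x.
  have := le_trans (cabs_Re _) (ltW h1); case: (x) => u v /=.
  by rewrite ler_norml => /andP[]; lra.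
have ix : `|complex.Im x| <= cabs (x - 1).
  by apply: le_trans (cabs_Im _); case: (x) => u v /=; rewrite subr0.
have vx : `|complex.Im x / complex.Re x| <= 2 * cabs (x - 1).
  have r0 : 0 < complex.Re x by lra.
  rewrite normrM normfV (gtr0_norm r0) ler_pdivrMr //.
  have := cabs_ge0 (x - 1); nra.
have vb : `|complex.Im x / complex.Re x| < b by lra.
have := hb _ vb; rewrite add0r atan0 subr0 expr0n addr0 invr1 !mul1r => l2.
apply: le_trans (cabs_ReIm _) _; rewrite /Logc /=.
move: l1 l2 vx c1; set L := ln _; set A := atan _; set V := _ / _; set D := cabs x - 1.
move=> l1 l2 vx c1.
have : `|L| <= `|L - D| + `|D| by rewrite -{1}[L](subrK D) ler_normD.
have : `|A| <= `|A - V| + `|V| by rewrite -{1}[A](subrK V) ler_normD.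
lra.
Qed.

(** The upper bound keeps y = log x in the discs where the analysis in y is valid; the lower bound
    controls division by powers of log x. *)
Lemma Logc_ge : exists2 dl : R, 0 < dl < 1 / 2 &
  forall x, cabs (x - 1) < dl ->
    [/\ cabs (Logc x) <= 6 * cabs (x - 1) & cabs (x - 1) <= 2 * cabs (Logc x)].
Proof.
have [a /andP[a0 a1] ha] := Logc_le; have [b b0 hb] := cexp_sub1_le.
exists (Num.min a (b / 6)).
  by rewrite lt_min a0 divr_gt0 // gt_min a1.
move=> x; rewrite lt_min => /andP[h1 h2]; have h3 := ha x h1; split=> //.
by rewrite -{1}[x]cexp_Logc; [apply: hb; lra|lra].
Qed.

End ComplexExponential.

(** * Divided differences *)

Section DividedDifferences.
Variables (K : fieldType) (N : nat) (l : 'I_N -> K).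
Hypothesis l_inj : injective l.
Implicit Types (i j m : 'I_N) (h hd : 'I_N -> K) (p : {poly K}).

(** The barycentric weights; [dd h] is then the classical divided difference of h at all N nodes. *)
Definition ddw j : K := (\prod_(m | m != j) (l j - l m))^-1.

Definition dd h : K := \sum_j ddw j * h j.

(* The divided difference at the nodes l together with a second copy of the
   node [l i], where the function has derivative [hd]. *)
Definition dd2 i h (hd : K) : K :=
  ddw i * hd + \sum_(j | j != i) ddw j * ((h j - h i) / (l j - l i)).

Lemma node_neq i j : j != i -> l j - l i != 0.
Proof. by move=> ji; rewrite subr_eq0 (inj_eq l_inj). Qed.

Lemma ddw_neq0 j : ddw j != 0.
Proof.
by rewrite invr_eq0; apply/prodf_neq0 => m mj; apply: node_neq; rewrite eq_sym.
Qed.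

Definition lagr j : {poly K} := \prod_(m | m != j) ('X - (l m)%:P).

Lemma lagr_monic j : lagr j \is monic.
Proof. by apply: monic_prod => m _; exact: monicXsubC. Qed.

Lemma size_lagr j : size (lagr j) = N.
Proof.
rewrite size_prod => [|m _]; last by rewrite polyXsubC_eq0.
under eq_bigr do rewrite size_XsubC.
rewrite sum_nat_const; have := cardC1 j; rewrite card_ord => hc.
have -> : #|(fun m : 'I_N => m != j)| = N.-1 by rewrite -hc; apply: eq_card.
have := ltn_ord j; lia.
Qed.

Lemma lagr_node i j : (lagr j).[l i] = if i == j then (ddw j)^-1 else 0.
Proof.
rewrite horner_prod; case: eqVneq => [->|ij].
  by rewrite invrK; apply: eq_bigr => m _; rewrite !hornerE.
by apply/eqP/prodf_eq0; exists i => //; rewrite !hornerE subrr.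
Qed.

Lemma poly_nodes0 p : (size p <= N)%N -> (forall j, p.[l j] = 0) -> p = 0.
Proof.
move=> sp hp; apply: (@roots_geq_poly_eq0 _ p [seq l j | j <- enum 'I_N]).
- by apply/allP => _ /mapP[j _ ->]; apply/rootP.
- by rewrite map_inj_uniq // enum_uniq.
- by rewrite size_map size_enum_ord.
Qed.

Lemma lagr_interp p : (size p <= N)%N -> p = \sum_j (p.[l j] * ddw j) *: lagr j.
Proof.
move=> sp; apply/eqP; rewrite -subr_eq0; apply/eqP/poly_nodes0.
  apply: leq_trans (size_polyD _ _) _; rewrite geq_max sp size_polyN.
  apply: leq_trans (size_sum _ _ _) _; apply/bigmax_leqP => j _.
  by apply: leq_trans (size_scale_leq _ _) _; rewrite size_lagr.
move=> i; rewrite hornerD hornerN horner_sum (bigD1 i) //= big1 ?addr0.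
  by rewrite hornerZ lagr_node eqxx mulfK ?subrr // ddw_neq0.
by move=> j ji; rewrite hornerZ lagr_node eq_sym (negbTE ji) mulr0.
Qed.

Lemma dd_poly p : (size p <= N)%N -> dd (fun j => p.[l j]) = p`_(N.-1).
Proof.
move=> sp; rewrite {2}[p]lagr_interp // coef_sum; apply: eq_bigr => j _.
rewrite coefZ; have := lagr_monic j; rewrite monicE lead_coefE size_lagr => /eqP ->.
by rewrite mulr1 mulrC.
Qed.

(** Testing against the Lagrange polynomials isolates each c_j, and the weights do not vanish. *)
Lemma dd_moments0 (c : 'I_N -> K) :
  (forall n, (n < N)%N -> dd (fun j => l j ^+ n * c j) = 0) -> forall j, c j = 0.
Proof.
move=> hc j.
have hp p : (size p <= N)%N -> dd (fun j => p.[l j] * c j) = 0.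
  move=> sp; rewrite /dd.
  transitivity (\sum_(n < size p) p`_n * dd (fun j => l j ^+ n * c j)).
    under eq_bigr => i _ do rewrite horner_coef mulr_suml mulr_sumr.
    rewrite exchange_big /=; apply: eq_bigr => n _; rewrite /dd mulr_sumr.
    by apply: eq_bigr => i _; ring.
  apply: big1 => n _; rewrite hc ?mulr0 //.
  exact: leq_trans (ltn_ord n) sp.
have := hp (lagr j); rewrite size_lagr => /(_ (leqnn N)).
rewrite /dd (bigD1 j) //= big1 ?addr0.
  by rewrite lagr_node eqxx mulrA divff ?mul1r // ddw_neq0.
by move=> i ij; rewrite lagr_node (negbTE ij) mul0r mulr0.
Qed.

Lemma horner_deriv_prod_XsubC (I : Type) (s : seq I) (P : pred I) (b : I -> K) (z : K) :
  (forall n, P n -> z != b n) ->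
  ((\prod_(n <- s | P n) ('X - (b n)%:P))^`()).[z] =
  \prod_(n <- s | P n) (z - b n) * \sum_(n <- s | P n) (z - b n)^-1.
Proof.
move=> hP; elim: s => [|m s IH]; first by rewrite !big_nil derivC hornerC mulr0.
rewrite !big_cons; case: ifP => Pm //.
rewrite derivM derivXsubC mul1r hornerD hornerM IH horner_prod !hornerE.
under [X in X + _]eq_bigr do rewrite !hornerE.
set A := \prod_(_ <- _ | _) _; set B := \sum_(_ <- _ | _) _.
by rewrite /=; field; rewrite subr_eq0 hP.
Qed.

(** This is the derivative at l_i of the Lagrange interpolation of the constant 1. *)
Lemma ddw_balance i : \sum_(j | j != i) (ddw i / (l i - l j) + ddw j / (l i - l j)) = 0.
Proof.
rewrite big_split /= -mulr_sumr.
pose lg2 j : {poly K} := \prod_(m | (m != j) && (m != i)) ('X - (l m)%:P).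
have lgE j : j != i -> lagr j = ('X - (l i)%:P) * lg2 j.
  by move=> ji; rewrite /lagr (bigD1 i) 1?eq_sym.
have N0 : (size (1%:P : {poly K}) <= N)%N.
  by rewrite (leq_trans (size_polyC_leq1 _)) // (leq_ltn_trans _ (ltn_ord i)).
have := congr1 (fun p : {poly K} => p^`().[l i]) (lagr_interp N0).
rewrite derivC hornerC raddf_sum horner_sum (bigD1 i) //= derivZ hornerZ hornerC mul1r.
rewrite horner_deriv_prod_XsubC => [|m mi]; last by rewrite (inj_eq l_inj) eq_sym.
rewrite mulrA mulVf ?mul1r; last by rewrite -invr_eq0; exact: ddw_neq0.
move=> /esym E; apply: (mulfI (_ : (ddw i)^-1 != 0)); first by rewrite invr_eq0 ddw_neq0.
rewrite mulr0 mulrDr mulrA mulVf ?ddw_neq0 // mul1r -[RHS]E; congr (_ + _).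
rewrite mulr_sumr; apply: eq_bigr => j ji.
rewrite derivZ hornerZ hornerC mul1r lgE // derivM derivXsubC mul1r hornerD hornerM.
rewrite hornerXsubC subrr mul0r addr0 horner_prod.
under eq_bigr do rewrite hornerXsubC.
rewrite invrK (bigD1 j) //=.
have -> : \prod_(m | (m != j) && (m != i)) (l i - l m) = \prod_(m | (m != i) && (m != j)) (l i - l m).
  by apply: eq_bigl => m; rewrite andbC.
have lij : l i - l j != 0 by rewrite node_neq // eq_sym.
by field.
Qed.

(** Leibniz rule for multiplication by the coordinate function, whose divided differences of order
    above one vanish. *)
Lemma dd2_mul i h (hd : K) : dd2 i (fun j => l j * h j) (h i + l i * hd) = l i * dd2 i h hd + dd h.
Proof.
have -> : dd h = ddw i * h i + \sum_(j | j != i) ddw j * h j by rewrite /dd (bigD1 i).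
rewrite /dd2 [l i * (_ + _)]mulrDr mulr_sumr addrACA -big_split /=.
congr (_ + _); first by ring.
by apply: eq_bigr => j ji; field; exact: node_neq.
Qed.

(** Doubling the node l_i amounts to differentiating in l_i, so the sum is the derivative under a
    common translation of the nodes. The identity holds for arbitrary values h and hd, by pairing
    (i, j) with (j, i) and using [ddw_balance]. *)
Lemma sum_dd2 h hd : \sum_i dd2 i h (hd i) = dd hd.
Proof.
rewrite big_split /= -[RHS]addr0; congr (_ + _).
pose A i j := ddw j * (h j / (l j - l i)).
pose B i j := ddw j * (h i / (l i - l j)).
transitivity (\sum_i \sum_(j | j != i) A i j + \sum_i \sum_(j | j != i) B i j).
  rewrite -big_split; apply: eq_bigr => i _; rewrite -big_split; apply: eq_bigr => j ji.
  have n1 := node_neq ji; have n2 : l i - l j != 0 by rewrite node_neq // eq_sym.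
  rewrite /A /B /=; field.
  by rewrite n1 n2.
have -> : \sum_i \sum_(j | j != i) A i j = \sum_i \sum_(j | j != i) A j i.
  rewrite (exchange_big_dep xpredT) //=; apply: eq_bigr => i _; apply: eq_bigl => j.
  by rewrite eq_sym.
rewrite -big_split; apply: big1 => i _; rewrite -big_split /=.
transitivity (h i * \sum_(j | j != i) (ddw i / (l i - l j) + ddw j / (l i - l j))).
  by rewrite mulr_sumr; apply: eq_bigr => j _; rewrite /A /B; ring.
by rewrite ddw_balance mulr0.
Qed.

End DividedDifferences.

(** * Divided differences of the exponential *)

Section ExponentialDifferences.
Variables (R : realType) (N : nat).
Local Notation C := (R[i] : numClosedFieldType).
Variable l : 'I_N -> C.
Hypothesis l_inj : injective l.
Implicit Types (y : C) (i j : 'I_N) (n : nat).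

(** [ddexp 0] is the function F of the overview and [ddexp n] its n-th derivative, see
    [cder_ddexp]. *)
Definition ddexp n y : C := dd l (fun j => l j ^+ n * cexp (l j * y)).

(** The last argument of [dd2] is the derivative of x^n exp(x y) at l_i; for n = 0 the factor [n%:R]
    removes the term with the truncated exponent. [ddexp2 i 0] is G_i. *)
Definition ddexp2 i n y : C := dd2 l i (fun j => l j ^+ n * cexp (l j * y))
  ((n%:R * l i ^+ n.-1 + y * l i ^+ n) * cexp (l i * y)).

Lemma ddexp2S i n y : ddexp2 i n.+1 y = l i * ddexp2 i n y + ddexp n y.
Proof.
rewrite /ddexp2 /ddexp -(dd2_mul l_inj); congr (dd2 _ _ _ _).
  by apply/funext => j; rewrite exprS mulrA.
case: n => [|n]; first by rewrite /= !expr0 expr1; ring.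
by rewrite /= -!natr1 !exprS; ring.
Qed.

Lemma sum_ddexp2 n y : \sum_i ddexp2 i n.+1 y = n.+1%:R * ddexp n y + y * ddexp n.+1 y.
Proof.
rewrite /ddexp2 (sum_dd2 l_inj _ (fun i => (n.+1%:R * l i ^+ n + y * l i ^+ n.+1) * cexp (l i * y))).
rewrite /ddexp /dd !mulr_sumr -big_split; apply: eq_bigr => j _ /=; ring.
Qed.

(** The sum of the [ddexp2 i n.+1] is evaluated twice, by [ddexp2S] and by [sum_ddexp2]. For n = 0
    this expresses y F' through F and the G_i, which closes the system. *)
Lemma ddexp_mulS n y :
  y * ddexp n.+1 y + n%:R * ddexp n y = (N%:R - 1) * ddexp n y + \sum_i l i * ddexp2 i n y.
Proof.
have := sum_ddexp2 n y; under eq_bigr do rewrite ddexp2S.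
rewrite big_split /= sumr_const card_ord -[_ *+ N]mulr_natl -natr1.
move: (\sum_i _) => S; move: (ddexp n.+1 y) (ddexp n y) => a b E.
have -> : S = (n%:R + 1) * b + y * a - N%:R * b by rewrite -E; ring.
ring.
Qed.

Lemma sum_ddexp2_0 y : \sum_i ddexp2 i 0 y = y * ddexp 0 y.
Proof.
rewrite /ddexp2 (sum_dd2 l_inj _ (fun i => (0%:R * l i ^+ 0.-1 + y * l i ^+ 0) * cexp (l i * y))).
rewrite /ddexp /dd !mulr_sumr; apply: eq_bigr => j _ /=; ring.
Qed.

Lemma cder_cexp_scale (c y : C) : cder (fun z => cexp (c * z)) y (c * cexp (c * y)).
Proof. exact: cder_scale (cder_cexp _). Qed.

Lemma cder_ddexp n y : cder (ddexp n) y (ddexp n.+1 y).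
Proof.
have H := @cder_sum _ _ (index_enum 'I_N) xpredT
  (fun j z => ddw l j * (l j ^+ n * cexp (l j * z)))
  (fun j => ddw l j * (l j ^+ n.+1 * cexp (l j * y))) y.
apply: H => j _; apply: cderZ; rewrite exprSr -mulrA; apply: cderZ.
exact: cder_cexp_scale.
Qed.

Lemma cder_ddexp2 i y : cder (ddexp2 i 0) y (l i * ddexp2 i 0 y + ddexp 0 y).
Proof.
rewrite -ddexp2S /ddexp2 /dd2.
have E z : ddw l i * ((0%:R * l i ^+ 0.-1 + z * l i ^+ 0) * cexp (l i * z)) =
  ddw l i * (z * cexp (l i * z)) by rewrite mul0r add0r expr0 mulr1.
have H := @cder_sum _ _ (index_enum 'I_N) (fun j => j != i)
  (fun j z => ddw l j * ((l j ^+ 0 * cexp (l j * z) - l i ^+ 0 * cexp (l i * z)) / (l j - l i)))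
  (fun j => ddw l j * ((l j ^+ 1 * cexp (l j * y) - l i ^+ 1 * cexp (l i * y)) / (l j - l i))) y.
apply: cderD; last first.
  apply: H => j ji; apply: cderZ.
  have -> : (l j ^+ 1 * cexp (l j * y) - l i ^+ 1 * cexp (l i * y)) / (l j - l i) =
    (l j - l i)^-1 * (l j * cexp (l j * y) - l i * cexp (l i * y)) by rewrite mulrC !expr1.
  apply: cder_local ltr01 _ (cderZ (l j - l i)^-1
    (cderB (cder_cexp_scale (l j) y) (cder_cexp_scale (l i) y))) => w _.
  by rewrite !expr0 !mul1r mulrC.
apply: cderZ.
have := cderM (cder_id y) (cder_cexp_scale (l i) y).
have -> : 1 * cexp (l i * y) + y * (l i * cexp (l i * y)) =
  (1%:R * l i ^+ 1.-1 + y * l i ^+ 1) * cexp (l i * y) by rewrite expr1 /= expr0; ring.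
by apply: cder_local ltr01 _ => w _; rewrite mul0r add0r expr0 mulr1.
Qed.

Lemma ddexp2_at0 i : ddexp2 i 0 0 = 0.
Proof.
rewrite /ddexp2 /dd2 !mul0r addr0 mul0r mulr0 add0r; apply: big1 => j _.
by rewrite !mulr0 cexp0 subrr mul0r mulr0.
Qed.

(** The recurrences propagate a common zero to all orders n, with a division by y in [ddexp_mulS];
    then every moment of exp(l_j y) vanishes, against [dd_moments0]. *)
Lemma ddexp_neq0 y : (0 < N)%N -> y != 0 ->
  ddexp 0 y = 0 -> (forall i, ddexp2 i 0 y = 0) -> False.
Proof.
move=> N0 y0 F0 G0.
have H n : ddexp n y = 0 /\ forall i, ddexp2 i n y = 0.
  elim: n => [//|n [Fn Gn]]; split; last by move=> i; rewrite ddexp2S Fn Gn mulr0 addr0.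
  have := ddexp_mulS n y; rewrite Fn !mulr0 addr0 add0r big1; last by move=> i _; rewrite Gn mulr0.
  by move/eqP; rewrite mulf_eq0 (negbTE y0) /= => /eqP.
have /(_ (Ordinal N0))/eqP := dd_moments0 l_inj (c := fun j => cexp (l j * y)) (fun n _ => (H n).1).
by rewrite (negbTE (cexp_neq0 _)).
Qed.

End ExponentialDifferences.

(** * Linear differential inequalities along a ray *)

Section Gronwall.
Variable R : realType.
Local Notation C := (R[i] : numClosedFieldType).
Implicit Types (f : R -> R) (t : R) (y : C).

Lemma eps_is_derive f t (d : R) :
  (forall e : R, 0 < e -> exists2 dl : R, 0 < dl &
    forall h : R, `|h| < dl -> `|f (t + h) - f t - d * h| <= e * `|h|) -> is_derive t 1 f d.
Proof.
move=> hf; have H : (fun h => h^-1 *: ((f \o shift t) (h *: 1) - f t)) @ 0^' --> d.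
  apply/cvgrPdist_le => e e0; have [dl dl0 hdl] := hf e e0.
  exists dl => //= h; rewrite /ball_ /= sub0r normrN => hh h0.
  have := hdl h hh; rewrite [t + h]addrC -ler_pdivrMr ?normr_gt0 // -normfV -normrM => k.
  apply: le_trans k; rewrite -normrN le_eqVlt; apply/orP; left; apply/eqP; congr (`|_|).
  by rewrite scaler1 /GRing.scale /=; field.
by apply: DeriveDef; [apply/cvg_ex; exists d|apply: cvg_lim].
Qed.

Lemma is_derive_ray (f : C -> C) y (d : C) t : cder f (t%:C%C * y) d ->
  is_derive t 1 (fun s => complex.Re (f (s%:C%C * y))) (complex.Re (d * y)) /\
  is_derive t 1 (fun s => complex.Im (f (s%:C%C * y))) (complex.Im (d * y)).
Proof.
move=> hf.
have H (e : R) : 0 < e -> exists2 dl : R, 0 < dl & forall h : R, `|h| < dl ->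
    cabs (f ((t + h)%:C%C * y) - f (t%:C%C * y) - h%:C%C * (d * y)) <= e * `|h|.
  move=> e0; have y1 : 0 < cabs y + 1 by have := cabs_ge0 y; lra.
  have [dl dl0 hd] := hf _ (divr_gt0 e0 y1).
  exists (dl / (cabs y + 1)) => [|h]; first exact: divr_gt0.
  rewrite ltr_pdivlMr // => hh.
  have := hd (h%:C%C * y); rewrite cabsM cabs_real => H.
  have -> : (t + h)%:C%C * y = t%:C%C * y + h%:C%C * y by rewrite rmorphD mulrDl.
  have -> : h%:C%C * (d * y) = d * (h%:C%C * y) by ring.
  apply: le_trans (H _) _.
    by apply: le_lt_trans hh; rewrite ler_wpM2l //; lra.
  rewrite -mulrA [(cabs y + 1)^-1 * _]mulrC ler_wpM2l ?(ltW e0) //.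
  rewrite ler_pdivrMr // ler_wpM2l //; lra.
split; apply: eps_is_derive => e e0; have [dl dl0 hd] := H e e0; exists dl => // h /hd.
  apply: le_trans; apply: le_trans (cabs_Re _).
  rewrite le_eqVlt; apply/orP; left; apply/eqP; congr (`|_|).
  by case: (f _) (f _) (d * y) => [? ?] [? ?] [? ?] /=; ring.
apply: le_trans; apply: le_trans (cabs_Im _).
rewrite le_eqVlt; apply/orP; left; apply/eqP; congr (`|_|).
by case: (f _) (f _) (d * y) => [? ?] [? ?] [? ?] /=; ring.
Qed.

Lemma sum_sqr_le n (b : 'I_n -> R) : (forall i, 0 <= b i) ->
  (\sum_i b i) ^+ 2 <= n%:R * \sum_i b i ^+ 2.
Proof.
move=> b0; elim: n b b0 => [|n IH] b b0; first by rewrite !big_ord0 mulr0 expr0n.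
rewrite !big_ord_recl -natr1; set S := \sum_(_ < _) _; set Q := \sum_(_ < _) _.
have S0 : 0 <= S by apply: sumr_ge0.
have SQ : S ^+ 2 <= n%:R * Q by apply: IH.
have Q0 : 0 <= Q by apply: sumr_ge0 => i _; exact: sqr_ge0.
have T : 2 * b ord0 * S <= n%:R * b ord0 ^+ 2 + Q.
  have [n0|n0] := posnP n.
    have S00 : S = 0 by rewrite /S; move: b b0 {IH S S0 SQ Q Q0}; rewrite n0 => b b0; rewrite big_ord0.
    by rewrite S00 mulr0 addr_ge0 // mulr_ge0 ?sqr_ge0.
  have np : 0 < n%:R :> R by rewrite ltr0n.
  rewrite -(ler_pM2l np) mulrDr; apply: le_trans (lerD (lexx _) SQ).
  have : 0 <= (n%:R * b ord0 - S) ^+ 2 by exact: sqr_ge0.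
  rewrite sqrrB; nra.
rewrite sqrrD; nra.
Qed.

Lemma cabs_conj (z : C) : cabs z^*%C = cabs z.
Proof. by case: z => p q; rewrite /cabs /= sqrrN. Qed.

(* The differential inequality [V' <= kappa V + e^2] for [V = sum |D_i|^2] makes
   [(V + e^2 / kappa) exp (- kappa t)] nonincreasing. *)
Lemma gronwall_ray n (D D' : 'I_n -> C -> C) y (K e : R) : 0 <= K -> 0 <= e ->
  (forall i t, 0 <= t <= 1 -> cder (D i) (t%:C%C * y) (D' i (t%:C%C * y))) ->
  (forall i, D i 0 = 0) ->
  (forall i t, 0 < t < 1 -> cabs (D' i (t%:C%C * y) * y) <=
     K * \sum_j cabs (D j (t%:C%C * y)) + e) ->
  forall i, cabs (D i y) <= e * expR ((2 * K + 1) * n.+1%:R).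
Proof.
move=> K0 e0 cD D0 hD i.
(* With S = sum |D_j|, this comes from V' <= 2 S (K S + e) and S^2 <= n V. Taking n + 1 in place of
   n makes k >= 1, so that [W] below can carry e^2 instead of e^2 / k. *)
pose k : R := (2 * K + 1) * n.+1%:R.
have k1 : 1 <= k.
  by rewrite /k -natr1; have := ler0n R n; nra.
pose u j t := complex.Re (D j (t%:C%C * y)); pose v j t := complex.Im (D j (t%:C%C * y)).
pose V t := \sum_j (u j t ^+ 2 + v j t ^+ 2).
pose u' j t := complex.Re (D' j (t%:C%C * y) * y); pose v' j t := complex.Im (D' j (t%:C%C * y) * y).
pose V' t := \sum_j (2 * (u j t * u' j t) + 2 * (v j t * v' j t)).
have dV t : 0 <= t <= 1 -> is_derive t 1 V (V' t).
  move=> ht; have -> : V = \sum_j (fun t => u j t ^+ 2 + v j t ^+ 2).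
    by apply/funext => s; rewrite fct_sumE.
  rewrite /V'; apply: is_derive_sum => j.
  have [du dv] := is_derive_ray (cD j t ht).
  have -> : (fun t => u j t ^+ 2 + v j t ^+ 2) = (u j * u j) + (v j * v j).
    by apply/funext => s; rewrite !expr2.
  apply: is_derive_eq; rewrite /GRing.scale /= -/(u' j t) -/(v' j t); ring.
have cV t : \sum_j cabs (D j (t%:C%C * y)) ^+ 2 = V t.
  apply: eq_bigr => j _; rewrite /cabs sqr_sqrtr ?addr_ge0 ?sqr_ge0 //.
have VK t : 0 < t < 1 -> V' t <= k * V t + e ^+ 2.
  move=> ht; set S := \sum_j cabs (D j (t%:C%C * y)).
  have S0 : 0 <= S by apply: sumr_ge0 => j _; exact: cabs_ge0.
  have h1 : V' t <= 2 * S * (K * S + e).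
    rewrite -mulrA mulr_suml mulr_sumr; apply: ler_sum => j _.
    apply: le_trans (_ : 2 * (cabs (D j (t%:C%C * y)) * cabs (D' j (t%:C%C * y) * y)) <= _); last first.
      by rewrite ler_pM2l // ler_wpM2l ?cabs_ge0 //; exact: hD.
    rewrite -mulrDr ler_pM2l // -cabsM.
    rewrite /u /v /u' /v'; set z := D j _; set w := _ * y.
    have -> : cabs (z * w) = cabs (z * w^*%C).
      by rewrite [LHS]cabsM [RHS]cabsM cabs_conj.
    apply: le_trans (ler_norm _) _; apply: le_trans (cabs_Re _).
    rewrite le_eqVlt; apply/orP; left; apply/eqP; congr (`|_|).
    by case: z w => [p q] [p' q'] /=; ring.
  have h2 : S ^+ 2 <= n%:R * V t by rewrite -cV; apply: sum_sqr_le => j; exact: cabs_ge0.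
  have V0 : 0 <= V t by apply: sumr_ge0 => j _; rewrite addr_ge0 ?sqr_ge0.
  have h3 : 2 * S * e <= S ^+ 2 + e ^+ 2 by have := sqr_ge0 (S - e); rewrite sqrrB; lra.
  apply: le_trans h1 _; rewrite mulrDr.
  have h4 : (2 * K + 1) * S ^+ 2 <= (2 * K + 1) * (n%:R * V t) by rewrite ler_wpM2l //; lra.
  have h5 : (2 * K + 1) * V t >= 0 by rewrite mulr_ge0 //; lra.
  rewrite /k -natr1; nra.
pose W t := (V t + e ^+ 2) * expR (- k * t).
have dW t : 0 <= t <= 1 -> is_derive t 1 W ((V' t - k * (V t + e ^+ 2)) * expR (- k * t)).
  move=> ht; have hV := dV t ht.
  have hE : is_derive t 1 (fun t => expR (- k * t)) (- k * expR (- k * t)).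
    have hL : is_derive t 1 (fun t => - k * t) (- k).
      apply: eps_is_derive => e' e0'; exists 1 => // h _.
      by rewrite (_ : _ - _ = 0) ?normr0 ?mulr_ge0 ?(ltW e0') //; ring.
    have := @is_derive1_comp _ _ _ _ _ _ (is_derive_expR (- k * t)) hL.
    by rewrite /comp mulrC.
  have -> : W = (V + cst (e ^+ 2)) * (fun t => expR (- k * t)) by [].
  apply: is_derive_eq; rewrite !fctE /GRing.scale /=; ring.
have W10 : W 1 <= W 0.
  have H : {in `[0, 1]%R &, {homo W : x y /~ x <= y}}.
    apply: ler0_derive1_le_cc => [t|t|].
    - by rewrite in_itv /= => /andP[t0 t1]; apply: (@ex_derive _ _ _ _ _ _ _ (dW t _)); lra.
    - rewrite in_itv /= => /andP[t0 t1]; rewrite derive1E (@derive_val _ _ _ _ _ _ _ (dW t _)); last by lra.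
      rewrite mulr_le0_ge0 ?expR_ge0 //.
      have ht : 0 < t < 1 by rewrite t0.
      by have := VK t ht; have := sqr_ge0 e; nra.
    - apply: derivable_within_continuous => t; rewrite in_itv /= => ht.
      exact: (@ex_derive _ _ _ _ _ _ _ (dW t ht)).
  by apply: H; rewrite ?in_itv /= ?lexx ?ler01.
have V00 : V 0 = 0.
  by rewrite -cV; apply: big1 => j _; rewrite mul0r D0 cabs0 expr0n.
have V1 : V 1 <= e ^+ 2 * expR k.
  move: W10; rewrite /W V00 add0r mulr0 expR0 !mulr1 => h.
  have : V 1 + e ^+ 2 <= e ^+ 2 * expR k.
    by rewrite -ler_pdivrMr ?expR_gt0 // -expRN.
  by have := sqr_ge0 e; lra.
have hi : cabs (D i y) ^+ 2 <= (e * expR k) ^+ 2.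
  apply: (@le_trans _ _ (V 1)).
    rewrite -cV (bigD1 i) //= mul1r lerDl sumr_ge0 // => j _; exact: sqr_ge0.
  apply: le_trans V1 _; rewrite exprMn ler_wpM2l ?sqr_ge0 //.
  rewrite expr2 ler_peMl ?expR_ge0 //.
  by rewrite -expR0 ler_expR; lra.
by rewrite -(@ler_pXn2r _ 2) // nnegrE ?cabs_ge0 // mulr_ge0 ?expR_ge0.
Qed.

End Gronwall.

(** * Weighted coefficient norms and a contraction on polynomials *)

Section WeightedNorm.
Variables (R : realType) (s : R).
Hypothesis s0 : 0 < s.
Local Notation C := (R[i] : numClosedFieldType).
Implicit Types (p q : {poly C}) (z : C).

(** An l^1 norm: submultiplicative, dominating the supremum on |z| <= s and, unlike the supremum,
    monotone in the moduli of the coefficients, as [nrm_euler_inv] requires. *)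
Definition nrm p : R := \sum_(k < size p) cabs p`_k * s ^+ k.

Lemma nrm_wide p m : (size p <= m)%N -> nrm p = \sum_(k < m) cabs p`_k * s ^+ k.
Proof.
move=> /subnKC <-; rewrite big_split_ord /= [X in _ + X]big1 ?addr0 // => k _.
by rewrite nth_default ?leq_addr // cabs0 mul0r.
Qed.

Lemma nrm_ge0 p : 0 <= nrm p.
Proof. by apply: sumr_ge0 => k _; rewrite mulr_ge0 ?cabs_ge0 ?exprn_ge0 // ltW. Qed.

Lemma nrm0 : nrm 0 = 0. Proof. by rewrite /nrm size_poly0 big_ord0. Qed.

Lemma nrm_le p q : (forall k, cabs p`_k <= cabs q`_k) -> nrm p <= nrm q.
Proof.
move=> h; rewrite (nrm_wide (leq_maxl (size p) (size q))) (nrm_wide (leq_maxr (size p) (size q))).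
by apply: ler_sum => k _; rewrite ler_wpM2r ?exprn_ge0 // ltW.
Qed.

Lemma nrmD p q : nrm (p + q) <= nrm p + nrm q.
Proof.
have h1 := leq_maxl (size p) (size q); have h2 := leq_maxr (size p) (size q).
rewrite (nrm_wide (size_polyD p q)) (nrm_wide h1) (nrm_wide h2) -big_split /=.
by apply: ler_sum => k _; rewrite coefD -mulrDl ler_wpM2r ?cabsD ?exprn_ge0 // ltW.
Qed.

Lemma nrmN p : nrm (- p) = nrm p.
Proof. by rewrite /nrm size_polyN; apply: eq_bigr => k _; rewrite coefN cabsN. Qed.

Lemma nrmB p q : nrm (p - q) <= nrm p + nrm q.
Proof. by rewrite -[nrm q]nrmN nrmD. Qed.

Lemma nrmZ (c : C) p : nrm (c *: p) = cabs c * nrm p.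
Proof.
rewrite (nrm_wide (size_scale_leq c p)) /nrm mulr_sumr.
by apply: eq_bigr => k _; rewrite coefZ cabsM mulrA.
Qed.

Lemma nrm_cons p (c : C) : nrm (p * 'X + c%:P) = nrm p * s + cabs c.
Proof.
have h : (size (p * 'X + c%:P)%R <= (size p).+1)%N.
  by rewrite size_MXaddC; case: ifP.
rewrite (nrm_wide h) big_ord_recl expr0 mulr1 coefD coefMX coefC /= add0r addrC; congr (_ + _).
rewrite /nrm mulr_suml; apply: eq_bigr => k _.
by rewrite coefD coefMX coefC /= addr0 exprSr mulrA.
Qed.

Lemma nrmM p q : nrm (p * q) <= nrm p * nrm q.
Proof.
elim/poly_ind: p => [|p c IH]; first by rewrite mul0r nrm0 mul0r.
have -> : (p * 'X + c%:P) * q = ((p * q) * 'X + 0%:P) + c *: q.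
  by rewrite addr0 -mul_polyC; ring.
apply: le_trans (nrmD _ _) _; rewrite nrm_cons cabs0 addr0 nrm_cons nrmZ mulrDl lerD2r.
by rewrite mulrAC ler_wpM2r // ltW.
Qed.

Lemma nrmX : nrm 'X = s.
Proof.
have -> : 'X = 1%:P * 'X + 0%:P :> {poly C} by rewrite mul1r addr0.
have -> : 1%:P = 0 * 'X + 1%:P :> {poly C} by rewrite mul0r add0r.
by rewrite !nrm_cons nrm0 cabs0 cabs1 mul0r add0r addr0 mul1r.
Qed.

Lemma nrm_sum (I : Type) (r : seq I) (F : I -> {poly C}) :
  nrm (\sum_(j <- r) F j) <= \sum_(j <- r) nrm (F j).
Proof.
elim/big_rec2: _ => [|j a b _ h]; first by rewrite nrm0.
by apply: le_trans (nrmD _ _) _; rewrite lerD2l.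
Qed.

Lemma horner_nrm p z : cabs z <= s -> cabs p.[z] <= nrm p.
Proof.
move=> hz; rewrite horner_coef; apply: le_trans (cabs_sum _ _ _) _.
apply: ler_sum => k _; rewrite cabsM cabsX ler_wpM2l ?cabs_ge0 //.
by rewrite lerXn2r ?nnegrE ?cabs_ge0 // ltW.
Qed.

(** A vanishing constant term gains the factor |z| / s, which later absorbs the singularity of the
    differential system at 0. *)
Lemma horner_nrm0 p z : cabs z <= s -> p`_0 = 0 -> cabs p.[z] <= cabs z * (nrm p / s).
Proof.
move=> hz p0; rewrite horner_coef; apply: le_trans (cabs_sum _ _ _) _.
rewrite /nrm mulr_suml mulr_sumr; apply: ler_sum => -[[|k] hk] _ /=.
  by rewrite p0 mul0r cabs0 !mul0r mulr0.
have -> : cabs p`_k.+1 * s ^+ k.+1 / s = cabs p`_k.+1 * s ^+ k.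
  by rewrite exprSr; field; rewrite gt_eqF.
rewrite cabsM cabsX exprS mulrCA.
by rewrite ler_wpM2l ?cabs_ge0 // ler_wpM2l ?cabs_ge0 // lerXn2r ?nnegrE ?cabs_ge0 // ltW.
Qed.

End WeightedNorm.

(** * A contraction solving the singular differential system *)

Section Contraction.
Variables (R : realType) (n : nat) (A s : R).
Local Notation C := (R[i] : numClosedFieldType).
Local Notation N := n.+1.
Variable a : 'I_N -> C.
(** The constant 12 serves three estimates: 6 A s <= 1/2 keeps the iterates in the ball of radius 2
    s, 5 A s <= 1/2 makes the map contract by 1/2, and 2 A s <= 1/6 keeps [u1] near 1. *)
Hypotheses (aA : forall i, cabs (a i) <= A) (s0 : 0 < s) (As : 12 * A * s <= 1).
Implicit Types (p q : {poly C}) (f g : 'I_N -> {poly C}) (i j : 'I_N).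
Local Notation nrm := (nrm s).

(* The solution q of [X q' + n q = N p] with zero constant term. *)
Definition euler_inv p : {poly C} :=
  \poly_(k < size p) (if k == 0%N then 0 else N%:R / (k + n)%:R * p`_k).

Lemma coef_euler_inv p k :
  (euler_inv p)`_k = if k == 0%N then 0 else N%:R / (k + n)%:R * p`_k.
Proof.
rewrite coef_poly; case: ltnP => // h; case: eqP => // _.
by rewrite nth_default ?mulr0.
Qed.

Lemma euler_invB p q : euler_inv p - euler_inv q = euler_inv (p - q).
Proof.
apply/polyP => k; rewrite coefB !coef_euler_inv; case: eqP => _; first by rewrite subrr.
by rewrite coefB mulrBr.
Qed.

Lemma nrm_euler_inv p : nrm (euler_inv p) <= nrm p.
Proof.
apply: nrm_le => // k; rewrite coef_euler_inv; case: k => [|k] /=; first by rewrite cabs0 cabs_ge0.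
rewrite cabsM ler_piMl ?cabs_ge0 // cabsM cabsV !cabs_nat.
by rewrite ler_pdivrMr ?mul1r ?ler_nat ?ltr0n //; lia.
Qed.

Lemma euler_invP p : p`_0 = 0 -> 'X * (euler_inv p)^`() + n%:R *: euler_inv p = N%:R *: p.
Proof.
move=> p0; apply/polyP => k; rewrite coefD !coefZ coefXM coef_deriv !coef_euler_inv.
case: k => [|k] /=; first by rewrite p0 !mulr0 addr0.
rewrite -mulr_natr; have h : (k.+1 + n)%:R != 0 :> C by rewrite pnatr_eq0.
by rewrite natrD in h *; field.
Qed.

Definition meanp f : {poly C} := N%:R^-1 *: \sum_j a j *: f j.

Lemma A_ge0 : 0 <= A. Proof. exact: le_trans (cabs_ge0 _) (aA ord0). Qed.

Lemma nrm_meanp f (B : R) : (forall j, nrm (f j) <= B) -> nrm (meanp f) <= A * B.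
Proof.
move=> hB; rewrite /meanp nrmZ // cabsV cabs_nat mulrC ler_pdivrMr ?ltr0n //.
apply: le_trans (nrm_sum _ _ _) _; first exact: s0.
apply: (@le_trans _ _ (\sum_(j < N) A * B)).
  by apply: ler_sum => j _; rewrite nrmZ // ler_pM ?cabs_ge0 ?nrm_ge0.
by rewrite sumr_const card_ord mulr_natr.
Qed.

(** With [euler_inv] in front, a fixed point solves the equation of [rho_ode], where [u1] stands for
    1 - 1/N plus the mean [meanp]. *)
Definition rhs f i : {poly C} := 'X + a i *: ('X * f i) - meanp f * f i.

Fixpoint rhop m : 'I_N -> {poly C} :=
  if m is m'.+1 then fun i => euler_inv (rhs (rhop m') i) else fun=> 0.

Lemma rhop_coef0 m i : (rhop m i)`_0 = 0.
Proof. by case: m => [|m] /=; rewrite ?coef0 ?coef_euler_inv. Qed.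

Lemma rhs_coef0 m i : (rhs (rhop m) i)`_0 = 0.
Proof.
by rewrite !coefB coefD coefX coefZ coefXM coefM big_ord1 !rhop_coef0 !(mulr0, addr0, subr0).
Qed.

Lemma rhop_ode m i :
  'X * (rhop m.+1 i)^`() + n%:R *: rhop m.+1 i = N%:R *: rhs (rhop m) i.
Proof. by apply: euler_invP; exact: rhs_coef0. Qed.

Lemma nrm_rhop m i : nrm (rhop m i) <= 2 * s.
Proof.
elim: m i => [|m IH] i /=; first by rewrite nrm0; have := s0; lra.
apply: le_trans (nrm_euler_inv _) _; apply: le_trans (nrmB _ _ _) _ => //.
have h1 : nrm ('X + a i *: ('X * rhop m i)) <= s + A * (s * (2 * s)).
  apply: le_trans (nrmD _ _ _) _ => //; rewrite nrmX // lerD2l nrmZ //.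
  apply: ler_pM; rewrite ?cabs_ge0 ?nrm_ge0 //.
  apply: le_trans (nrmM _ _ _) _ => //; rewrite nrmX // ler_wpM2l // ltW //.
have h2 : nrm (meanp (rhop m) * rhop m i) <= A * (2 * s) * (2 * s).
  apply: le_trans (nrmM _ _ _) _ => //.
  by apply: ler_pM; rewrite ?nrm_ge0 ?nrm_meanp.
have h3 : 12 * A * s * s <= 1 * s by rewrite ler_wpM2r // ltW.
have h4 := s0; apply: le_trans (lerD h1 h2) _; lra.
Qed.

Lemma nrm_rhs_diff f g i (d : R) : (forall j, nrm (f j) <= 2 * s) -> (forall j, nrm (g j) <= 2 * s) ->
  (forall j, nrm (f j - g j) <= d) -> nrm (rhs f i - rhs g i) <= d / 2.
Proof.
move=> hf hg hd.
have -> : rhs f i - rhs g i = a i *: ('X * (f i - g i)) -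
    (meanp (fun j => f j - g j) * f i + meanp g * (f i - g i)).
  have -> : meanp (fun j => f j - g j) = meanp f - meanp g.
    rewrite /meanp -scalerBr -sumrB; congr (_ *: _); apply: eq_bigr => j _.
    by rewrite scalerBr.
  by rewrite /rhs mulrBr scalerBr; ring.
have d0 : 0 <= d by apply: le_trans (nrm_ge0 _ _) (hd i).
have A0 := A_ge0.
apply: le_trans (nrmB _ _ _) _ => //.
have h1 : nrm (a i *: ('X * (f i - g i))) <= A * (s * d).
  rewrite nrmZ //; apply: ler_pM; rewrite ?cabs_ge0 ?nrm_ge0 //.
  apply: le_trans (nrmM _ _ _) _ => //; rewrite nrmX // ler_wpM2l // ltW //.
have h2 : nrm (meanp (fun j => f j - g j) * f i) <= A * d * (2 * s).
  apply: le_trans (nrmM _ _ _) _ => //.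
  by apply: ler_pM; rewrite ?nrm_ge0 ?nrm_meanp.
have h3 : nrm (meanp g * (f i - g i)) <= A * (2 * s) * d.
  apply: le_trans (nrmM _ _ _) _ => //.
  by apply: ler_pM; rewrite ?nrm_ge0 ?nrm_meanp.
have h4 := @nrmD _ _ s0 (meanp (fun j => f j - g j) * f i) (meanp g * (f i - g i)).
have h5 : 12 * A * s * d <= 1 * d by rewrite ler_wpM2r.
have h6 : 0 <= A * s * d by rewrite !mulr_ge0 // ltW.
lra.
Qed.

Lemma nrm_rhop_diff m i : nrm (rhop m.+1 i - rhop m i) <= 2 * s * 2^-1 ^+ m.
Proof.
elim: m i => [|m IH] i.
  by rewrite expr0 mulr1 [rhop 0]/= subr0; exact: nrm_rhop.
rewrite [rhop m.+2]/= [rhop m.+1 i]/= euler_invB; apply: le_trans (nrm_euler_inv _) _.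
rewrite exprSr mulrA; apply: nrm_rhs_diff => j; [exact: (nrm_rhop m.+1)|exact: nrm_rhop|exact: IH].
Qed.

Lemma nrm_rhop_cauchy m m' i : (m <= m')%N -> nrm (rhop m' i - rhop m i) <= 4 * s * 2^-1 ^+ m.
Proof.
move=> mm'.
suff H d : nrm (rhop (m + d) i - rhop m i) <= 4 * s * (2^-1 ^+ m - 2^-1 ^+ (m + d)).
  have := H (m' - m)%N; rewrite subnKC // => /le_trans; apply.
  rewrite ler_pM2l ?mulr_gt0 // lerBlDr lerDl exprn_ge0 //.
elim: d => [|d IH]; first by rewrite addn0 !subrr mulr0 nrm0.
have -> : rhop (m + d.+1) i - rhop m i =
    (rhop (m + d).+1 i - rhop (m + d) i) + (rhop (m + d) i - rhop m i).
  by rewrite addnS addrA subrK.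
apply: le_trans (nrmD _ _ _) _ => //.
apply: le_trans (lerD (nrm_rhop_diff _ _) IH) _.
rewrite addnS exprSr; move: (2^-1 ^+ (m + d)) (2^-1 ^+ m) => u v; lra.
Qed.

End Contraction.

(** * The normalised divided differences near the origin *)

Section NormalisedDifferences.
Variables (R : realType) (n : nat) (A s : R).
Local Notation C := (R[i] : numClosedFieldType).
Local Notation N := n.+1.
Variable a : 'I_N -> C.
Hypotheses (aA : forall i, cabs (a i) <= A) (s0 : 0 < s) (As : 12 * A * s <= 1).
Definition nodes i : C := N%:R * a i.
Hypothesis nodes_inj : injective nodes.
Implicit Types (i j : 'I_N) (y z : C) (m q : nat).
Local Notation nrm := (nrm s).
Local Notation F := (ddexp nodes 0).
Local Notation G := (fun i => ddexp2 nodes i 0).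
Local Notation rp := (rhop a).

Lemma cabs_cexp z : cabs (cexp z) <= expR (cabs z).
Proof.
have -> : cabs (cexp z) = expR (complex.Re z).
  rewrite /cabs /= !exprMn -mulrDr cos2Dsin2 mulr1 sqrtr_sqr ger0_norm //; exact: expR_ge0.
by rewrite ler_expR; apply: le_trans (cabs_Re z); exact: ler_norm.
Qed.

Lemma ddexp_bounded : exists2 M : R, 0 <= M & forall y, cabs y <= s -> cabs (F y) <= M.
Proof.
exists (\sum_j cabs (ddw nodes j) * expR (cabs (nodes j) * s)).
  by apply: sumr_ge0 => j _; rewrite mulr_ge0 ?cabs_ge0 ?expR_ge0.
move=> y hy; apply: le_trans (cabs_sum _ _ _) _; apply: ler_sum => j _.
rewrite cabsM ler_wpM2l ?cabs_ge0 // expr0 mul1r.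
apply: le_trans (cabs_cexp _) _; rewrite ler_expR cabsM ler_wpM2l ?cabs_ge0 //.
Qed.

(** The error of the iterate as an approximation of N G_i / F, multiplied by F so that nothing is
    divided before F is known not to vanish. [D'] is its derivative and [E] the defect of the
    iterate. *)
Let D m i y : C := N%:R * G i y - (rp m.+1 i).[y] * F y.
Let D' m i y : C := N%:R * (nodes i * G i y + F y) -
  ((rp m.+1 i)^`().[y] * F y + (rp m.+1 i).[y] * ddexp nodes 1 y).
Let E m i : {poly C} := rhs a (rp m.+1) i - rhs a (rp m) i.

Let D_ode m i y : y * D' m i y = y * nodes i * D m i y -
  (rp m.+1 i).[y] * \sum_j a j * D m j y + N%:R * (E m i).[y] * F y.
Proof.
have h := congr1 (fun p : {poly C} => p.[y]) (rhop_ode a m i).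
rewrite /= hornerD hornerM hornerX !hornerZ -/(rhop a m.+1 i) in h.
have hE : (rhs a (rp m) i).[y] = (rhs a (rp m.+1) i).[y] - (E m i).[y].
  by rewrite /E hornerD hornerN; ring.
rewrite hE in h.
have hr : (rhs a (rp m.+1) i).[y] = y + a i * (y * (rp m.+1 i).[y]) -
    (meanp a (rp m.+1)).[y] * (rp m.+1 i).[y].
  by rewrite /rhs hornerD hornerN hornerD hornerX hornerZ !hornerM hornerX.
have hm : N%:R * (meanp a (rp m.+1)).[y] = \sum_j a j * (rp m.+1 j).[y].
  rewrite /meanp hornerZ mulrA divff ?pnatr_eq0 // mul1r horner_sum.
  by apply: eq_bigr => j _; rewrite hornerZ.
have hF := ddexp_mulS nodes_inj 0 y; rewrite mul0r addr0 in hF.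
have hS : \sum_j a j * D m j y = \sum_j nodes j * G j y - (\sum_j a j * (rp m.+1 j).[y]) * F y.
  rewrite mulr_suml -sumrB; apply: eq_bigr => j _; rewrite /D /nodes; ring.
have nE : nodes i = N%:R * a i by [].
rewrite hS -hm; rewrite hr in h; move: h hF hm; rewrite /D' /D.
have -> : N%:R - 1 = n%:R :> C by rewrite -natr1 addrK.
set P' := ((rp m.+1 i)^`()).[y]; set P := (rp m.+1 i).[y]; set mp := (meanp _ _).[y].
set SG := \sum_j _; set F1 := ddexp nodes 1 y; set F0 := ddexp nodes 0 y.
set e := (E m i).[y]; set g := ddexp2 _ _ _ _ => h hF hm.
have -> : y * (N%:R * (nodes i * g + F0) - (P' * F0 + P * F1)) =
  y * N%:R * (nodes i * g + F0) - (y * P') * F0 - P * (y * F1) by ring.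
have -> : y * P' = N%:R * (y + a i * (y * P) - mp * P - e) - n%:R * P by rewrite -h; ring.
by rewrite hF nE; ring.
Qed.

(** Gronwall's inequality on the ray from 0 to y. K depends on N, which is harmless: it is used with
    N fixed and m tending to infinity, and the rate uniform in N comes from [nrm_rhop_cauchy]. *)
Lemma rhop_residual : exists2 K : R, 0 <= K & forall m i y, cabs y <= s ->
  cabs (N%:R * G i y - (rp m.+1 i).[y] * F y) <= K * 2^-1 ^+ m.
Proof.
have [M M0 hM] := ddexp_bounded.
have A0 := A_ge0 aA.
pose K0 : R := s * (N%:R * A + 2 * A).
have K00 : 0 <= K0.
  by rewrite /K0 mulr_ge0 ?(ltW s0) // addr_ge0 ?mulr_ge0.
exists (s * N%:R * M * expR ((2 * K0 + 1) * n.+2%:R)).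
  by rewrite !mulr_ge0 ?expR_ge0 // ltW.
move=> m i y hy.
pose e : R := s * (N%:R * (2^-1 ^+ m * M)).
have e0 : 0 <= e by rewrite !mulr_ge0 ?exprn_ge0 ?(ltW s0).
have cD j z : cder (D m j) z (D' m j z).
  apply: cderB; first exact/cderZ/cder_ddexp2.
  by apply: cderM; [exact: cder_horner|exact: cder_ddexp].
have D00 j : D m j 0 = 0.
  by rewrite /D ddexp2_at0 horner_coef0 rhop_coef0 mulr0 mul0r subrr.
have hD j (t : R) : 0 < t < 1 -> cabs (D' m j (t%:C%C * y) * y) <=
    K0 * \sum_j0 cabs (D m j0 (t%:C%C * y)) + e.
  move=> /andP[t0 t1]; have [z zE] : exists z, z = t%:C%C * y by exists (t%:C%C * y).
  rewrite -!zE.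
  have hz : cabs z = t * cabs y by rewrite zE cabsM cabs_real gtr0_norm.
  have zs : cabs z <= s.
    by rewrite hz; apply: le_trans hy; rewrite ler_piMl ?cabs_ge0 // ltW.
  set S := \sum_j0 _.
  have S0 : 0 <= S by apply: sumr_ge0 => p _; exact: cabs_ge0.
  have jS : cabs (D m j z) <= S.
    by rewrite /S (bigD1 j) //= lerDl sumr_ge0 // => p _; exact: cabs_ge0.
  (* [D_ode] controls z D' and not D'. Every term on its right has a factor |z|, here and in [Ea]
     thanks to a vanishing constant term, so the division by z costs nothing. *)
  have ra : cabs (rp m.+1 j).[z] <= cabs z * 2.
    apply: le_trans (horner_nrm0 s0 zs (rhop_coef0 _ _ _)) _.
    rewrite ler_wpM2l ?cabs_ge0 // ler_pdivrMr //; exact: (nrm_rhop aA s0 As).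
  have Ea : cabs (E m j).[z] <= cabs z * 2^-1 ^+ m.
    have E0 : (E m j)`_0 = 0 by rewrite /E coefB !rhs_coef0 subrr.
    apply: le_trans (horner_nrm0 s0 zs E0) _.
    rewrite ler_wpM2l ?cabs_ge0 // ler_pdivrMr //.
    apply: (@le_trans _ _ (2 * s * 2^-1 ^+ m / 2)); last by rewrite le_eqVlt; apply/orP; left; apply/eqP; field.
    apply: (nrm_rhs_diff aA s0 As) => p; [exact: (nrm_rhop aA s0 As)|exact: (nrm_rhop aA s0 As)|].
    exact: (nrm_rhop_diff aA s0 As).
  have lj : cabs (nodes j) <= N%:R * A by rewrite cabsM cabs_nat ler_wpM2l.
  have hS : cabs (\sum_j0 a j0 * D m j0 z) <= A * S.
    apply: le_trans (cabs_sum _ _ _) _; rewrite mulr_sumr; apply: ler_sum => p _.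
    by rewrite cabsM ler_wpM2r ?cabs_ge0.
  rewrite -(ler_pM2l t0).
  have -> : t * cabs (D' m j z * y) = cabs (z * D' m j z).
    by rewrite [RHS]cabsM hz cabsM [cabs _ * cabs y]mulrC mulrA.
  rewrite D_ode.
  have b1 : cabs (z * nodes j * D m j z) <= cabs z * (N%:R * A) * S.
    have -> : cabs (z * nodes j * D m j z) = cabs z * (cabs (nodes j) * cabs (D m j z)).
      by rewrite -mulrA [LHS]cabsM [X in _ * X]cabsM.
    rewrite -mulrA; apply: ler_wpM2l; first exact: cabs_ge0.
    by apply: ler_pM; rewrite ?cabs_ge0.
  have b2 : cabs ((rp m.+1 j).[z] * \sum_j0 a j0 * D m j0 z) <= cabs z * 2 * (A * S).
    by rewrite cabsM; apply: ler_pM; rewrite ?cabs_ge0.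
  have b3 : cabs (N%:R * (E m j).[z] * F z) <= N%:R * (cabs z * 2^-1 ^+ m) * M.
    rewrite !cabsM cabs_nat; apply: ler_pM; rewrite ?mulr_ge0 ?cabs_ge0 //.
      by rewrite ler_wpM2l.
    exact: hM.
  have b4 := cabsD (z * nodes j * D m j z - (rp m.+1 j).[z] * \sum_j0 a j0 * D m j0 z) (N%:R * (E m j).[z] * F z).
  have b5 := cabsB_le (z * nodes j * D m j z) ((rp m.+1 j).[z] * \sum_j0 a j0 * D m j0 z).
  have b6 : cabs z * ((N%:R * A + 2 * A) * S + N%:R * (2^-1 ^+ m * M)) <= t * (K0 * S + e).
    have -> : t * (K0 * S + e) = (t * s) * ((N%:R * A + 2 * A) * S + N%:R * (2^-1 ^+ m * M)).
      by rewrite /K0 /e; ring.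
    rewrite ler_wpM2r //; last by rewrite hz ler_wpM2l // ltW.
    by rewrite addr_ge0 // !mulr_ge0 ?addr_ge0 ?mulr_ge0 ?exprn_ge0.
  apply: le_trans b4 _; apply: le_trans b6.
  apply: le_trans (lerD (le_trans b5 (lerD b1 b2)) b3) _.
  rewrite le_eqVlt; apply/orP; left; apply/eqP; ring.
have := gronwall_ray K00 e0 (fun j t _ => cD j (t%:C%C * y)) D00 hD i.
move/le_trans; apply; rewrite /e le_eqVlt; apply/orP; left; apply/eqP; ring.
Qed.

Lemma eq0_pow (x : C) (K : R) : (forall m, cabs x <= K * 2^-1 ^+ m) -> x = 0.
Proof.
move=> h; apply/eqP; rewrite -cabs_eq0 eq_le cabs_ge0 andbT.
apply/ler_addgt0Pr => e e0; rewrite add0r.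
have h1 : 0 <= 2^-1 :> R by []; have h2 : 2^-1 < 1 :> R by lra.
by have [m hm] := small_pow K h1 h2 e0; exact: le_trans (h m) hm.
Qed.

(** At a zero of F the residual bound reads N |G_i| <= K 2^-m for all m, so that all G_i vanish
    together with F, which [ddexp_neq0] excludes. *)
Lemma ddexp_disc_neq0 y : y != 0 -> cabs y <= s -> F y != 0.
Proof.
move=> y0 hy; apply/eqP => F0; apply: (ddexp_neq0 nodes_inj (ltn0Sn n) y0 F0) => i.
have [K K0 hK] := rhop_residual.
have : N%:R * G i y = 0.
  apply: (@eq0_pow _ K) => m; have := hK m i y hy.
  by rewrite F0 mulr0 subr0.
by move/eqP; rewrite mulf_eq0 pnatr_eq0 /= => /eqP.
Qed.

(** F vanishes at 0 when N > 1; the conventional value 0 of the quotient there is the right one, as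
    [rho_an] shows. *)
Definition rho i y : C := N%:R * G i y / F y.

Lemma rho0 i : rho i 0 = 0. Proof. by rewrite /rho ddexp2_at0 mulr0 mul0r. Qed.

Lemma rho_approx m i y : cabs y <= s -> cabs (rho i y - (rp m i).[y]) <= 4 * s * 2^-1 ^+ m.
Proof.
move=> hy; have [->|y0] := eqVneq y 0.
  rewrite rho0 horner_coef0 rhop_coef0 subrr cabs0.
  by rewrite !mulr_ge0 ?exprn_ge0 // ltW.
have [K K0 hK] := rhop_residual.
have Fy := ddexp_disc_neq0 y0 hy; have Fp : 0 < cabs (F y) by rewrite cabs_gt0.
apply/ler_addgt0Pr => e e0.
have h1 : 0 <= 2^-1 :> R by []; have h2 : 2^-1 < 1 :> R by lra.
have [m1 hm1] := small_pow K h1 h2 (mulr_gt0 e0 Fp).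
(* An iterate late enough to beat the constant K, then compared with the m-th one at the rate that
   is uniform in N. *)
pose m' := maxn m m1.
have c1 : cabs (rho i y - (rp m'.+1 i).[y]) <= e.
  have -> : rho i y - (rp m'.+1 i).[y] = (N%:R * G i y - (rp m'.+1 i).[y] * F y) / F y.
    by rewrite /rho; field.
  rewrite cabsM cabsV ler_pdivrMr //; apply: le_trans (hK m' i y hy) _.
  apply: le_trans hm1; rewrite ler_wpM2l //.
  apply: ler_wiXn2l => //; [by rewrite ltW|exact: leq_maxr].
have c2 : cabs ((rp m'.+1 i).[y] - (rp m i).[y]) <= 4 * s * 2^-1 ^+ m.
  have -> : (rp m'.+1 i).[y] - (rp m i).[y] = (rp m'.+1 i - rp m i).[y] by rewrite hornerD hornerN.
  apply: le_trans (horner_nrm s0 _ hy) _ => //; apply: (nrm_rhop_cauchy aA s0 As).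
  by rewrite (leq_trans (leq_maxl m m1)).
by have := cabs_tri (rp m'.+1 i).[y] (rho i y) (rp m i).[y]; lra.
Qed.

Lemma rho_an i : an 0 s (rho i).
Proof.
move=> e e0.
have h1 : 0 <= 2^-1 :> R by []; have h2 : 2^-1 < 1 :> R by lra.
have [m hm] := small_pow (4 * s) h1 h2 e0.
exists (rp m i) => y; rewrite subr0 => hy; exact: le_trans (rho_approx m i hy) hm.
Qed.

Lemma rho_le i y : cabs y <= s -> cabs (rho i y) <= 2 * s.
Proof.
move=> hy; apply/ler_addgt0Pr => e e0.
have h1 : 0 <= 2^-1 :> R by []; have h2 : 2^-1 < 1 :> R by lra.
have [m hm] := small_pow (4 * s) h1 h2 e0.
have := rho_approx m i hy; have := horner_nrm s0 (rp m i) hy; have := nrm_rhop aA s0 As m i.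
by have := cabsD (rho i y - (rp m i).[y]) (rp m i).[y]; rewrite subrK; lra.
Qed.

Lemma sum_rho y : cabs y <= s -> \sum_i rho i y = N%:R * y.
Proof.
move=> hy; have [->|y0] := eqVneq y 0.
  by rewrite mulr0 big1 // => i _; rewrite rho0.
have Fy := ddexp_disc_neq0 y0 hy.
rewrite -mulr_suml -mulr_sumr sum_ddexp2_0 // -mulrA mulfK //.
Qed.

(** The quotient y F' / (N F), see [u1_ddexp], written through the [rho i] so as to be analytic
    across the zero of F at the origin. *)
Definition u1 y : C := 1 - N%:R^-1 + N%:R^-1 * \sum_i a i * rho i y.

Lemma u1_ddexp y : y != 0 -> cabs y <= s -> y * ddexp nodes 1 y = N%:R * u1 y * F y.
Proof.
move=> y0 hy; have Fy := ddexp_disc_neq0 y0 hy.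
have := ddexp_mulS nodes_inj 0 y; rewrite mul0r addr0 => ->.
have -> : \sum_i nodes i * ddexp2 nodes i 0 y = (\sum_i a i * rho i y) * F y.
  rewrite mulr_suml; apply: eq_bigr => i _; rewrite /rho /nodes; field.
  exact: Fy.
have N0 : N%:R != 0 :> C by rewrite pnatr_eq0.
rewrite /u1; move: (\sum_i _) => S; rewrite -mulrDl; congr (_ * _).
by field; rewrite nat1r.
Qed.

Lemma u1_an : an 0 s u1.
Proof.
apply: anD; first exact: an_cst.
by apply: anZ; apply: an_sum => i _; apply: anZ; exact: rho_an.
Qed.

Lemma u1_near1 y : cabs y <= s -> cabs (u1 y - 1) <= N%:R^-1 + 6^-1.
Proof.
move=> hy; have -> : u1 y - 1 = - N%:R^-1 + N%:R^-1 * \sum_i a i * rho i y by rewrite /u1; ring.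
apply: le_trans (cabsD _ _) _; rewrite cabsN cabsV cabs_nat lerD2l cabsM cabsV cabs_nat.
rewrite mulrC ler_pdivrMr ?ltr0n //.
apply: le_trans (cabs_sum _ _ _) _.
apply: (@le_trans _ _ (\sum_(i < N) 6^-1)); last by rewrite sumr_const card_ord mulr_natr.
apply: ler_sum => i _; rewrite cabsM; apply: (@le_trans _ _ (A * (2 * s))).
  by apply: ler_pM; rewrite ?cabs_ge0 ?rho_le.
have := As; lra.
Qed.

Lemma u1_le2 y : cabs y <= s -> cabs (u1 y) <= 3.
Proof.
move=> /u1_near1; have := cabsD (u1 y - 1) 1; rewrite subrK cabs1.
have : N%:R^-1 <= 1 :> R by rewrite invf_le1 ?ltr0n // ler1n.
move: (N%:R^-1) => t; lra.
Qed.

Lemma rho_ode i y : y != 0 -> cabs y < s ->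
  y * derive1 (rho i) y = N%:R * (y + a i * y * rho i y - u1 y * rho i y).
Proof.
move=> y0 hy; have Fy := ddexp_disc_neq0 y0 (ltW hy).
have h1 := u1_ddexp y0 (ltW hy).
have -> : derive1 (rho i) y = _ :=
  cder_derive1 (cderM (cderZ N%:R (cder_ddexp2 nodes_inj i y)) (cderV Fy (cder_ddexp nodes 0 y))).
rewrite /rho; move: h1 Fy; set F1 := ddexp nodes 1 y; set F0 := ddexp nodes 0 y.
set g := ddexp2 _ _ _ _; set u := u1 y => h1 Fy.
have -> : y * (N%:R * (nodes i * g + F0) * F0^-1 + N%:R * g * (- F1 / F0 ^+ 2)) =
  N%:R * y * (nodes i * g + F0) * F0^-1 - N%:R * g * (y * F1) / F0 ^+ 2 by field.
by rewrite h1 /nodes; field.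
Qed.

(* uq q y = y^q F^(q)(y) / (N^q F(y)), see uq_ddexp; the recursion exhibits it as
   analytic at the origin. *)
Fixpoint uq q : C -> C :=
  if q is q'.+1 then
    fun y => u1 y * uq q' y + N%:R^-1 * (y * derive1 (uq q') y - q'%:R * uq q' y)
  else fun=> 1.

Lemma pow2_le q : s / 2 ^+ q.+1 <= s / 2 ^+ q.
Proof.
rewrite ler_pM2l // lef_pV2 ?posrE ?exprn_gt0 // exprS ler_peMl ?exprn_ge0 //; lra.
Qed.

Lemma pow2_les q : s / 2 ^+ q <= s.
Proof. by elim: q => [|q IH]; rewrite ?expr0 ?divr1 // (le_trans (pow2_le q)). Qed.

Lemma pow2_gt0 q : 0 < s / 2 ^+ q. Proof. by rewrite divr_gt0 // exprn_gt0. Qed.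

Lemma pow2S q : s / 2 ^+ q.+1 = s / 2 ^+ q / 2.
Proof. by rewrite exprSr invfM mulrA. Qed.

Lemma uq_an q : an 0 (s / 2 ^+ q) (uq q).
Proof.
elim: q => [|q IH] /=; first exact: an_cst.
apply: anD.
  apply: anM; first exact: an_shrink (pow2_les _) u1_an.
  exact: an_shrink (pow2_le _) IH.
apply: anZ; apply: anB.
  apply: anM; first exact: an_id.
  by rewrite pow2S; apply: an_derive1 => //; exact: pow2_gt0.
by apply: anZ; exact: an_shrink (pow2_le _) IH.
Qed.

Lemma uq_ddexp q y : y != 0 -> cabs y < s / 2 ^+ q ->
  y ^+ q * ddexp nodes q y = N%:R ^+ q * uq q y * F y.
Proof.
elim: q y => [|q IH] y y0 hy; first by rewrite !expr0 !mul1r.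
have hyq : cabs y < s / 2 ^+ q := lt_le_trans hy (pow2_le q).
have hys : cabs y < s := lt_le_trans hyq (pow2_les q).
have Fy := ddexp_disc_neq0 y0 (ltW hys).
have N0 : N%:R != 0 :> C by rewrite pnatr_eq0.
have Nq : N%:R ^+ q != 0 :> C by rewrite expf_neq0.
have uE z : z != 0 -> cabs z < s / 2 ^+ q -> uq q z = (N%:R ^+ q)^-1 * (z ^+ q * ddexp nodes q z / F z).
  move=> z0 hz; have Fz := ddexp_disc_neq0 z0 (le_trans (ltW hz) (pow2_les q)).
  by rewrite (IH z z0 hz); field; rewrite Fz Nq.
have cz : cder (fun z : C => z ^+ q) y (q%:R * y ^+ q.-1).
  have := cder_horner ('X^q) y; rewrite derivXn hornerMn hornerXn mulr_natl.
  by apply: cder_local ltr01 _ => w _; rewrite hornerXn.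
have cd := cderZ (N%:R ^+ q)^-1 (cderM (cderM cz (cder_ddexp nodes q y)) (cderV Fy (cder_ddexp nodes 0 y))).
have r0 : 0 < Num.min (cabs y) (s / 2 ^+ q - cabs y) by rewrite lt_min cabs_gt0 y0 subr_gt0.
have du := cder_derive1 (cder_local r0 _ cd).
have {}du := du (uq q); rewrite /= du; last first.
  move=> w; rewrite lt_min => /andP[h1 h2]; rewrite uE //.
    by apply/eqP => w0; move: h1; rewrite w0 sub0r cabsN ltxx.
  by have := cabsD (w - y) y; rewrite subrK; lra.
have h1 := u1_ddexp y0 (ltW hys).
rewrite (uE y y0 hyq) exprS.
move: h1; set u := u1 y; set Fq := ddexp nodes q y; set Fq1 := ddexp nodes q.+1 y.
set F1 := ddexp nodes 1 y; set F0 := ddexp nodes 0 y => h1.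
have hq : q%:R * y ^+ q.-1 * y = q%:R * y ^+ q by case: (q) => [|q']; rewrite ?mul0r //= exprSr mulrA.
have F00 : F0 != 0 by [].
set P := y ^+ q in hq *; set P1 := y ^+ q.-1 in hq *; set M := N%:R ^+ q in Nq *.
have -> : y * (M^-1 * ((q%:R * P1 * Fq + P * Fq1) * F0^-1 + P * Fq * (- F1 / F0 ^+ 2))) =
  M^-1 * (((q%:R * P1 * y) * Fq + P * y * Fq1) * F0^-1 - P * Fq * (y * F1) / F0 ^+ 2).
  by field; rewrite F00 Nq.
rewrite hq h1; rewrite exprS -/M; field.
by rewrite F00 Nq nat1r N0.
Qed.

(** [Bq] bounds [uq] and [Cq], below, bounds N |[uq] - [u1]^q|, both independently of N. They follow
    the recursion of [uq], with |[u1]| <= 3 and Cauchy's estimate for the derivative. *)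
Fixpoint Bq q : R := if q is q'.+1 then (4 + q'%:R) * Bq q' else 1.

Lemma Bq_ge0 q : 0 <= Bq q.
Proof. by elim: q => //= q IH; rewrite mulr_ge0 // addr_ge0. Qed.

Lemma uq_der_le q y : (forall z, cabs z <= s / 2 ^+ q -> cabs (uq q z) <= Bq q) ->
  cabs y <= s / 2 ^+ q.+1 ->
  cabs (y * derive1 (uq q) y - q%:R * uq q y) <= (1 + q%:R) * Bq q.
Proof.
move=> hB hy; have B0 := Bq_ge0 q; have p0 := pow2_gt0 q.
have hB' z : cabs (z - 0) <= s / 2 ^+ q -> cabs (uq q z) <= Bq q by rewrite subr0; exact: hB.
have hy' : cabs (y - 0) <= s / 2 ^+ q / 2 by rewrite subr0 -pow2S.
have h1 := an_der_bound p0 (uq_an q) hB' hy'.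
apply: le_trans (cabsB_le _ _) _; rewrite !cabsM cabs_nat mulrDl mul1r; apply: lerD.
  apply: (@le_trans _ _ (s / 2 ^+ q / 2 * (2 * Bq q / (s / 2 ^+ q)))).
    by apply: ler_pM; rewrite ?cabs_ge0 // -pow2S.
  rewrite le_eqVlt; apply/orP; left; apply/eqP; field.
  by rewrite gt_eqF ?exprn_gt0 //= gt_eqF.
rewrite ler_wpM2l //; apply: hB; exact: le_trans hy (pow2_le q).
Qed.

Lemma uq_le q y : cabs y <= s / 2 ^+ q -> cabs (uq q y) <= Bq q.
Proof.
elim: q y => [|q IH] y hy /=; first by rewrite cabs1.
have h1 := uq_der_le IH hy.
have h2 := IH y (le_trans hy (pow2_le q)); have h3 := u1_le2 (le_trans hy (pow2_les _)).
apply: le_trans (cabsD _ _) _; rewrite !cabsM cabsV cabs_nat.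
have B0 := Bq_ge0 q.
have h4 : cabs (u1 y) * cabs (uq q y) <= 3 * Bq q by apply: ler_pM; rewrite ?cabs_ge0.
have h5 : N%:R^-1 * cabs (y * derive1 (uq q) y - q%:R * uq q y) <= 1 * ((1 + q%:R) * Bq q).
  by apply: ler_pM; rewrite ?cabs_ge0 ?invr_ge0 // invf_le1 ?ltr0n // ler1n.
apply: le_trans (lerD h4 h5) _; lra.
Qed.

Fixpoint Cq q : R := if q is q'.+1 then 3 * Cq q' + (1 + q'%:R) * Bq q' else 0.

Lemma uq_u1 q y : cabs y <= s / 2 ^+ q -> cabs (uq q y - u1 y ^+ q) <= Cq q / N%:R.
Proof.
elim: q y => [|q IH] y hy; first by rewrite expr0 subrr cabs0 mul0r.
have h1 := uq_der_le (@uq_le q) hy.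
have h2 := IH y (le_trans hy (pow2_le q)); have h3 := u1_le2 (le_trans hy (pow2_les _)).
have -> : uq q.+1 y - u1 y ^+ q.+1 = u1 y * (uq q y - u1 y ^+ q) +
  N%:R^-1 * (y * derive1 (uq q) y - q%:R * uq q y) by rewrite exprS /=; ring.
apply: le_trans (cabsD _ _) _; rewrite cabsM [X in _ + X]cabsM cabsV cabs_nat /= mulrDl.
apply: lerD.
  by rewrite -mulrA; apply: ler_pM; rewrite ?cabs_ge0.
by rewrite mulrC ler_wpM2r ?invr_ge0.
Qed.

(** Solving [rho_ode] gives rho_i = y (1 - rho_i' / N) / (u1 - a_i y). By [sum_rho], the deviation
    from 1 is the mean of rho_i' / N / (u1 - a_i y), where |rho_i'| <= 4 and the denominators are at
    least 1 - 1/4 - 1/6 - 1/12 = 1/2; the 1/4 comes from N >= 4. *)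
Lemma mean_inv_u1 y : (4 <= N)%N -> y != 0 -> cabs y <= s / 2 ->
  cabs (N%:R^-1 * (\sum_i (u1 y - a i * y)^-1) - 1) <= 8 / N%:R.
Proof.
move=> N4 y0 hy; have ys : cabs y <= s by have := s0; lra.
have ys' : cabs y < s by have := s0; lra.
have N0 : N%:R != 0 :> C by rewrite pnatr_eq0.
have Np : 0 < N%:R :> R by rewrite ltr0n.
have lb i : 2^-1 <= cabs (u1 y - a i * y).
  have h1 := u1_near1 ys.
  have h2 : N%:R^-1 <= 4^-1 :> R by rewrite lef_pV2 ?posrE ?ltr0n // ler_nat.
  have h3 : cabs (a i * y) <= A * s by rewrite cabsM ler_pM ?cabs_ge0.
  have -> : u1 y - a i * y = 1 - (a i * y - (u1 y - 1)) by ring.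
  have h4 := cabs_lbB 1 (a i * y - (u1 y - 1)); have h5 := cabsB_le (a i * y) (u1 y - 1).
  have h6 := As; rewrite cabs1 in h4; move: (N%:R^-1) h1 h2 => t h1 h2; lra.
have v0 i : u1 y - a i * y != 0 by rewrite -cabs_gt0; have := lb i; lra.
have rE i : rho i y = y * (1 - derive1 (rho i) y / N%:R) / (u1 y - a i * y).
  have := rho_ode i y0 ys'; move: (derive1 _ _) => d h.
  have -> : y * (1 - d / N%:R) = y - (y * d) / N%:R by ring.
  by rewrite h; field; rewrite ?nat1r ?N0 v0.
have S1 := sum_rho ys.
have -> : N%:R^-1 * (\sum_i (u1 y - a i * y)^-1) - 1 =
    N%:R^-1 * (\sum_i derive1 (rho i) y / N%:R / (u1 y - a i * y)).
  have E1 : N%:R^-1 * (\sum_i rho i y) / y = 1 by rewrite S1; field; rewrite nat1r N0 y0.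
  rewrite -[X in _ - X]E1 -[X in _ - X]mulrA mulr_suml -mulrBr -sumrB; congr (_ * _).
  apply: eq_bigr => i _; rewrite [in LHS]rE; field.
  by rewrite ?nat1r ?N0 ?v0 ?y0.
rewrite cabsM cabsV cabs_nat mulrC ler_pM2r ?invr_gt0 //.
apply: le_trans (cabs_sum _ _ _) _.
apply: (@le_trans _ _ (\sum_(i < N) 8 / N%:R)); last first.
  by rewrite sumr_const card_ord -[X in X <= _]mulr_natr divfK // gt_eqF.
apply: ler_sum => i _; rewrite !cabsM !cabsV cabs_nat mulrAC ler_pM2r ?invr_gt0 //.
have d4 : cabs (derive1 (rho i) y) <= 4.
  have h : forall z, cabs (z - 0) <= s -> cabs (rho i z) <= 2 * s.
    by move=> z; rewrite subr0; exact: rho_le.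
  have hy' : cabs (y - 0) <= s / 2 by rewrite subr0.
  apply: le_trans (an_der_bound s0 (rho_an i) h hy') _.
  by rewrite ler_pdivrMr //; lra.
have -> : 8 = 4 * 2^-1^-1 :> R by field.
apply: ler_pM; rewrite ?cabs_ge0 ?invr_ge0 ?cabs_ge0 //.
by rewrite lef_pV2 ?posrE ?lb // (lt_le_trans _ (lb i)).
Qed.

End NormalisedDifferences.

(** * Schur functions as determinants *)

Section Branching.
Variable R : realType.
Local Notation C := (R[i] : numClosedFieldType).
Implicit Types (l mu : seq int) (y : C).

Lemma GT_cons N (a b : int) l : GT N.+1 (a :: b :: l) -> GT N (b :: l) /\ b <= a.
Proof. by move=> [[hs] /= /andP[ba hl]]. Qed.

Lemma interlaceE (a b : int) l : interlace (a :: b :: l) =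
  [seq m :: mu | m <- int_range b a, mu <- interlace (b :: l)].
Proof. by []. Qed.

Lemma mem_int_range (a b m : int) : a <= b -> m \in int_range a b -> a <= m <= b.
Proof.
rewrite /int_range => ab h; have [i hi ->] := mapP h.
by move: hi; rewrite mem_iota; lia.
Qed.

Lemma interlace_GT N l mu : GT N.+1 l -> mu \in interlace l -> GT N mu.
Proof.
elim: N l mu => [|N IH] l mu hl.
  by case: l hl => [|a [|b l]] [] //= _ _; rewrite inE => /eqP ->.
case: l hl => [[] //|a [[] //|b l]] hl.
have [hl' ba] := GT_cons hl.
rewrite interlaceE => /allpairsP [[m nu] [hm hnu ->]]; rewrite /= in hm *.
have [sz so] := IH _ _ hl' hnu; split; first by rewrite /= sz.

have /andP[bm ma] := mem_int_range ba hm.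
case: l hl hl' hnu => [|c l] hl hl' hnu.
  by case: nu sz so hnu => //= d nu; rewrite inE.
have [_ cb] := GT_cons hl'.
move: hnu; rewrite interlaceE => /allpairsP [[m' nu'] [hm' _ E]]; rewrite /= in hm' E; subst nu.
have /andP[_ h] := mem_int_range cb hm'.
by move: so => /= ->; rewrite (le_trans h bm).
Qed.

(** The parts of an interlacing signature range over independent intervals, so the sum of products
    factorises. *)
Lemma interlace_sum N l (g : 'I_N -> int -> C) : GT N.+1 l ->
  \sum_(mu <- interlace l) \prod_(j < N) g j (nth 0 mu j) =
  \prod_(j < N) \sum_(m <- int_range (nth 0 l j.+1) (nth 0 l j)) g j m.
Proof.
elim: N l g => [|N IH] l g hl.
  case: l hl => [|a [|b l]] [] //= _ _.
  by rewrite big_seq1 !big_ord0.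
case: l hl => [[] //|a [[] //|b l]] hl.
have [hl' ba] := GT_cons hl.
rewrite [RHS]big_ord_recl -(IH (b :: l) (fun j => g (lift ord0 j)) hl').
rewrite interlaceE big_allpairs_dep /= mulr_suml; apply: eq_bigr => m _.
rewrite mulr_sumr; apply: eq_bigr => mu _.
by rewrite big_ord_recl.
Qed.

Lemma expz_sumz y l : y != 0 -> y ^ sumz l = \prod_(j < size l) y ^ (nth 0 l j).
Proof.
move=> y0; rewrite /sumz; elim: l => [|a l IH]; first by rewrite big_nil big_ord0 expr0z.
by rewrite big_cons big_ord_recl /= -IH expfzDr.
Qed.

Lemma sum_int_range (a b : int) (g : int -> C) : a <= b ->
  \sum_(m <- int_range a b) (g (m + 1) - g m) = g (b + 1) - g a.
Proof.
move=> ab; rewrite /int_range big_map -/(index_iota 0 _).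
rewrite -[iota _ _]/(index_iota 0 (absz (b - a)).+1).
rewrite (eq_bigr (fun i : nat => g (a + i.+1%:Z) - g (a + i%:Z))) => [|i _].
  rewrite telescope_sumr //; congr (g _ - g _); lia.
by congr (g _ - g _); lia.
Qed.

(* Shifted coordinates: lambda_i + N - i for a signature of length N, in 0-based indexing. *)
Definition shifted l (j : nat) : int := nth 0 l j + (size l)%:Z - j.+1%:Z.

(** Subtracting from each column but the last the next one turns the first row into (0, ..., 0, 1);
    (-1)^N is the sign of the corner cofactor. *)
Lemma det_border N (psi : 'I_N -> 'I_N.+1 -> C) :
  \det (\matrix_(i < N.+1, j < N.+1)
      if unlift ord0 i is Some i' then psi i' j else 1) =
  (-1) ^+ N * \det (\matrix_(i < N, j < N) (psi i (widen_ord (leqnSn N) j) - psi i (lift ord0 j))).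
Proof.
set M := \matrix_(_, _) _.
pose U : 'M[C]_N.+1 := \matrix_(i, j)
  (if i == j then 1 else if (i == j.+1 :> nat) then - 1 else 0).
have detU : \det U = 1.
  rewrite det_trig; last first.
    apply/is_trig_mxP => i j ij; rewrite mxE.
    case: (eqVneq i j) => [ij'|_]; first by move: ij; rewrite ij' ltnn.
    by case: eqP => // ij'; move: ij; rewrite ij' ltnNge leqnSn.
  by apply: big1 => i _; rewrite mxE eqxx.
have sumU (f : 'I_N.+1 -> C) (j : 'I_N) :
    \sum_m f m * U m (widen_ord (leqnSn N) j) = f (widen_ord (leqnSn N) j) - f (lift ord0 j).
  rewrite (bigD1 (widen_ord (leqnSn N) j)) //= mxE eqxx mulr1; congr (_ + _).
  have nw : lift ord0 j != widen_ord (leqnSn N) j.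
    by rewrite -val_eqE /= /bump /= add1n neq_ltn ltnSn orbT.
  rewrite (bigD1 (lift ord0 j)) //= mxE (negbTE nw) /= /bump /= add1n eqxx mulrN1.
  rewrite big1 ?addr0 // => m /andP[m1 m2]; rewrite mxE (negbTE m1).
  case: eqP => [h|_]; last by rewrite mulr0.
  by move: m2; rewrite -val_eqE /= /bump /= add1n h eqxx.
have sumUmax (f : 'I_N.+1 -> C) : \sum_m f m * U m ord_max = f ord_max.
  rewrite (bigD1 ord_max) //= mxE eqxx mulr1 big1 ?addr0 // => m m1.
  rewrite mxE (negbTE m1); case: eqP => [h|_]; last by rewrite mulr0.
  by have := ltn_ord m; rewrite h ltnn.
have -> : \det M = \det (M *m U) by rewrite det_mulmx detU mulr1.
rewrite (expand_det_row _ ord0) (bigD1 ord_max) //=.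
rewrite [X in _ + X]big1 ?addr0 => [|j jm]; last first.
  have [j' ->] : exists j' : 'I_N, j = widen_ord (leqnSn N) j'.
    have jN : (j < N)%N.
      by rewrite ltn_neqAle -ltnS ltn_ord andbT; apply: contra jm => /eqP h; apply/eqP/val_inj.
    by exists (Ordinal jN); apply: val_inj.
  by rewrite mxE (sumU (M ord0)) !mxE unlift_none subrr mul0r.
rewrite mxE (sumUmax (M ord0)) mxE unlift_none mul1r /cofactor /= add0n; congr (_ * \det _).
apply/matrixP => i j; rewrite !mxE.
have -> : lift ord_max j = widen_ord (leqnSn N) j.
  by apply: val_inj; rewrite /= /bump leqNgt ltn_ord.
rewrite (sumU (M (lift ord0 i))) !mxE !liftK //.
Qed.

(** Dividing column j by y^(l_j) makes the first row constant. After [det_border] the entries become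
    sums over the interlacing intervals, since y^(-m) chi(m) has increments y^(-m-1) phi(m) and
    telescopes. *)
Lemma branching_det N l y (phi chi : 'I_N -> int -> C) : GT N.+1 l -> y != 0 ->
  (forall i m, phi i m = chi i (m + 1) - y * chi i m) ->
  \det (\matrix_(i < N.+1, j < N.+1)
      if unlift ord0 i is Some i' then chi i' (shifted l j) else y ^ shifted l j) =
  (-1) ^+ N * \sum_(mu <- interlace l) y ^ (sumz l - sumz mu) *
     \det (\matrix_(i < N, j < N) phi i (shifted mu j)).
Proof.
move=> hl y0 hphi; have [sl _] := hl.
have yz (m : int) : y ^ m != 0 by rewrite expfz_neq0.
pose psi i (j : 'I_N.+1) := y ^ (- shifted l j) * chi i (shifted l j).
pose D : 'rV[C]_N.+1 := \row_j y ^ shifted l j.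
have -> : \matrix_(i < N.+1, j < N.+1)
      (if unlift ord0 i is Some i' then chi i' (shifted l j) else y ^ shifted l j) =
    (\matrix_(i < N.+1, j < N.+1) if unlift ord0 i is Some i' then psi i' j else 1) *m diag_mx D.
  apply/matrixP => i j; rewrite mul_mx_diag !mxE; case: unlift => [i'|]; last by rewrite mul1r.
  by rewrite /psi mulrAC -expfzDr // addNr expr0z mul1r.
rewrite det_mulmx det_border det_diag -mulrA; congr (_ * _).
have szmu mu : mu \in interlace l -> size mu = N by move/(interlace_GT hl) => [].
pose T i (j : nat) := \sum_(m <- int_range (nth 0 l j.+1) (nth 0 l j)) y ^ (- m) * phi i (m + N%:Z - j.+1%:Z).
have E1 : \sum_(mu <- interlace l) y ^ (sumz l - sumz mu) * \det (\matrix_(i < N, j < N) phi i (shifted mu j)) =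
    y ^ sumz l * \det (\matrix_(i < N, j < N) T i j).
  transitivity (\sum_(mu <- interlace l) y ^ sumz l * \sum_(s : 'S_N)
     (-1) ^+ s * \prod_(j < N) (y ^ (- nth 0 mu j) * phi (s j) (nth 0 mu j + N%:Z - j.+1%:Z))).
    rewrite !big_seq; apply: eq_bigr => mu hmu.
    rewrite expfzDr // -mulrA; congr (_ * _).
    rewrite -invr_expz expz_sumz // -prodfV (szmu _ hmu) -det_tr /determinant mulr_sumr.
    apply: eq_bigr => s _; rewrite mulrCA; congr (_ * _); rewrite -big_split /=.
    apply: eq_bigr => j _; rewrite !mxE /shifted (szmu _ hmu); congr (_ * _).
    by rewrite invr_expz.
  rewrite -mulr_sumr; congr (_ * _); rewrite exchange_big /= -det_tr /determinant.
  apply: eq_bigr => s _; rewrite -mulr_sumr; congr (_ * _).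
  rewrite (interlace_sum (fun j m => y ^ (- m) * phi (s j) (m + N%:Z - j.+1%:Z)) hl).
  by apply: eq_bigr => j _; rewrite !mxE.
rewrite E1.
have srt (j : nat) : (j < N)%N -> nth 0 l j.+1 <= nth 0 l j.
  move=> jN; have [_ so] := hl.
  have := @sorted_ltn_nth _ (fun a b : int => b <= a) _ 0 l so j j.+1.
  rewrite !inE sl; apply => //; try by lia.
  by move=> a b c ab bc; exact: le_trans bc ab.
have E2 (i j : 'I_N) : T i j = psi i (widen_ord (leqnSn N) j) * y ^ (N%:Z - j%:Z)
    - psi i (lift ord0 j) * y ^ (N%:Z - j%:Z).
  rewrite /T (eq_bigr (fun m => y ^ (N%:Z - j%:Z) * (y ^ (- (m + 1 + N%:Z - j.+1%:Z)) * chi i (m + 1 + N%:Z - j.+1%:Z)) -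
     y ^ (N%:Z - j%:Z) * (y ^ (- (m + N%:Z - j.+1%:Z)) * chi i (m + N%:Z - j.+1%:Z)))); last first.
    move=> m _; rewrite hphi mulrBr !mulrA -!expfzDr //.
    have -> : m + N%:Z - j.+1%:Z + 1 = m + 1 + N%:Z - j.+1%:Z by ring.
    have -> : y ^ (- m) * y = y ^ (- m + 1) by rewrite -{2}(expr1z y) -expfzDr.
    congr (y ^ _ * _ - y ^ _ * _); lia.
  rewrite (@sum_int_range _ _ (fun m => y ^ (N%:Z - j%:Z) *
    (y ^ (- (m + N%:Z - j.+1%:Z)) * chi i (m + N%:Z - j.+1%:Z)))) ?srt //.
  rewrite /psi /shifted sl /= /bump /= add1n ![y ^ (N%:Z - _) * _]mulrC.
  have -> : nth 0 l j + 1 + N%:Z - j.+1%:Z = nth 0 l j + N.+1%:Z - j.+1%:Z by lia.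
  have -> : nth 0 l j.+1 + N%:Z - j.+1%:Z = nth 0 l j.+1 + N.+1%:Z - j.+2%:Z by lia.
  by [].
have -> : \matrix_(i < N, j < N) T i j = (\matrix_(i < N, j < N)
    (psi i (widen_ord (leqnSn N) j) - psi i (lift ord0 j))) *m diag_mx (\row_(j < N) y ^ (N%:Z - j%:Z)).
  by apply/matrixP => i j; rewrite mul_mx_diag !mxE E2 mulrBl.
rewrite det_mulmx det_diag [RHS]mulrCA; congr (_ * _).
rewrite expz_sumz // sl big_ord_recr [in RHS]big_ord_recr /=.
under eq_bigr do rewrite mxE.
rewrite mulrAC -big_split /= !mxE; congr (_ * _).
  apply: eq_bigr => j _; rewrite mxE -expfzDr // /shifted sl /=; congr (y ^ _); lia.
by rewrite /shifted sl /=; congr (y ^ _); lia.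
Qed.

End Branching.

(** * Confluent Vandermonde determinants *)

Section SchurDeterminant.
Variable R : realType.
Local Notation C := (R[i] : numClosedFieldType).
Implicit Types (l mu : seq int) (x y : C) (xs : seq C) (m : int) (p q : nat).

(* The binomial polynomial X (X - 1) ... (X - p + 1) / p!. *)
Definition binpoly p : {poly C} := (p`!%:R)^-1 *: \prod_(q < p) ('X - (q%:R)%:P).

Definition bin_at p m : C := (binpoly p).[m%:~R].

Lemma bin_atE p m : bin_at p m = (p`!%:R)^-1 * \prod_(q < p) (m%:~R - q%:R).
Proof.
rewrite /bin_at hornerZ horner_prod; congr (_ * _).
by apply: eq_bigr => q _; rewrite hornerXsubC.
Qed.

Lemma bin_at0 m : bin_at 0 m = 1.
Proof. by rewrite bin_atE big_ord0 fact0 invr1 mulr1. Qed.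

Lemma bin_atS p m : bin_at p.+1 (m + 1) = bin_at p.+1 m + bin_at p m.
Proof.
rewrite !bin_atE big_ord_recl big_ord_recr /=.
have -> : \prod_(i < p) ((m + 1)%:~R - (bump 0 i)%:R) = \prod_(i < p) (m%:~R - i%:R) :> C.
  by apply: eq_bigr => i _; rewrite /bump /= add1n -natr1 rmorphD /= opprD addrACA subrr addr0.
rewrite factS natrM rmorphD /= -natr1; set P := \prod_(_ < _) _.
have f0 : p`!%:R != 0 :> C by rewrite pnatr_eq0 -lt0n fact_gt0.
have p0 : p%:R + 1 != 0 :> C by rewrite natr1 pnatr_eq0.
by field; rewrite f0 p0.
Qed.

(** Powers x_i^m, completed by binomial polynomials in m: the confluent form of the Vandermonde rows
    of the remaining variables, which are equal to 1. *)
Definition baserow xs p m : C :=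
  if (p < size xs)%N then (nth 0 xs p) ^ m else bin_at (p - size xs) m.

Fixpoint vdm xs : C := if xs is y :: xs' then vdm xs' * \prod_(x <- xs') (x - y) else 1.

Definition det_sign N : C := \prod_(j < N) (-1) ^+ j.

Lemma det_sign_neq0 N : det_sign N != 0.
Proof. by apply/prodf_neq0 => j _; rewrite signr_eq0. Qed.

(** The operator chi(m + 1) - y chi(m) is diagonal on powers and, by Pascal's rule, bidiagonal on
    binomials, with 1 - y on the diagonal. *)
Lemma baserow_step N xs n y (i : 'I_N) m : N = (size xs + n)%N -> all (fun x => x != 0) xs ->
  baserow xs i (m + 1) - y * baserow xs i m =
  \sum_(j < N) (if i == j then (if (i < size xs)%N then nth 0 xs i else 1) - y
     else if (size xs <= j)%N && (i == j.+1 :> nat) then 1 else 0) * baserow xs j m.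
Proof.
move=> hN hx; rewrite (bigD1 i) //= eqxx.
rewrite /baserow; case: ltnP => ik.
  rewrite big1 ?addr0 => [|j ji].
    by rewrite expfzDr ?expr1z ?(all_nthP _ hx) // mulrBl mulrC.
  rewrite eq_sym (negbTE ji); case: ifP => [/andP[h1 /eqP h2]|_]; last by rewrite mul0r.
  by move: ik; rewrite h2 ltnNge (leq_trans h1).
have [ik'|ik'] := eqVneq (i : nat) (size xs).
  rewrite ik' subnn !bin_at0 big1 ?addr0 ?mulr1 // => j ji.
  rewrite eq_sym (negbTE ji); case: ifP => [/andP[h1 /eqP h2]|_]; last by rewrite mul0r.
  by move: h1; rewrite h2 ltnn.
have [j0 hj0] : exists j : 'I_N, i = j.+1 :> nat.
  have h : (i.-1 < N)%N by have := ltn_ord i; lia.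
  by exists (Ordinal h) => /=; lia.
have j0i : j0 != i.
  by apply/eqP => h; move: hj0; rewrite h => /eqP; rewrite -[X in X == _]addn0 -addn1 eqn_add2l.
rewrite (bigD1 j0) //= eq_sym (negbTE j0i).
have kj0 : (size xs <= j0)%N by lia.
rewrite kj0 hj0 eqxx /= ltnNge kj0 /= mul1r big1 ?addr0; last first.
  move=> j /andP[ji jj0]; rewrite eq_sym (negbTE ji); case: ifP => [/andP[_ /eqP h]|_]; last by rewrite mul0r.
  by move: jj0; rewrite -val_eqE -eqSS h eqxx.
by rewrite subSn // bin_atS; ring.
Qed.

Lemma det_baserow_step N xs n y l : N = (size xs + n)%N -> all (fun x => x != 0) xs ->
  \det (\matrix_(i < N, j < N) (baserow xs i (shifted l j + 1) - y * baserow xs i (shifted l j))) =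
  \prod_(x <- xs) (x - y) * (1 - y) ^+ n * \det (\matrix_(i < N, j < N) baserow xs i (shifted l j)).
Proof.
move=> hN hx.
pose D : 'M[C]_N := \matrix_(i, j) (if i == j then (if (i < size xs)%N then nth 0 xs i else 1) - y
     else if (size xs <= j)%N && (i == j.+1 :> nat) then 1 else 0).
have -> : \matrix_(i < N, j < N) (baserow xs i (shifted l j + 1) - y * baserow xs i (shifted l j)) =
    D *m (\matrix_(i < N, j < N) baserow xs i (shifted l j)).
  apply/matrixP => i j; rewrite !mxE (baserow_step _ i _ hN hx).
  by apply: eq_bigr => p _; rewrite !mxE.
rewrite det_mulmx; congr (_ * _).
rewrite det_trig; last first.
  apply/is_trig_mxP => i j ij; rewrite mxE.
  case: (eqVneq i j) => [ij'|_]; first by move: ij; rewrite ij' ltnn.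
  by case: ifP => // /andP[_ /eqP ij']; move: ij; rewrite ij' ltnNge leqnSn.
have DE i : D i i = (if (i < size xs)%N then nth 0 xs i else 1) - y by rewrite mxE eqxx.
rewrite (eq_bigr _ (fun i _ => DE i)).
rewrite (big_nth 0) big_mkord; subst N; rewrite big_split_ord /=; congr (_ * _).
  by apply: eq_bigr => i _; rewrite ltn_ord.
under eq_bigr do rewrite ltnNge leq_addr /=.
by rewrite prodr_const card_ord.
Qed.

(** Induction along the branching rule, removing the first variable. Once only ones are left, y = 1
    and the difference operator lowers the binomials by one degree, so the rows merely shift. *)
Lemma schur_baserow N xs n l : N = (size xs + n)%N -> all (fun x => x != 0) xs -> GT N l ->
  \det (\matrix_(i < N, j < N) baserow xs i (shifted l j)) =
  det_sign N * (vdm xs * (\prod_(x <- xs) (1 - x)) ^+ n * schur (xs ++ nseq n 1) l).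
Proof.
elim: N xs n l => [|N IH] xs n l.
  case: xs n => [|? ?] [|?] //= _ _ [sl _]; rewrite det_mx00 /det_sign big_ord0 big_nil.
  by case: l sl => //= _; rewrite ?expr0 !mulr1.
have signS : det_sign N.+1 = (-1) ^+ N * det_sign N by rewrite /det_sign big_ord_recr /= mulrC.
case: xs n => [|y xs] n.
  rewrite add0n => <- _ hl; rewrite signS.
  pose phi (i : 'I_N) m := baserow [::] i m; pose chi (i : 'I_N) m := baserow [::] i.+1 m.
  have hphi i m : phi i m = chi i (m + 1) - 1 * chi i m.
    by rewrite /phi /chi /baserow /= !subn0 bin_atS; ring.
  have := branching_det hl (oner_neq0 C) hphi.
  have -> : \matrix_(i < N.+1, j < N.+1) (if unlift ord0 i is Some i' then chi i' (shifted l j)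
      else 1 ^ shifted l j) = \matrix_(i < N.+1, j < N.+1) baserow [::] i (shifted l j).
    apply/matrixP => i j; rewrite !mxE; case: unliftP => [i' ->|->].
      by rewrite /chi /= /bump /= add1n.
    by rewrite /baserow /= bin_at0 exp1rz.
  move=> ->; rewrite -[RHS]mulrA; congr (_ * _).
  rewrite [vdm _]/= big_nil expr1n !mul1r.
  rewrite mulr_sumr; apply: eq_big_seq => mu hmu.
  rewrite exp1rz !mul1r (IH [::] N mu) //; last exact: interlace_GT hmu.
  by rewrite /= big_nil expr1n !mul1r.
move=> hN /= /andP[y0 hx] hl; have {}hN : N = (size xs + n)%N by move: hN => /= [].
rewrite signS.
pose chi (i : 'I_N) m := baserow xs i m.
have := @branching_det _ N l y (fun i m => chi i (m + 1) - y * chi i m) chi hl y0 (fun _ _ => erefl).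
have -> : \matrix_(i < N.+1, j < N.+1) (if unlift ord0 i is Some i' then chi i' (shifted l j)
    else y ^ shifted l j) = \matrix_(i < N.+1, j < N.+1) baserow (y :: xs) i (shifted l j).
  apply/matrixP => i j; rewrite !mxE; case: unliftP => [i' ->|->]; last by [].
  by rewrite /chi /baserow /= /bump /= add1n ltnS subSS.
move=> ->; rewrite -[RHS]mulrA; congr (_ * _).
rewrite big_cons mulrA !mulr_sumr; apply: eq_big_seq => mu hmu.
rewrite (det_baserow_step y mu hN hx) (IH xs n mu hN hx (interlace_GT hl hmu)) exprMn.
ring.
Qed.

Lemma shifted_lt N l (i j : nat) : GT N l -> (i < j < N)%N -> shifted l j < shifted l i.
Proof.
move=> [sl so] /andP[ij jN].
have h : nth 0 l j <= nth 0 l i.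
  have := @sorted_ltn_nth _ (fun a b : int => b <= a) _ 0 l so i j.
  rewrite !inE sl; apply => //; last exact: ltn_trans jN.
  by move=> a b c ab bc; exact: le_trans bc ab.
by rewrite /shifted; lia.
Qed.

Lemma shifted_inj N l : GT N l -> injective (fun j : 'I_N => (shifted l j)%:~R : C).
Proof.
move=> hl i j /= /eqP; rewrite eqr_int => /eqP h; apply: val_inj => /=.
case: (ltngtP i j) => // ij.
  by have := @shifted_lt _ _ i j hl; rewrite ij ltn_ord h ltxx => /(_ isT).
by have := @shifted_lt _ _ j i hl; rewrite ij ltn_ord h ltxx => /(_ isT).
Qed.

Lemma size_binpoly p : size (binpoly p) = p.+1.
Proof.
rewrite size_scale; last by rewrite invr_eq0 pnatr_eq0 -lt0n fact_gt0.
have -> : \prod_(q < p) ('X - (q%:R)%:P) = \prod_(q <- index_enum 'I_p) ('X - ((q : nat)%:R)%:P) :> {poly C} by [].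
by rewrite size_prod_XsubC -[index_enum _]enumT size_enum_ord.
Qed.

Lemma lead_coef_binpoly p : lead_coef (binpoly p) != 0.
Proof. by rewrite lead_coef_eq0 -size_poly_eq0 size_binpoly. Qed.

(** The matrix of [schur_baserow] is multiplied by the weighted powers ddw_j l_j^e, so that entries
    become divided differences, which kill polynomials of degree below N - 1, where N = k + n. With
    the exponents in the order 0, ..., k - 1, N - 1, ..., k the product is block triangular: the
    wanted block of size k, and a triangular invertible block Z that does not involve x. *)
Lemma schur_det k n l : GT (k + n) l -> exists2 kappa : C, kappa != 0 &
  forall x : 'I_k -> C, (forall i, x i != 0) ->
  kappa * (vdm [seq x i | i <- enum 'I_k] * (\prod_i (1 - x i)) ^+ n *
     schur ([seq x i | i <- enum 'I_k] ++ nseq n 1) l) =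
  \det (\matrix_(i < k, r < k) dd (fun j : 'I_(k + n) => (shifted l j)%:~R)
     (fun j => (shifted l j)%:~R ^+ r * x i ^ shifted l j)).
Proof.
move=> hl; set L : 'I_(k + n) -> C := fun j => (shifted l j)%:~R.
have L_inj : injective L := shifted_inj hl.
pose e (c : 'I_(k + n)) : nat := if (c < k)%N then (c : nat) else ((k + n).-1 - (c - k))%N.
have e_inj : injective e.
  move=> c c'; rewrite /e => h; apply: val_inj => /=.
  have h1 := ltn_ord c; have h2 := ltn_ord c'.
  by move: h; case: (ltnP c k) => a1; case: (ltnP c' k) => a2; lia.
have e_lt c : (e c < k + n)%N.
  by rewrite /e; have h := ltn_ord c; case: (ltnP c k); lia.
pose B : 'M[C]_(k + n) := \matrix_(j, c) (ddw L j * L j ^+ e c).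
have detB : \det B != 0.
  rewrite -det_tr; apply/det0P => -[v v0 vB].
  have P0 : \sum_c v 0 c *: 'X^(e c) = 0 :> {poly C}.
    apply: (poly_nodes0 L_inj).
      apply: leq_trans (size_sum _ _ _) _; apply/bigmax_leqP => c _.
      by apply: leq_trans (size_scale_leq _ _) _; rewrite size_polyXn.
    move=> j; have := congr1 (fun A : 'rV_(k + n) => A 0 j) vB; rewrite !mxE.
    under eq_bigr do rewrite !mxE mulrCA.
    rewrite -mulr_sumr => /eqP; rewrite mulf_eq0 (negbTE (ddw_neq0 L_inj _)) /= => /eqP h.
    rewrite horner_sum -[RHS]h; apply: eq_bigr => c _.
    by rewrite hornerZ hornerXn.
  move/eqP: v0; apply; apply/rowP => c; rewrite mxE.
  have := congr1 (fun p : {poly C} => p`_(e c)) P0.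
  rewrite coef0 coef_sum (bigD1 c) //= coefZ coefXn eqxx mulr1 big1 ?addr0 // => c' cc'.
  by rewrite coefZ coefXn (inj_eq e_inj) eq_sym (negbTE cc') mulr0.
have ddlow p q : (p + q < (k + n).-1)%N -> dd L (fun j => bin_at p (shifted l j) * L j ^+ q) = 0.
  move=> pq; have := @dd_poly _ _ _ L_inj (binpoly p * 'X^q).
  have sz : (size (binpoly p * 'X^q)%R <= (k + n).-1)%N.
    by apply: leq_trans (size_polyMleq _ _) _; rewrite size_binpoly size_polyXn; lia.
  rewrite (leq_trans sz (leq_pred _)) => /(_ isT); rewrite nth_default // => h.
  by rewrite -[RHS]h; congr (dd _ _); apply/funext => j; rewrite hornerM hornerXn.
have ddtop p q : (0 < k + n)%N -> (p + q = (k + n).-1)%N -> dd L (fun j => bin_at p (shifted l j) * L j ^+ q) != 0.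
  move=> kn pq; have := @dd_poly _ _ _ L_inj (binpoly p * 'X^q).
  have sz : size (binpoly p * 'X^q)%R = (k + n)%N.
    by rewrite size_Mmonic ?monicXn -?size_poly_eq0 ?size_binpoly // size_polyXn; lia.
  rewrite sz leqnn => /(_ isT) h.
  have -> : dd L (fun j => bin_at p (shifted l j) * L j ^+ q) = lead_coef (binpoly p * 'X^q).
    rewrite lead_coefE sz -h; congr (dd _ _); apply/funext => j; rewrite hornerM hornerXn //.
  by rewrite lead_coefM lead_coefXn mulr1 lead_coef_binpoly.
pose Z : 'M[C]_n := \matrix_(p, q) dd L (fun j => bin_at p (shifted l j) * L j ^+ e (rshift k q)).
have eR (q : 'I_n) : e (rshift k q) = ((k + n).-1 - q)%N.
  by rewrite /e /= ltnNge leq_addr /= addKn.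
have detZ : \det Z != 0.
  rewrite det_trig; last first.
    apply/is_trig_mxP => p q pq; rewrite mxE eR ddlow //.
    by have := ltn_ord q; lia.
  apply/prodf_neq0 => p _; rewrite mxE eR ddtop //; have := ltn_ord p; lia.
exists (det_sign (k + n) * \det B / \det Z).
  by rewrite !mulf_neq0 ?invr_eq0 ?det_sign_neq0.
move=> x x0; set xs := [seq x i | i <- enum 'I_k].
have sxs : size xs = k by rewrite size_map size_enum_ord.
have hN : (k + n = size xs + n)%N by rewrite sxs.
have axs : all (fun y => y != 0) xs by apply/allP => _ /mapP [i _ ->].
have nxs (i : 'I_k) : nth 0 xs i = x i.
  by rewrite (nth_map i) ?size_enum_ord // nth_ord_enum.
have pxs : \prod_(y <- xs) (1 - y) = \prod_i (1 - x i).
  by rewrite big_map -[index_enum _]enumT.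
have H := schur_baserow hN axs hl; rewrite pxs in H.
set W := vdm xs * _ ^+ n * _ in H *.
suff : det_sign (k + n) * W * \det B = \det (\matrix_(i < k, r < k)
    dd L (fun j => L j ^+ r * x i ^ shifted l j)) * \det Z.
  move=> E; apply: (mulIf detZ); rewrite -E; field.
  exact: detZ.
rewrite -H -det_mulmx; set M := _ *m B.
have ME i c : M i c = dd L (fun j => baserow xs i (shifted l j) * L j ^+ e c).
  by rewrite /M mxE; apply: eq_bigr => j _; rewrite !mxE; ring.
have -> : M = block_mx (\matrix_(i < k, r < k) dd L (fun j => L j ^+ r * x i ^ shifted l j))
    (ursubmx M) 0 Z.
  rewrite -[LHS]submxK; congr block_mx.
  - apply/matrixP => i r; rewrite [LHS]mxE [LHS]mxE ME mxE; congr (dd _ _); apply/funext => j.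
    by rewrite /e /= ltn_ord mulrC /baserow /= sxs ltn_ord nxs.
  - apply/matrixP => p r; rewrite [LHS]mxE [LHS]mxE ME mxE -[RHS](@ddlow p r); last first.
      by have := ltn_ord p; have := ltn_ord r; lia.
    congr (dd _ _); apply/funext => j; rewrite /e /= ltn_ord /baserow /= sxs ltnNge leq_addr /=.
    by rewrite addKn.
  - apply/matrixP => p q; rewrite [LHS]mxE [LHS]mxE ME mxE; congr (dd _ _); apply/funext => j.
    by rewrite /baserow /= sxs ltnNge leq_addr /= addKn.
by rewrite det_ublock.
Qed.

End SchurDeterminant.

(** * Empirical Cauchy transforms *)

Section PiecewiseBounded.
Variable R : realType.
Implicit Types (f : R -> R) (t : seq R).

Lemma within_continuous_bounded f (a b : R) : a <= b -> {within `[a, b], continuous f} ->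
  exists B, forall x, a <= x <= b -> `|f x| <= B.
Proof.
move=> ab cf; have [c _ hc] := EVT_max ab cf; have [d _ hd] := EVT_min ab cf.
exists (`|f c| + `|f d|) => x hx; rewrite ler_norml.
have xi : x \in `[a, b]%R by rewrite in_itv.
have := hc x xi; have := hd x xi; have := ler_norm (f c); have := ler_norm (- f d).
rewrite normrN; have := normr_ge0 (f c); have := normr_ge0 (f d).
by move=> ? ? ? ? ? ?; apply/andP; split; lra.
Qed.

Lemma pieces_bounded f t : sorted <%R t ->
  (forall i, (i.+1 < size t)%N -> exists g : R -> R,
      {within `[nth 0 t i, nth 0 t i.+1], continuous g} /\
      forall x, nth 0 t i < x < nth 0 t i.+1 -> f x = g x) ->
  exists B, forall x, head 1 t <= x <= last 0 t -> `|f x| <= B.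
Proof.
elim: t => [|a [|b t] IH] so hp.
- by exists 0 => x /= /andP[h1 h2]; have := le_trans h1 h2; rewrite ler10.
- by exists `|f a| => x /=; rewrite -eq_le => /eqP ->.
move: so => /= /andP[ab so].
have [B hB] := IH so (fun i hi => hp i.+1 hi).
have [g [cg fg]] := hp 0%N isT.
have [B' hB'] := within_continuous_bounded (ltW ab) cg.
exists (`|f a| + `|B'| + `|B|) => x /= /andP[ax xl].
have n1 := normr_ge0 (f a); have n2 := normr_ge0 B'; have n3 := normr_ge0 B.
have [xa|xa] := eqVneq x a; first by rewrite xa; lra.
have [bx|xb] := leP b x.
  have /hB h : head 1 (b :: t) <= x <= last 0 (b :: t) by rewrite /= bx xl.
  by have := ler_norm B; lra.
have ax' : a < x by rewrite lt_neqAle eq_sym xa ax.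
rewrite fg /= ?ax' //.
have /hB' h : a <= x <= b by rewrite ax ltW.
by have := ler_norm B'; lra.
Qed.

Lemma piecewise_continuous_bounded f : piecewise_continuous f ->
  exists B, forall x, 0 <= x <= 1 -> `|f x| <= B.
Proof.
move=> [t [so h0 h1 hp]]; have [B hB] := pieces_bounded so hp.
exists B => x hx; apply: hB; move: h0 h1; case: t {so hp} => [|a t] /=.
  by move=> /eqP; rewrite oner_eq0.
by move=> -> ->.
Qed.

Definition scaled_node (l : seq int) (i : nat) : R := (shifted l i)%:~R / (size l)%:R.

(** Regularity keeps lambda_j / N at bounded distance from f, which is bounded on [0, 1]; the shift
    (N - j) / N adds at most 1. *)
Lemma regular_bounded (lam : nat -> seq int) : (forall N, GT N (lam N)) -> regular R lam ->
  exists2 A : R, 0 < A & forall N i, (i < N)%N -> `|scaled_node (lam N) i| <= A.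
Proof.
move=> hG [f [pf [K [_ hK]]]]; have [B hB] := piecewise_continuous_bounded pf.
exists (`|K| + `|B| + 1) => [|N i iN].
  by rewrite ltr_wpDl // addr_ge0.
have [sN _] := hG N; rewrite /scaled_node /shifted sN.
have N0 : 0 < N%:R :> R by rewrite ltr0n (leq_ltn_trans _ iN).
have Nn : N%:R != 0 :> R by rewrite gt_eqF.
have -> : (nth 0 (lam N) i + N%:Z - i.+1%:Z)%:~R / N%:R =
   ((nth 0 (lam N) i)%:~R / N%:R - f (i.+1%:R / N%:R)) + f (i.+1%:R / N%:R) + (1 - i.+1%:R / N%:R) :> R.
  rewrite rmorphB rmorphD /= -!pmulrn mulrBl mulrDl divff //; ring.
have r1 : 0 <= (i.+1%:R / N%:R : R) <= 1.
  by rewrite divr_ge0 //= ler_pdivrMr // mul1r ler_nat.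
have k1 := hK N i iN; have k2 := hB _ r1.
have k3 : `|1 - i.+1%:R / N%:R| <= 1 :> R.
  by move: r1 => /andP[]; move: (i.+1%:R / N%:R) => u u0 u1; rewrite ger0_norm; lra.
have := ler_norm K; have := ler_norm B.
move: k1 k2 k3; set u := _ - f _; set v := f _; set w := 1 - _ => k1 k2 k3 k4 k5.
have := ler_normD (u + v) w; have := ler_normD u v; lra.
Qed.

End PiecewiseBounded.

Section CauchyTransform.
Variables (R : realType) (lam : nat -> seq int) (m : probability R R) (A : R).
Local Notation C := (R[i] : numClosedFieldType).
Hypotheses (hG : forall N, GT N (lam N)) (hw : weak_conv lam m) (A0 : 0 < A)
  (hA : forall N i, (i < N)%N -> `|scaled_node R (lam N) i| <= A :> R).
Implicit Types (c : C) (x : R).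

(** Retraction onto [-A, A], which contains all nodes: composition with it makes integrands bounded
    and continuous, as weak convergence demands. *)
Definition clamp x : R := Num.max (- A) (Num.min A x).

Lemma clamp_bound x : - A <= clamp x <= A.
Proof. by rewrite /clamp le_max lexx /= ge_max ge_min lexx /= andbT; have := A0; lra. Qed.

Lemma clamp_id x : `|x| <= A -> clamp x = x.
Proof.
by rewrite ler_norml => /andP[h1 h2]; rewrite /clamp (min_idPr _) // (max_idPr _).
Qed.

Lemma clamp_continuous : continuous clamp.
Proof.
move=> x; apply: (@continuous_max _ _ (fun=> - A) (fun x => Num.min A x)); first exact: cvg_cst.
by apply: (@continuous_min _ _ (fun=> A) (fun x => x)); [exact: cvg_cst|exact: cvg_id].
Qed.

Lemma emp_integral_nodes (f : R -> R) N :
  emp_integral (lam N) f = N%:R^-1 * \sum_(i < N) f (scaled_node R (lam N) i).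
Proof.
have [sN _] := hG N; rewrite /emp_integral sN; congr (_ * _).
have H i : (i < N)%N -> f (((nth 0 (lam N) i)%:~R + N%:R - i.+1%:R) / N%:R) = f (scaled_node R (lam N) i).
  move=> _; rewrite /scaled_node /shifted sN rmorphB rmorphD /= -!pmulrn //.
move: sN H; move: (nth 0 (lam N)) => g sN H.
by apply: eq_bigr => i _; exact: H.
Qed.

(** The compact support of m is derived: min(1, |x - clamp x|) is bounded, continuous and zero at
    every node, so its integral against m is 0. *)
Lemma clamp_ae : ae_eq m setT (fun x => (clamp x)%:E) (fun x => x%:E).
Proof.
pose d x := Num.min 1 `|x - clamp x|.
have d0 x : 0 <= d x by rewrite le_min ler01 normr_ge0.
have d1 x : d x <= 1 by rewrite ge_min lexx.
have cd : continuous d.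
  move=> x; apply: (@continuous_min _ _ (fun=> 1) (fun x => `|x - clamp x|)); first exact: cvg_cst.
  by apply: cvg_norm; apply: cvgB; [exact: cvg_id|exact: clamp_continuous].
have bd : exists M : R, forall x, `|d x| <= M by exists 1 => x; rewrite ger0_norm.
have := hw cd bd.
have -> : (fun N => emp_integral (lam N) d) = fun=> 0.
  apply/funext => N; rewrite emp_integral_nodes big1 ?mulr0 // => i _.
  by rewrite /d clamp_id ?hA // subrr normr0 (min_idPr _).
move=> /cvg_lim; rewrite lim_cst // => /(_ (@norm_hausdorff _ _)) I0.
have md : measurable_fun setT d by exact: continuous_measurable_fun.
have id : m.-integrable setT (EFin \o d).
  apply: measurable_bounded_integrable => //.
    by rewrite (le_lt_trans (probability_le1 m _)) // ltry.
  by exists 1; split => // M M1 x _ /=; rewrite ger0_norm // (le_trans (d1 x)) // ltW.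
have I1 : (\int[m]_x (d x)%:E = 0)%E.
  have fn := integrable_fin_num measurableT id.
  by rewrite -(fineK fn); congr EFin; exact: esym I0.
have : ae_eq m setT (EFin \o d) (cst 0%E).
  apply/ae_eq_integral_abs => //; first exact/measurable_EFinP.
  by rewrite -[RHS]I1; apply: eq_integral => x _ /=; rewrite ger0_norm.
apply: filterS => x /= h _; have := h I => -[] /eqP dx.
congr EFin; apply/eqP; rewrite eq_sym -subr_eq0 -normr_eq0.
move: dx; rewrite /d; case: leP => // _; by rewrite oner_eq0.
Qed.

Lemma Rintegral_clamp (f : R -> R) : measurable_fun setT f ->
  Rintegral m setT f = Rintegral m setT (fun x => f (clamp x)).
Proof.
move=> mf; rewrite /Rintegral; congr fine.
have mc : measurable_fun setT (fun x => f (clamp x)).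
  by apply: measurableT_comp => //; exact: continuous_measurable_fun clamp_continuous.
apply: ae_eq_integral => //; [exact/measurable_EFinP|exact/measurable_EFinP|].
by apply: filterS clamp_ae => x h /h [] ->.
Qed.

Lemma cinv_subr c x : (c - x%:C%C)^-1 =
  Complex ((complex.Re c - x) / ((complex.Re c - x) ^+ 2 + complex.Im c ^+ 2))
          (- complex.Im c / ((complex.Re c - x) ^+ 2 + complex.Im c ^+ 2)).
Proof.
case: c => a b; apply/eqP; rewrite eq_complex /= oppr0 addr0.
by rewrite mulNr !eqxx.
Qed.

Lemma cinv_node_le c x : A < cabs c -> `|x| <= A -> cabs (c - x%:C%C)^-1 <= (cabs c - A)^-1.
Proof.
move=> hc hx; have := cabs_lbB c x%:C%C; rewrite cabs_real => h.
by rewrite cabsV lef_pV2 ?posrE; lra.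
Qed.

Lemma measurable_div_sumsq (u v : R -> R) (b : R) : measurable_fun setT u -> measurable_fun setT v ->
  measurable_fun setT (fun x => u x / (v x ^+ 2 + b ^+ 2)).
Proof.
move=> mu mv.
have -> : (fun x => u x / (v x ^+ 2 + b ^+ 2)) = (fun x => u x * (v x ^+ 2 + b ^+ 2) `^ (-1)).
  by apply/funext => x; rewrite powR_inv1 // addr_ge0 ?sqr_ge0.
apply: measurable_funM => //.
apply: (measurableT_comp (measurable_powR (-1))).
by apply: measurable_funD => //; exact: measurable_funX.
Qed.

Lemma mean_node_cvg (phi : R -> R) (M : R) : measurable_fun setT phi ->
  (forall x, `|x| <= A -> {for x, continuous phi}) -> (forall x, `|x| <= A -> `|phi x| <= M) ->
  forall e : R, 0 < e -> exists N0, forall N, (N0 <= N)%N ->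
    `|N%:R^-1 * \sum_(i < N) phi (scaled_node R (lam N) i) - Rintegral m setT phi| <= e.
Proof.
move=> mphi cphi hM e e0.
have cl x : `|clamp x| <= A by rewrite ler_norml clamp_bound.
have cc : continuous (fun x => phi (clamp x)).
  move=> x; apply: (@continuous_comp _ _ _ clamp phi); first exact: clamp_continuous.
  exact: cphi.
have bc : exists M : R, forall x, `|phi (clamp x)| <= M by exists M => x; exact: hM.
have := hw cc bc; rewrite -Rintegral_clamp // => /cvgrPdist_le /(_ e e0) [N0 _ hN].
exists N0 => N hNN; have := hN N hNN; rewrite distrC emp_integral_nodes.
by under eq_bigr => i _ do rewrite clamp_id ?hA //.
Qed.

Lemma mean_cauchy c : A < cabs c -> forall e : R, 0 < e -> exists N0, forall N, (N0 <= N)%N ->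
  cabs (N%:R^-1 * \sum_(i < N) (c - (scaled_node R (lam N) i)%:C%C)^-1 - Cauchy m c) <= e.
Proof.
move=> hc e e0; pose a := complex.Re c; pose b := complex.Im c.
have den x : `|x| <= A -> (a - x) ^+ 2 + b ^+ 2 != 0.
  move=> hx; have := cabs_lbB c x%:C%C; rewrite cabs_real => h.
  have : 0 < cabs (c - x%:C%C) by lra.
  rewrite /cabs sqrtr_gt0 => h1; rewrite gt_eqF //; move: h1.
  by rewrite /a /b; case: (c) => u v /=; rewrite oppr0 addr0.
have cden x : {for x, continuous (fun x => (a - x) ^+ 2 + b ^+ 2)}.
  apply: cvgD; last exact: cvg_cst.
  apply: (@continuous_comp _ _ _ (fun x => a - x) (fun z => z ^+ 2)); last exact: exprn_continuous.
  by apply: cvgB; [exact: cvg_cst|exact: cvg_id].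
have e2 : 0 < e / 2 by lra.
have mre : measurable_fun setT (fun x => (a - x) / ((a - x) ^+ 2 + b ^+ 2)).
  by apply: measurable_div_sumsq; apply: measurable_funB.
have mim : measurable_fun setT (fun x => - b / ((a - x) ^+ 2 + b ^+ 2)).
  by apply: measurable_div_sumsq; [exact: measurable_cst|apply: measurable_funB].
have cre x : `|x| <= A -> {for x, continuous (fun x => (a - x) / ((a - x) ^+ 2 + b ^+ 2))}.
  by move=> hx; apply: cvgM; [apply: cvgB; [exact: cvg_cst|exact: cvg_id]|apply: cvgV; [exact: den|exact: cden]].
have cim x : `|x| <= A -> {for x, continuous (fun x => - b / ((a - x) ^+ 2 + b ^+ 2))}.
  by move=> hx; apply: cvgM; [exact: cvg_cst|apply: cvgV; [exact: den|exact: cden]].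
have bre x : `|x| <= A -> `|(a - x) / ((a - x) ^+ 2 + b ^+ 2)| <= (cabs c - A)^-1.
  by move=> hx; apply: le_trans (cinv_node_le hc hx); rewrite cinv_subr; exact: (cabs_Re (Complex _ _)).
have bim x : `|x| <= A -> `|- b / ((a - x) ^+ 2 + b ^+ 2)| <= (cabs c - A)^-1.
  by move=> hx; apply: le_trans (cinv_node_le hc hx); rewrite cinv_subr; exact: (cabs_Im (Complex _ _)).
have [N1 h1] := mean_node_cvg mre cre bre e2.
have [N2 h2] := mean_node_cvg mim cim bim e2.
exists (maxn N1 N2) => N; rewrite geq_max => /andP[/h1 k1 /h2 k2].
have -> : N%:R^-1 * \sum_(i < N) (c - (scaled_node R (lam N) i)%:C%C)^-1 =
  Complex (N%:R^-1 * \sum_(i < N) (a - scaled_node R (lam N) i) / ((a - scaled_node R (lam N) i) ^+ 2 + b ^+ 2))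
   (N%:R^-1 * \sum_(i < N) - b / ((a - scaled_node R (lam N) i) ^+ 2 + b ^+ 2)).
  have -> : N%:R^-1 = (N%:R^-1 : R)%:C%C :> C by rewrite fmorphV rmorph_nat.
  under eq_bigr => i _ do rewrite cinv_subr.
  have S (I : finType) (u v : I -> R) : \sum_i Complex (u i) (v i) = Complex (\sum_i u i) (\sum_i v i) :> C.
    by elim/big_rec3: _ => // i x y z _ ->.
  by rewrite S; apply/eqP; rewrite eq_complex /= !mul0r subr0 addr0 !eqxx.
by apply: le_trans (cabs_ReIm _) _; rewrite /Cauchy -/a -/b /=; lra.
Qed.

End CauchyTransform.

(** * The limit of the logarithmic derivatives *)

Section PointwiseToUniform.
Variable R : realType.
Local Notation C := (R[i] : numClosedFieldType).
Implicit Types (z w : C).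

Lemma disc_net (r dl : R) : 0 < dl -> exists s : seq C,
  forall z, cabs z <= r -> exists2 w, w \in s & cabs (z - w) <= dl.
Proof.
move=> dl0; have d2 : 0 < dl / 2 by lra.
pose K := (Num.truncn (r / (dl / 2))).+2.
pose g (p : 'I_K * 'I_K * (bool * bool)) : C :=
  Complex ((-1) ^+ p.2.1 * (p.1.1%:R * (dl / 2))) ((-1) ^+ p.2.2 * (p.1.2%:R * (dl / 2))).
exists [seq g p | p <- enum {: 'I_K * 'I_K * (bool * bool)}] => z hz.
have key (t : R) : `|t| <= r -> exists (i : 'I_K) (b : bool), `|t - (-1) ^+ b * (i%:R * (dl / 2))| <= dl / 2.
  move=> ht; have t0 : 0 <= `|t| / (dl / 2) by rewrite divr_ge0 // ltW.
  have iK : (Num.truncn (`|t| / (dl / 2)) < K)%N.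
    rewrite /K ltnS (leq_trans (_ : _ <= Num.truncn (r / (dl / 2)))%N) //.
    by apply: le_truncn; rewrite ler_pM2r ?invr_gt0.
  exists (Ordinal iK), (t < 0) => /=.
  have := truncn_itv t0; set T := Num.truncn _; rewrite -[T.+1%:R]natr1 => /andP[h1 h2].
  rewrite ler_pdivlMr // in h1; rewrite ltr_pdivrMr // in h2.
  case: (ltP t 0) => t00.
    rewrite expr1 mulN1r opprK; rewrite ltr0_norm // in h1 h2.
    by rewrite ler_norml; apply/andP; split; nra.
  rewrite expr0 mul1r; rewrite ger0_norm // in h1 h2.
  by rewrite ler_norml; apply/andP; split; nra.
have [i [b hb]] := key _ (le_trans (cabs_Re z) hz).
have [j [c hc]] := key _ (le_trans (cabs_Im z) hz).
exists (g (i, j, (b, c))); first by apply: map_f; rewrite mem_enum.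
apply: le_trans (cabs_ReIm _) _; rewrite /g /=.
by move: hb hc; case: z {hz} => p q /=; lra.
Qed.

(** A finite net suffices, since the f n share the Lipschitz constant L and the limit inherits it.
    The larger radius 2 r makes room for net points outside the disc of radius r. *)
Lemma uniform_of_pointwise (f : nat -> C -> C) (v : C -> C) (r L : R) : 0 < r -> 0 <= L ->
  (forall n z w, cabs z <= 2 * r -> cabs w <= 2 * r -> cabs (f n z - f n w) <= L * cabs (z - w)) ->
  (forall z, cabs z <= 2 * r -> forall e : R, 0 < e -> exists N0, forall n, (N0 <= n)%N ->
     cabs (f n z - v z) <= e) ->
  forall e : R, 0 < e -> exists N0, forall n, (N0 <= n)%N -> forall z, cabs z <= r ->
     cabs (f n z - v z) <= e.
Proof.
move=> r0 L0 hL hp e e0.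
pose dl := Num.min r (e / (4 * (L + 1))).
have L1 : 0 < 4 * (L + 1) by lra.
have dl0 : 0 < dl by rewrite lt_min r0 divr_gt0.
have dlr : dl <= r by rewrite ge_min lexx.
have dlL : L * dl <= e / 4.
  have : dl * (4 * (L + 1)) <= e by rewrite -ler_pdivlMr // ge_min lexx orbT.
  nra.
have e8 : 0 < e / 4 by lra.
have [s hs] := disc_net r dl0.
have [N0 hN0] : exists N0, forall w, w \in s -> cabs w <= 2 * r -> forall n, (N0 <= n)%N ->
    cabs (f n w - v w) <= e / 4.
  elim: s {hs} => [|w s [N1 h1]]; first by exists 0.
  have [hw|hw] := leP (cabs w) (2 * r).
    have [N2 h2] := hp w hw _ e8; exists (maxn N1 N2) => w'.
    rewrite inE => /orP[/eqP -> _|ws hw'] n; rewrite geq_max => /andP[k1 k2]; first exact: h2.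
    exact: h1.
  exists N1 => w'; rewrite inE => /orP[/eqP -> hw'|]; last exact: h1.
  by move: hw; rewrite ltNge hw'.
exists N0 => n hn z hz; have [w ws zw] := hs z hz.
have w2 : cabs w <= 2 * r by have := cabs_tri z w 0; rewrite !subr0 cabsBC; lra.
have z2 : cabs z <= 2 * r by lra.
have Lzw : L * cabs (z - w) <= e / 4 by apply: le_trans dlL; rewrite ler_wpM2l.
have hv : cabs (v w - v z) <= e / 4 + e / 4.
  apply/ler_addgt0Pr => e' e0'; have e2 : 0 < e' / 2 by lra.
  have [N1 h1] := hp z z2 _ e2; have [N2 h2] := hp w w2 _ e2.
  have k1 := h1 _ (leq_maxl N1 N2); have k2 := h2 _ (leq_maxr N1 N2).
  have k3 := hL (maxn N1 N2) z w z2 w2.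
  have := cabs_tri (f (maxn N1 N2) w) (v w) (v z).
  have := cabs_tri (f (maxn N1 N2) z) (f (maxn N1 N2) w) (v z).
  by rewrite [cabs (v w - f _ w)]cabsBC [cabs (f _ w - f _ z)]cabsBC; lra.
have k1 := hL n z w z2 w2; have k2 := hN0 w ws w2 n hn.
have := cabs_tri (f n w) (f n z) (v z); have := cabs_tri (v w) (f n w) (v z); lra.
Qed.

(** The difference of the means is (v - u) / (u v) times the mean of 1 / ((1 - b_i / u) (1 - b_i /
    v)); the factor 8 puts each term, hence the mean, within 1/2 of 1. This stability turns
    approximate solutions of mean_i 1 / (u - b_i) = 1 into convergent ones. *)
Lemma mean_inv_diff n (b : 'I_n.+1 -> C) (u v : C) : u != 0 -> v != 0 ->
  (forall i, 8 * cabs (b i) <= cabs u) -> (forall i, 8 * cabs (b i) <= cabs v) ->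
  cabs (v - u) <= 2 * cabs u * cabs v *
    cabs (n.+1%:R^-1 * (\sum_i (u - b i)^-1) - n.+1%:R^-1 * (\sum_i (v - b i)^-1)).
Proof.
move=> u0 v0 hu hv.
have up : 0 < cabs u by rewrite cabs_gt0.
have vp : 0 < cabs v by rewrite cabs_gt0.
have Np : 0 < n.+1%:R :> R by rewrite ltr0n.
have N0 : n.+1%:R != 0 :> C by rewrite pnatr_eq0.
pose p i := b i / u; pose q i := b i / v.
have hp i : cabs (p i) <= 8^-1.
  by rewrite cabsM cabsV ler_pdivrMr //; have := hu i; lra.
have hq i : cabs (q i) <= 8^-1.
  by rewrite cabsM cabsV ler_pdivrMr //; have := hv i; lra.
pose z i := (1 - p i) * (1 - q i).
have hz i : cabs (1 - z i) <= 3^-1.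
  have -> : 1 - z i = p i + (q i - p i * q i) by rewrite /z; ring.
  apply: le_trans (cabsD _ _) _; apply: le_trans (lerD (lexx _) (cabsB_le _ _)) _.
  rewrite cabsM; have := hp i; have := hq i; have := cabs_ge0 (p i); have := cabs_ge0 (q i).
  nra.
have zl i : 2 / 3 <= cabs (z i).
  by have := cabs_lbB 1 (1 - z i); rewrite subKr cabs1; have := hz i; lra.
have z0 i : z i != 0 by rewrite -cabs_gt0; have := zl i; lra.
have hzi i : cabs (1 - (z i)^-1) <= 2^-1.
  have -> : 1 - (z i)^-1 = - ((1 - z i) / z i) by field.
  rewrite cabsN cabsM cabsV ler_pdivrMr; last by have := zl i; lra.
  by have := zl i; have := hz i; lra.
pose M := n.+1%:R^-1 * (\sum_i (z i)^-1).
have hM : 2^-1 <= cabs M.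
  have : cabs (1 - M) <= 2^-1.
    have -> : 1 - M = n.+1%:R^-1 * (\sum_i (1 - (z i)^-1)).
      rewrite sumrB sumr_const card_ord mulrBr /M; congr (_ - _).
      by rewrite -[1 *+ _]/(n.+1%:R) mulVf.
    rewrite cabsM cabsV cabs_nat mulrC ler_pdivrMr //.
    apply: le_trans (cabs_sum _ _ _) _.
    apply: le_trans (ler_sum _ (fun i _ => hzi i)) _.
    by rewrite sumr_const card_ord -[X in X <= _]mulr_natr.
  by have := cabs_lbB 1 (1 - M); rewrite subKr cabs1; lra.
have -> : n.+1%:R^-1 * (\sum_i (u - b i)^-1) - n.+1%:R^-1 * (\sum_i (v - b i)^-1) =
    (v - u) / (u * v) * M.
  rewrite -mulrBr /M mulrCA; congr (_ * _); rewrite -sumrB mulr_sumr.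
  apply: eq_bigr => i _.
  have := z0 i; rewrite /z /p /q mulf_eq0 negb_or => /andP[z1 z2].
  have ub : u - b i != 0.
    by apply: contra z1 => /eqP h; have -> : 1 - b i / u = (u - b i) / u; [field|rewrite h mul0r].
  have vb : v - b i != 0.
    by apply: contra z2 => /eqP h; have -> : 1 - b i / v = (v - b i) / v; [field|rewrite h mul0r].
  by field; rewrite ub vb u0 v0.
have -> : cabs ((v - u) / (u * v) * M) = cabs (v - u) / (cabs u * cabs v) * cabs M.
  by rewrite [LHS]cabsM [cabs (_ / _)]cabsM cabsV [cabs (u * v)]cabsM.
have -> : 2 * cabs u * cabs v * (cabs (v - u) / (cabs u * cabs v) * cabs M) = cabs (v - u) * (2 * cabs M).
  by field; rewrite !gt_eqF.
by rewrite ler_peMr ?cabs_ge0 //; lra.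
Qed.

End PointwiseToUniform.

Section LimitDerivative.
Variables (R : realType) (lam : nat -> seq int) (m : probability R R) (A : R).
Local Notation C := (R[i] : numClosedFieldType).
Hypotheses (hG : forall N, GT N (lam N)) (hw : weak_conv lam m) (A0 : 0 < A)
  (hA : forall N i, (i < N)%N -> `|scaled_node R (lam N) i| <= A :> R).
Variable Ci : C -> C.
Hypothesis hCi : Cauchy_inverse m Ci.
Implicit Types (y : C).

(** The numbers l_i / N with N = n + 1, the form in which the normalised differences expect their
    nodes. *)
Definition snode n (i : 'I_n.+1) : C := (scaled_node R (lam n.+1) i)%:C%C.

Lemma snode_le n i : cabs (@snode n i) <= A.
Proof. by rewrite cabs_real hA. Qed.

Lemma nodes_snode n : nodes (@snode n) = fun j => (shifted (lam n.+1) j)%:~R.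
Proof.
apply/funext => j; rewrite /nodes /snode /scaled_node; have [-> _] := hG n.+1.
rewrite -(rmorph_nat (real_complex R)) -rmorphM /= mulrC divfK ?pnatr_eq0 //.
exact: (rmorph_int (real_complex R)).
Qed.

Lemma nodes_snode_inj n : injective (nodes (@snode n)).
Proof. by rewrite nodes_snode; exact: shifted_inj. Qed.

(** The largest s with 12 A s <= 1. *)
Definition rad : R := (12 * A)^-1.

Lemma rad_gt0 : 0 < rad. Proof. by rewrite invr_gt0 mulr_gt0. Qed.

Lemma rad_le : 12 * A * rad <= 1.
Proof. by rewrite /rad divff // gt_eqF // mulr_gt0. Qed.

Definition limv y : C := if y == 0 then 1 else y * Ci y.

(** For c = Ci y and v = y c, the mean of 1 / (v - a_i y) is the empirical Cauchy transform at c
    divided by y, which tends to C_m(c) / y = 1. By [mean_inv_u1] the same mean at [u1] also tends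
    to 1, and [mean_inv_diff] forces [u1] to tend to v. *)
Lemma u1_pointwise : exists2 r : R, 0 < r <= rad / 4 & forall y, cabs y <= 2 * r ->
  forall e : R, 0 < e -> exists N0, forall n, (N0 <= n)%N -> cabs (u1 (@snode n) y - limv y) <= e.
Proof.
(* |Ci y| > 8 A places c away from the nodes and gives 8 |a_i y| <= |y c|, as [mean_inv_diff]
   requires. *)
have [h1 [d2 d20 h2]] := hCi; have [d1 d10 {}h1] := h1 (8 * A).
pose r := Num.min (rad / 8) (Num.min (d1 / 4) (d2 / 4)).
have rp := rad_gt0; have rl := rad_le.
have r0 : 0 < r by rewrite !lt_min; apply/andP; split; [lra|apply/andP; split; lra].
have r1 : r <= rad / 8 by rewrite ge_min lexx.
have r2 : r <= d1 / 4 by rewrite !ge_min lexx !orbT.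
have r3 : r <= d2 / 4 by rewrite !ge_min lexx !orbT.
exists r; first by apply/andP; split; lra.
move=> y hy e e0; rewrite /limv.
have einv (e' : R) : 0 < e' -> exists N0, forall n, (N0 <= n)%N -> n.+1%:R^-1 <= e'.
  move=> e0'; exists (Num.truncn e'^-1) => n hn.
  rewrite -[e']invrK lef_pV2 ?posrE ?invr_gt0 ?ltr0n //.
  apply: ltW; apply: lt_le_trans (truncnS_gt _) _.
  by rewrite ler_nat.
have [->|y0] := eqVneq y 0.
  have [N0 hN] := einv e e0; exists N0 => n hn.
  rewrite /u1 big1 => [|i _]; last by rewrite rho0 mulr0.
  have -> : 1 - n.+1%:R^-1 + n.+1%:R^-1 * 0 - 1 = - n.+1%:R^-1 :> C by ring.
  by rewrite cabsN cabsV cabs_nat hN.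
have yp : 0 < cabs y by rewrite cabs_gt0.
set c := Ci y.
have c8 : 8 * A < cabs c by apply: h1; rewrite yp /=; lra.
have cy : Cauchy m c = y by apply: h2; rewrite yp /=; lra.
have cA : A < cabs c by have := A0; lra.
have ys : cabs y <= rad by lra.
have ys2 : cabs y <= rad / 2 by lra.
have v0 : y * c != 0 by rewrite mulf_neq0 // -cabs_gt0; have := A0; lra.
(* This bounds the factor 2 |U| |v| of [mean_inv_diff], as |U| <= 3. *)
pose K := 6 * cabs (y * c).
have K0 : 0 < K by rewrite /K mulr_gt0 // cabs_gt0.
have e1 : 0 < e / K / 2 / 8 by rewrite !divr_gt0.
have e2 : 0 < e / K / 2 * cabs y by rewrite mulr_gt0 // !divr_gt0.
have [N1 k1] := einv _ e1; have [N2 k2] := mean_cauchy hG hw A0 hA cA e2.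
exists (maxn 3 (maxn N1 N2)) => n; rewrite !geq_max => /andP[n3 /andP[/k1 k3 hn2]].
have := k2 n.+1 (leq_trans hn2 (leqnSn n)); rewrite cy => k4.
have aA := @snode_le n; have inj := @nodes_snode_inj n.
have M1 := mean_inv_u1 aA rp rl inj n3 y0 ys2.
have U1 := u1_near1 aA rp rl inj ys.
have U3 := u1_le2 aA rp rl inj ys.
set U := u1 _ y in M1 U1 U3 *.
have Ul : 7 / 12 <= cabs U.
  have q : n.+1%:R^-1 <= 4^-1 :> R by rewrite lef_pV2 ?posrE ?ltr0n // ler_nat.
  have := cabs_lbB 1 (1 - U); rewrite subKr cabs1 [cabs (1 - U)]cabsBC.
  move: (n.+1%:R^-1) q U1 => t; lra.
have U0 : U != 0 by rewrite -cabs_gt0; lra.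
pose b (i : 'I_n.+1) : C := snode i * y.
have bA i : cabs (b i) <= A * cabs y.
  by rewrite /b cabsM; apply: ler_wpM2r; [exact: cabs_ge0|exact: aA].
have bU i : 8 * cabs (b i) <= cabs U.
  have := bA i; have : A * cabs y <= A * (rad / 4) by rewrite ler_wpM2l ?(ltW A0) //; lra.
  lra.
have bv i : 8 * cabs (b i) <= cabs (y * c).
  rewrite cabsM; have := bA i; nra.
have D := mean_inv_diff U0 v0 bU bv.
rewrite cabsBC; apply: le_trans D _.
set S1 := n.+1%:R^-1 * _ in M1 *; set S2 := n.+1%:R^-1 * _.
have E2 : S2 - 1 = (n.+1%:R^-1 * (\sum_(i < n.+1) (c - (scaled_node R (lam n.+1) i)%:C%C)^-1) - y) / y.
  rewrite mulrBl divff //; congr (_ - _); rewrite /S2 -mulrA mulr_suml; congr (_ * _).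
  by apply: eq_bigr => i _; rewrite /b [snode i * y]mulrC -mulrBr invfM mulrC.
have hS2 : cabs (S2 - 1) <= e / K / 2.
  by rewrite E2 cabsM cabsV ler_pdivrMr.
have hS1 : cabs (S1 - 1) <= e / K / 2.
  by apply: le_trans M1 _; move: k3; move: (n.+1%:R^-1) => t; lra.
have hS : cabs (S1 - S2) <= e / K.
  by have := cabs_tri 1 S1 S2; rewrite [cabs (1 - S2)]cabsBC; lra.
apply: (@le_trans _ _ (K * (e / K))); last by rewrite mulrC divfK // gt_eqF.
apply: ler_pM => //; rewrite ?cabs_ge0 ?mulr_ge0 ?cabs_ge0 //.
by rewrite /K ler_wpM2r ?cabs_ge0 //; lra.
Qed.

Lemma u1_uniform : exists2 r : R, 0 < r <= rad / 4 & forall e : R, 0 < e -> exists N0, forall n,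
  (N0 <= n)%N -> forall y, cabs y <= r -> cabs (u1 (@snode n) y - limv y) <= e.
Proof.
have [r /andP[r0 r1] hp] := u1_pointwise; exists r; first by rewrite r0.
have rp := rad_gt0; have rl := rad_le.
have L0 : 0 <= 8 * 3 / rad by rewrite divr_ge0 // ltW.
apply: (uniform_of_pointwise (f := fun n => u1 (@snode n)) r0 L0) => // n z w hz hw'.
have inj := @nodes_snode_inj n; have aA := @snode_le n.
apply: (an_lip rp (u1_an aA rp rl inj)); rewrite ?subr0; [|lra|lra].
by move=> x; rewrite subr0; exact: (u1_le2 aA rp rl inj).
Qed.

Lemma limv_le : exists2 r : R, 0 < r & forall y, cabs y <= r -> cabs (limv y) <= 4.
Proof.
have [r /andP[r0 r1] hu] := u1_uniform; exists r => // y hy.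
have [N0 hN] := hu 1 ltr01; have := hN N0 (leqnn N0) y hy.
have rp := rad_gt0; have rl := rad_le.
have ys : cabs y <= rad by lra.
have := u1_le2 (@snode_le N0) rp rl (@nodes_snode_inj N0) ys.
by have := cabs_lbB (limv y) (limv y - u1 (@snode N0) y); rewrite subKr [cabs (limv y - _)]cabsBC; lra.
Qed.

Lemma uq_uniform q : exists2 r : R, 0 < r <= rad / 2 ^+ q & forall e : R, 0 < e -> exists N0, forall n,
  (N0 <= n)%N -> forall y, cabs y <= r -> cabs (uq (@snode n) q y - limv y ^+ q) <= e.
Proof.
have [r /andP[r0 r1] hu] := u1_uniform; have [r' r0' hv] := limv_le.
have rp := rad_gt0; have rl := rad_le.
have qp := @pow2_gt0 _ _ rp q.
exists (Num.min (rad / 2 ^+ q) (Num.min r r')).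
  by rewrite !lt_min qp r0 r0' ge_min lexx.
have pw : forall e : R, 0 < e -> exists N0, forall n, (N0 <= n)%N -> forall y,
    cabs y <= Num.min r r' -> cabs (u1 (@snode n) y ^+ q - limv y ^+ q) <= e.
  elim: q {qp} => [|q IH] e e0.
    by exists 0 => n _ y _; rewrite !expr0 subrr cabs0 ltW.
  have v4 : 0 < 4 ^+ q :> R by exact: exprn_gt0.
  have e1 : 0 < e / 2 / 4 ^+ q by rewrite !divr_gt0.
  have e2 : 0 < e / 6 by lra.
  have [N1 h1] := hu _ e1; have [N2 h2] := IH _ e2.
  exists (maxn N1 N2) => n; rewrite geq_max => /andP[/h1 k1 /h2 k2] y hy.
  have := hy; rewrite le_min => /andP[hy1 hy2].
  rewrite !exprS; set U := u1 _ y; set V := limv y.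
  have -> : U * U ^+ q - V * V ^+ q = U * (U ^+ q - V ^+ q) + (U - V) * V ^+ q by ring.
  have ys : cabs y <= rad by lra.
  have U3 := u1_le2 (@snode_le n) rp rl (@nodes_snode_inj n) ys.
  apply: le_trans (cabsD _ _) _; rewrite !cabsM.
  have b1 : cabs U * cabs (U ^+ q - V ^+ q) <= 3 * (e / 6) by apply: ler_pM; rewrite ?cabs_ge0 ?k2.
  have b2 : cabs (U - V) * cabs (V ^+ q) <= e / 2 / 4 ^+ q * 4 ^+ q.
    apply: ler_pM; rewrite ?cabs_ge0 ?k1 // cabsX lerXn2r ?nnegrE ?cabs_ge0 //.
    exact: hv.
  rewrite divfK ?gt_eqF // in b2; lra.
move=> e e0; have e2 : 0 < e / 2 by lra.
have [N1 h1] := pw _ e2.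
exists (maxn N1 (Num.truncn (Cq R q / (e / 2)))) => n; rewrite geq_max => /andP[/h1 k1 k2] y.
rewrite le_min => /andP[hy1 hy2].
have c1 := k1 y hy2.
have c3 : Cq R q / n.+1%:R <= e / 2.
  rewrite ler_pdivrMr ?ltr0n // mulrC -ler_pdivrMr //.
  apply: ltW; apply: lt_le_trans (truncnS_gt _) _; by rewrite ler_nat.
have c2 := le_trans (uq_u1 (@snode_le n) rp rl (@nodes_snode_inj n) hy1) c3.
by have := cabs_tri (u1 (@snode n) y ^+ q) (uq (@snode n) q y) (limv y ^+ q); lra.
Qed.

End LimitDerivative.

(** * Normalised Schur functions *)

Section Vandermonde.
Variable R : realType.
Local Notation C := (R[i] : numClosedFieldType).
Implicit Types (l : seq int).

Lemma vdmE k (x : 'I_k -> C) :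
  vdm [seq x i | i <- enum 'I_k] = \prod_(i < k) \prod_(j < k | (i < j)%N) (x j - x i).
Proof.
elim: k x => [|k IH] x.
  by rewrite big_ord0 (_ : enum 'I_0 = [::]) //; apply: size0nil; rewrite size_enum_ord.
rewrite enum_ordSl /= -map_comp (IH (x \o lift ord0)) big_ord_recl mulrC; congr (_ * _).
  rewrite [RHS]big_mkcond [RHS]big_ord_recl /= mul1r big_map -[index_enum _]enumT.
  by apply: eq_bigr.
apply: eq_bigr => i _; rewrite [RHS]big_mkcond big_ord_recl /= mul1r -big_mkcond /=.
by apply: eq_bigl => j; rewrite /bump /= !add1n ltnS.
Qed.

Lemma prod_pairs k (a : 'I_k.+1 -> C) :
  (\prod_i a i) ^+ k = \prod_(i < k.+1) \prod_(j < k.+1 | (i < j)%N) (a i * a j).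
Proof.
transitivity (\prod_(i < k.+1) \prod_(j < k.+1 | j != i) a i).
  rewrite -prodrXl; apply: eq_bigr => i _; rewrite prodr_const; congr (_ ^+ _).
  by rewrite (cardC1 i) card_ord.
under [RHS]eq_bigr do rewrite big_split /=.
rewrite big_split /= [X in _ * X](exchange_big_dep xpredT) //= -big_split.
apply: eq_bigr => i _ /=; rewrite (bigID (fun j : 'I_k.+1 => (i < j)%N)) /=.
by congr (_ * _); apply: eq_bigl => j; rewrite -val_eqE /=; lia.
Qed.

Lemma interlace_neq0 N l : GT N.+1 l -> (0 < size (interlace l))%N.
Proof.
elim: N l => [|N IH] l hl; first by case: l hl => [|a [|b l]] [] //.
case: l hl => [[] //|a [[] //|b l]] hl.
have [hl' _] := GT_cons hl; rewrite interlaceE size_allpairs muln_gt0 (IH _ hl') andbT.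
by rewrite size_map size_iota.
Qed.

(** The number of Gelfand-Tsetlin patterns; its nonvanishing makes the denominator of [schur_ratio]
    legitimate. *)
Lemma schur_ones N l : GT N l -> exists p : nat, schur (nseq N (1 : C)) l = p.+1%:R.
Proof.
elim: N l => [|N IH] l hl.
  by exists 0%N; case: l hl => [|a l] [].
have := interlace_neq0 hl.
have hmu mu : mu \in interlace l -> GT N mu := interlace_GT hl.
suff H s : (0 < size s)%N -> (forall mu, mu \in s -> GT N mu) ->
    exists p : nat, \sum_(mu <- s) (1 : C) ^ (sumz l - sumz mu) * schur (nseq N 1) mu = p.+1%:R.
  by move=> hs; exact: H hs hmu.
elim: s {hmu} => [//|mu s IHs] _ hs.
have [p hp] : exists p : nat, schur (nseq N (1 : C)) mu = p.+1%:R.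
  by apply: IH; apply: hs; rewrite inE eqxx.
rewrite big_cons exp1rz mul1r hp.
case: s IHs hs => [|nu s] IHs hs; first by exists p; rewrite big_nil addr0.
have [q ->] := IHs isT (fun mu' h => hs mu' (mem_behead (s := mu :: nu :: s) h)).
by exists (p + q.+1)%N; rewrite -natrD.
Qed.

End Vandermonde.

(** * Uniform convergence towards bounded limits *)

Section UniformConvergence.
Variables (R : realType) (T : Type) (D : T -> Prop).
Local Notation C := (R[i] : numClosedFieldType).
Implicit Types (f : nat -> T -> C) (g : T -> C).

(** Boundedness of the limit is included to make the notion stable under products, hence under
    determinants. *)
Definition ucv f g := (exists2 M : R, 0 <= M & forall x, D x -> cabs (g x) <= M) /\
  forall e : R, 0 < e -> exists N0, forall n, (N0 <= n)%N -> forall x, D x -> cabs (f n x - g x) <= e.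

Lemma ucv_cst g : (exists2 M : R, 0 <= M & forall x, D x -> cabs (g x) <= M) -> ucv (fun=> g) g.
Proof.
by move=> hg; split=> // e e0; exists 0 => n _ x _; rewrite subrr cabs0 ltW.
Qed.

Lemma ucvD f g f' g' : ucv f g -> ucv f' g' ->
  ucv (fun n x => f n x + f' n x) (fun x => g x + g' x).
Proof.
move=> [[M M0 hM] hf] [[M' M0' hM'] hf']; split.
  exists (M + M') => [|x Dx]; first exact: addr_ge0.
  by apply: le_trans (cabsD _ _) _; apply: lerD; [exact: hM|exact: hM'].
move=> e e0; have e2 : 0 < e / 2 by lra.
have [N1 h1] := hf _ e2; have [N2 h2] := hf' _ e2.
exists (maxn N1 N2) => n; rewrite geq_max => /andP[/h1 k1 /h2 k2] x Dx.
rewrite opprD addrACA; apply: le_trans (cabsD _ _) _.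
by have := k1 x Dx; have := k2 x Dx; lra.
Qed.

Lemma ucvM f g f' g' : ucv f g -> ucv f' g' ->
  ucv (fun n x => f n x * f' n x) (fun x => g x * g' x).
Proof.
move=> [[M M0 hM] hf] [[M' M0' hM'] hf']; split.
  exists (M * M') => [|x Dx]; first exact: mulr_ge0.
  by rewrite cabsM ler_pM ?cabs_ge0 ?hM ?hM'.
move=> e e0.
have K0 : 0 < M + M' + 1 by lra.
have [e1 [e10 e11 e1K]] : exists e1 : R, [/\ 0 < e1, e1 <= 1 & e1 * (M + M' + 1) <= e].
  exists (Num.min 1 (e / (M + M' + 1))); split; first by rewrite lt_min ltr01 divr_gt0.
    by rewrite ge_min lexx.
  by rewrite -ler_pdivlMr // ge_min lexx orbT.
have [N1 h1] := hf _ e10; have [N2 h2] := hf' _ e10.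
exists (maxn N1 N2) => n; rewrite geq_max => /andP[/h1 k1 /h2 k2] x Dx.
have -> : f n x * f' n x - g x * g' x = g x * (f' n x - g' x) + (f n x - g x) * g' x
  + (f n x - g x) * (f' n x - g' x) by ring.
have a1 := k1 x Dx; have a2 := k2 x Dx; have a3 := hM x Dx; have a4 := hM' x Dx.
have b1 : cabs (g x * (f' n x - g' x)) <= M * e1 by rewrite cabsM ler_pM ?cabs_ge0.
have b2 : cabs ((f n x - g x) * g' x) <= e1 * M' by rewrite cabsM ler_pM ?cabs_ge0.
have b3 : cabs ((f n x - g x) * (f' n x - g' x)) <= e1 * 1.
  by rewrite cabsM ler_pM ?cabs_ge0 // (le_trans a2).
have b4 := cabsD (g x * (f' n x - g' x)) ((f n x - g x) * g' x).
apply: le_trans (cabsD _ _) _; lra.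
Qed.

Lemma ucv_const (c : C) : ucv (fun _ _ => c) (fun=> c).
Proof. by apply: (ucv_cst (g := fun=> c)); exists (cabs c) => //; exact: cabs_ge0. Qed.

Lemma ucv_ext f f' g g' : (exists N0, forall n, (N0 <= n)%N -> forall x, D x -> f n x = f' n x) ->
  (forall x, D x -> g x = g' x) -> ucv f g -> ucv f' g'.
Proof.
move=> [N1 ff] gg [[M M0 hM] hf]; split.
  by exists M => // x Dx; rewrite -gg // hM.
move=> e e0; have [N0 hN] := hf e e0; exists (maxn N1 N0) => n.
rewrite geq_max => /andP[h1 h2] x Dx; rewrite -ff // -gg //; exact: hN.
Qed.

Lemma ucv_sum (I : Type) (r : seq I) (P : pred I) (f : I -> nat -> T -> C) (g : I -> T -> C) :
  (forall i, P i -> ucv (f i) (g i)) ->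
  ucv (fun n x => \sum_(i <- r | P i) f i n x) (fun x => \sum_(i <- r | P i) g i x).
Proof.
move=> h; elim: r => [|i r IH].
  by apply: ucv_ext (ucv_const 0) => [|x _]; [exists 0 => n _ x _|]; rewrite big_nil.
case Pi : (P i); last first.
  by apply: ucv_ext IH => [|x _]; [exists 0 => n _ x _|]; rewrite big_cons Pi.
by apply: ucv_ext (ucvD (h i Pi) IH) => [|x _]; [exists 0 => n _ x _|]; rewrite big_cons Pi.
Qed.

Lemma ucv_prod (I : Type) (r : seq I) (P : pred I) (f : I -> nat -> T -> C) (g : I -> T -> C) :
  (forall i, P i -> ucv (f i) (g i)) ->
  ucv (fun n x => \prod_(i <- r | P i) f i n x) (fun x => \prod_(i <- r | P i) g i x).
Proof.
move=> h; elim: r => [|i r IH].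
  by apply: ucv_ext (ucv_const 1) => [|x _]; [exists 0 => n _ x _|]; rewrite big_nil.
case Pi : (P i); last first.
  by apply: ucv_ext IH => [|x _]; [exists 0 => n _ x _|]; rewrite big_cons Pi.
by apply: ucv_ext (ucvM (h i Pi) IH) => [|x _]; [exists 0 => n _ x _|]; rewrite big_cons Pi.
Qed.

Lemma ucv_det k (f : 'I_k -> 'I_k -> nat -> T -> C) (g : 'I_k -> 'I_k -> T -> C) :
  (forall i j, ucv (f i j) (g i j)) ->
  ucv (fun n x => \det (\matrix_(i, j) f i j n x)) (fun x => \det (\matrix_(i, j) g i j x)).
Proof.
move=> h.
have -> : (fun n x => \det (\matrix_(i, j) f i j n x)) =
   fun n x => \sum_(s : 'S_k) (-1) ^+ s * \prod_i f i (s i) n x.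
  apply/funext => n; apply/funext => x; apply: eq_bigr => s _; congr (_ * _).
  by apply: eq_bigr => i _; rewrite mxE.
have -> : (fun x => \det (\matrix_(i, j) g i j x)) =
   fun x => \sum_(s : 'S_k) (-1) ^+ s * \prod_i g i (s i) x.
  apply/funext => x; apply: eq_bigr => s _; congr (_ * _).
  by apply: eq_bigr => i _; rewrite mxE.
apply: (@ucv_sum 'S_k (index_enum _) xpredT (fun (s : 'S_k) n x => (-1) ^+ s * \prod_i f i (s i) n x)
  (fun (s : 'S_k) x => (-1) ^+ s * \prod_i g i (s i) x)) => s _.
apply: ucvM; first exact: ucv_const.
exact: (@ucv_prod _ (index_enum _) xpredT (fun i n x => f i (s i) n x) (fun i x => g i (s i) x)).
Qed.

End UniformConvergence.

Lemma ucv_mono (R : realType) (T : Type) (D D' : T -> Prop) (f : nat -> T -> R[i]) g :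
  (forall x, D' x -> D x) -> ucv D f g -> ucv D' f g.
Proof.
move=> DD [[M M0 hM] hf]; split; first by exists M => // x /DD; exact: hM.
by move=> e e0; have [N0 hN] := hf e e0; exists N0 => n hn x /DD; exact: hN.
Qed.

(** * Ratios of Schur functions as small determinants *)

Section SchurRatio.
Variables (R : realType) (lam : nat -> seq int) (m : probability R R) (A : R).
Local Notation C := (R[i] : numClosedFieldType).
Hypotheses (hG : forall N, GT N (lam N)) (hw : weak_conv lam m) (A0 : 0 < A)
  (hA : forall N i, (i < N)%N -> `|scaled_node R (lam N) i| <= A :> R).
Variable Ci : C -> C.
Hypothesis hCi : Cauchy_inverse m Ci.
Implicit Types (t y z w : C).

Definition schurk k n (x : 'I_k -> C) : C :=
  schur ([seq x i | i <- enum 'I_k] ++ nseq n 1) (lam (k + n)%N).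

Definition schur1 n t : C := schur (t :: nseq n 1) (lam n.+1).

Local Notation F n := (ddexp (nodes (@snode R lam n))).

Lemma near1_neq0 t : cabs (t - 1) < 1 -> t != 0.
Proof.
by move=> h; apply/eqP => t0; move: h; rewrite t0 sub0r cabsN cabs1 ltxx.
Qed.

Lemma schurk_ddexp k n : exists2 kappa : C, kappa != 0 & forall x : 'I_k.+1 -> C,
  (forall i, cabs (x i - 1) < 1) ->
  kappa * (vdm [seq x i | i <- enum 'I_k.+1] * (\prod_i (1 - x i)) ^+ n * schurk n x) =
  \det (\matrix_(i < k.+1, r < k.+1) F (k + n) r (Logc (x i))).
Proof.
have [kappa k0 hk] := @schur_det R k.+1 n (lam (k.+1 + n)%N) (hG _).
exists kappa => // x hx; rewrite hk => [|i]; last exact: near1_neq0.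
congr (\det _); apply/matrixP => i r; rewrite !mxE /ddexp nodes_snode //.
congr (dd _ _); apply/funext => j; congr (_ * _).
by rewrite cexp_int cexp_Logc.
Qed.

Lemma schur1_ddexp n : exists2 kappa : C, kappa != 0 & forall t, cabs (t - 1) < 1 ->
  kappa * ((1 - t) ^+ n * schur1 n t) = F n 0 (Logc t).
Proof.
have [kappa k0 hk] := schurk_ddexp 0 n; exists kappa => // t ht.
have := hk (fun=> t) (fun=> ht); rewrite det_mx11 mxE add0n => <-.
by rewrite big_ord1 /schurk enum_ordSl /= (_ : enum 'I_0 = [::]) /=
  ?big_nil ?mul1r //; apply: size0nil; rewrite size_enum_ord.
Qed.

Lemma Logc_neq0 t : cabs (t - 1) < 1 -> t != 1 -> Logc t != 0.
Proof.
by move=> h t1; apply/eqP => h0; move: t1; rewrite -(cexp_Logc h) h0 cexp0 eqxx.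
Qed.

(** Away from t = 1 this is the nonvanishing of F, transported by [schur1_ddexp]. At t = 1 the
    factor (1 - t)^n may hide the value, and [schur_ones] takes over. *)
Lemma schur1_neq0 n t : cabs (t - 1) < 1 -> cabs (Logc t) <= rad A -> schur1 n t != 0.
Proof.
move=> ht hl; have [->|t1] := eqVneq t 1.
  by have [p hp] := schur_ones R (hG n.+1); rewrite /schur1 -/(nseq n.+1 1) hp pnatr_eq0.
have [kappa k0 /(_ t ht) hk] := schur1_ddexp n.
have := @ddexp_disc_neq0 _ n A (rad A) _ (snode_le hA (n:=n)) (rad_gt0 A0) (rad_le A0)
  (nodes_snode_inj hG (n:=n)) _ (Logc_neq0 ht t1) hl.
by apply: contra => /eqP s0; rewrite -hk s0 !mulr0.
Qed.

(** The numerator carries (1 - x_i)^n and each one-variable factor (1 - x_i)^(k+n), which leaves the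
    power k. The powers of N in F^(q) = N^q [uq] F / y^q are pulled out of the columns into [nu]. *)
Lemma schur_ratio_det k n : exists2 gamma : C, gamma != 0 & forall x : 'I_k.+1 -> C,
  (forall i, cabs (x i - 1) < 1) -> (forall i, x i != 1) ->
  (forall i, cabs (Logc (x i)) < rad A / 2 ^+ k.+1) ->
  vdm [seq x i | i <- enum 'I_k.+1] != 0 ->
  gamma * (schurk n x / \prod_i schur1 (k + n) (x i)) =
  (\prod_i (1 - x i)) ^+ k / vdm [seq x i | i <- enum 'I_k.+1] *
  \det (\matrix_(i < k.+1, r < k.+1)
     (uq (@snode R lam (k + n)) r (Logc (x i)) / Logc (x i) ^+ r)).
Proof.
have [kk kk0 hk] := schurk_ddexp k n; have [k1 k10 h1] := schur1_ddexp (k + n).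
pose nu : C := \prod_(r < k.+1) (k + n).+1%:R ^+ r.
have nu0 : nu != 0 by apply/prodf_neq0 => r _; rewrite expf_neq0 // pnatr_eq0.
exists (kk / (k1 ^+ k.+1 * nu)).
  by rewrite mulf_neq0 // invr_eq0 mulf_neq0 // expf_neq0.
move=> x hx x1 hl hv; have aA := snode_le hA (n := k + n); have inj := @nodes_snode_inj R _ hG (k + n).
have rp := rad_gt0 A0; have rl := rad_le A0.
have hle i : cabs (Logc (x i)) <= rad A.
  by apply: le_trans (ltW (hl i)) _; exact: pow2_les.
have y0 i := Logc_neq0 (hx i) (x1 i).
have E : \det (\matrix_(i < k.+1, r < k.+1) F (k + n) r (Logc (x i))) =
  \prod_i F (k + n) 0 (Logc (x i)) * \det (\matrix_(i < k.+1, r < k.+1)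
     (uq (@snode R lam (k + n)) r (Logc (x i)) / Logc (x i) ^+ r)) * nu.
  have -> : \matrix_(i < k.+1, r < k.+1) F (k + n) r (Logc (x i)) =
    diag_mx (\row_i F (k + n) 0 (Logc (x i))) *m (\matrix_(i < k.+1, r < k.+1)
     (uq (@snode R lam (k + n)) r (Logc (x i)) / Logc (x i) ^+ r)) *m
     diag_mx (\row_(r < k.+1) (k + n).+1%:R ^+ r).
    apply/matrixP => i r; rewrite mul_mx_diag mxE mul_diag_mx !mxE.
    have hr : cabs (Logc (x i)) < rad A / 2 ^+ r.
      apply: lt_le_trans (hl i) _; rewrite ler_pM2l // lef_pV2 ?posrE ?exprn_gt0 //.
      by apply: ler_weXn2l; [rewrite ler1n|exact: ltnW (ltn_ord r)].
    have h := uq_ddexp aA rp rl inj (y0 i) hr.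
    have yr : Logc (x i) ^+ r != 0 by rewrite expf_neq0.
    by apply: (mulfI yr); rewrite h; field.
  rewrite !det_mulmx !det_diag; congr (_ * _ * _); apply: eq_bigr => i _; rewrite mxE //.
have := hk x hx; rewrite E.
have -> : \prod_i F (k + n) 0 (Logc (x i)) =
    k1 ^+ k.+1 * ((\prod_i (1 - x i)) ^+ (k + n) * \prod_i schur1 (k + n) (x i)).
  under eq_bigr => i _ do rewrite -(h1 _ (hx i)).
  by rewrite big_split prodr_const card_ord big_split /= -prodrXl.
set P := \prod_i (1 - x i); set S := \prod_i schur1 _ _; set V := vdm _ in hv *; set Dt := \det _.
have S0 : S != 0 by apply/prodf_neq0 => i _; exact: schur1_neq0.
have P0 : P != 0 by apply/prodf_neq0 => i _; rewrite subr_eq0 eq_sym.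
have Pn : P ^+ n != 0 by rewrite expf_neq0.
have k1k : k1 ^+ k.+1 != 0 by rewrite expf_neq0.
rewrite exprD => h; apply: (mulfI (mulf_neq0 Pn (mulf_neq0 hv (mulf_neq0 k1k nu0)))).
have -> : P ^+ n * (V * (k1 ^+ k.+1 * nu)) * (kk / (k1 ^+ k.+1 * nu) * (schurk n x / S)) =
  kk * (V * P ^+ n * schurk n x) / S by field; rewrite S0 nu0 ?k1k ?k10.
by rewrite h; field; rewrite hv S0.
Qed.

(** The division by (log t)^q is why t keeps a distance [dl] from 1; the outer radius r does not
    depend on [dl]. *)
Lemma phi_ucv q : exists2 r : R, 0 < r & forall dl : R, 0 < dl ->
  ucv (fun t : C => dl <= cabs (t - 1) <= r)
    (fun n t => uq (@snode R lam n) q (Logc t) / Logc t ^+ q) (fun t => Ci (Logc t) ^+ q).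
Proof.
have [r1 /andP[r10 _] h1] := uq_uniform hG hw A0 hA hCi q.
have [r2 r20 h2] := limv_le hG hw A0 hA hCi.
have [r3 /andP[r30 r31] h3] := @Logc_ge R.
pose r := Num.min (r3 / 2) (Num.min (r1 / 6) (r2 / 6)).
exists r; first by rewrite !lt_min !divr_gt0.
move=> dl dl0.
have key t : dl <= cabs (t - 1) <= r -> [/\ Logc t != 0, cabs (Logc t) <= r1, cabs (Logc t) <= r2
    & cabs (Logc t)^-1 <= 2 / dl].
  move=> /andP[d1]; rewrite !le_min => /andP[d2 /andP[d3 d4]].
  have [e1 e2] : cabs (Logc t) <= 6 * cabs (t - 1) /\ cabs (t - 1) <= 2 * cabs (Logc t).
    by have [] := h3 t (ltac:(lra)).
  have yp : 0 < cabs (Logc t) by lra.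
  split; [by rewrite -cabs_gt0|lra|lra|].
  by rewrite cabsV -[2 / dl]invf_div lef_pV2 ?posrE //; lra.
apply: (@ucv_ext _ _ _ (fun n t => uq (@snode R lam n) q (Logc t) * (Logc t)^-1 ^+ q) _
   (fun t => limv Ci (Logc t) ^+ q * (Logc t)^-1 ^+ q)).
- by exists 0 => n _ t _; rewrite exprVn.
- move=> t /key[y0 _ _ _]; rewrite /limv (negbTE y0) exprMn exprVn mulrAC divff ?mul1r //.
  exact: expf_neq0.
apply: ucvM.
  split.
    exists (4 ^+ q) => [|t /key[_ _ k2 _]]; first exact: exprn_ge0.
    by rewrite cabsX lerXn2r ?nnegrE ?cabs_ge0 ?h2.
  move=> e e0; have [N0 hN] := h1 e e0; exists N0 => n hn t /key[_ k1 _ _].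
  exact: hN.
apply: ucv_cst; exists ((2 / dl) ^+ q) => [|t /key[_ _ _ k3]].
  by rewrite exprn_ge0 // divr_ge0 // ltW.
have d20 : 0 <= 2 / dl by rewrite divr_ge0 // ltW.
by rewrite cabsX lerXn2r ?nnegrE ?cabs_ge0.
Qed.

End SchurRatio.

(** * Separated points, and approximability of Schur functions in several variables *)

Section Generic.
Variable R : realType.
Local Notation C := (R[i] : numClosedFieldType).
Implicit Types (r dl : R) (t z w : C).

Definition generic k dl r (x : 'I_k -> C) := (forall i, dl <= cabs (x i - 1) <= r) /\
  forall i j : 'I_k, (i < j)%N -> dl <= cabs (x i - x j).

Lemma generic_le k dl dl' r r' (x : 'I_k -> C) : dl' <= dl -> r <= r' ->
  generic dl r x -> generic dl' r' x.
Proof.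
move=> h1 h2 [h3 h4]; split=> [i|i j /h4 h]; last exact: le_trans h.
by have /andP[h5 h6] := h3 i; rewrite (le_trans h1) ?(le_trans h6).
Qed.

Lemma man_sub k k' r (s : 'I_k' -> 'I_k) (f : ('I_k' -> C) -> C) : man r f ->
  man r (fun x => f (fun i => x (s i))).
Proof.
move=> hf e e0; have [g mg hg] := hf e e0.
exists (fun x => g (fun i => x (s i))); last by move=> x hx; apply: hg => i; exact: hx.
elim: mg => {g hg} [c|i|f1 g1 _ h1 _ h2|f1 g1 _ h1 _ h2].
- exact: mpf_cst.
- exact: mpf_var.
- exact: mpf_add.
- exact: mpf_mul.
Qed.

(** [man_torus] with radii r/2 + i r / (2 (k + 1)): distinct radii keep the points of the torus
    apart from each other and from 1, so that a bound at separated points is enough. *)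
Lemma man_generic k r (f : ('I_k.+1 -> C) -> C) (M : R) : 0 < r -> man r f ->
  (forall x, generic (r / (2 * k.+1%:R)) r x -> cabs (f x) <= M) ->
  forall x, pdisc (r / 4) x -> cabs (f x) <= 2 ^+ k.+1 * M.
Proof.
move=> r0 hf hM x hx.
pose rho (i : 'I_k.+1) : R := r / 2 + i%:R * (r / (2 * k.+1%:R)).
have K0 : (0 : R) < k.+1%:R by rewrite ltr0n.
have dE : r / 2 = k.+1%:R * (r / (2 * k.+1%:R)) by field; rewrite nat1r gt_eqF.
have d0 : 0 < r / (2 * k.+1%:R) by rewrite divr_gt0 // mulr_gt0.
have d1 : r / (2 * k.+1%:R) <= r / 2.
  by rewrite dE; apply: ler_peMl; [exact: ltW|rewrite ler1n].
have hrho i : r / 2 <= rho i <= r.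
  have h1 : 0 <= i%:R * (r / (2 * k.+1%:R)) by rewrite mulr_ge0 ?ler0n // ltW.
  have h2 : i%:R * (r / (2 * k.+1%:R)) <= k.+1%:R * (r / (2 * k.+1%:R)).
    by rewrite ler_wpM2r ?(ltW d0) // ler_nat ltnW.
  by rewrite /rho lerDl h1 /= [leRHS]splitr lerD2l dE.
apply: (man_torus (rho := rho) hf) => [i|y hy|i].
- by have := hrho i; lra.
- apply: hM; split=> [i|i j ij].
    by rewrite hy; have /andP[h1 ->] := hrho i; rewrite (le_trans d1).
  have := cabs_lbB (y j - 1) (y i - 1).
  rewrite !hy [cabs (_ - (y i - 1))]cabsBC opprB addrA subrK; apply: le_trans.
  have h : i%:R + 1 <= j%:R :> R by rewrite natr1 ler_nat.
  rewrite /rho opprD addrACA subrr add0r -mulrBl.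
  by apply: ler_peMl; [exact: ltW|rewrite lerBrDr addrC].
- by have := hx i; have := hrho i; lra.
Qed.

Lemma prod_near1 (I : Type) (s : seq I) (P : pred I) (e : R) : 0 < e ->
  exists2 d : R, 0 < d & forall a : I -> C, (forall i, cabs (1 - a i) <= d) ->
    cabs (1 - \prod_(i <- s | P i) a i) <= e.
Proof.
elim: s e => [|i s IH] e e0.
  by exists 1 => // a _; rewrite big_nil subrr cabs0 ltW.
have [d d0 hd] := IH (e / 4) (ltac:(lra)).
exists (Num.min d (Num.min (e / 4) 1)); first by rewrite !lt_min d0 divr_gt0 /=.
move=> a ha; have hda j : cabs (1 - a j) <= d by have := ha j; rewrite le_min => /andP[].
have := hd a hda; rewrite big_cons; case: (P i) => h; last by apply: le_trans h _; lra.
have := ha i; rewrite !le_min => /andP[_ /andP[h1 h2]].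
set b := \prod_(j <- s | P j) a j in h *.
have -> : 1 - a i * b = (1 - a i) + (1 - (1 - a i)) * (1 - b) by ring.
apply: le_trans (cabsD _ _) _; rewrite cabsM.
have h3 := cabsB_le 1 (1 - a i); rewrite cabs1 in h3.
have h4 : cabs (1 - (1 - a i)) * cabs (1 - b) <= 2 * (e / 4).
  by apply: ler_pM; rewrite ?cabs_ge0 //; lra.
lra.
Qed.

Lemma Logc_small (e : R) : 0 < e -> exists2 r, 0 < r < 1 &
  forall t, cabs (t - 1) <= r -> cabs (Logc t) < e.
Proof.
move=> e0; have [d /andP[d0 d1] hd] := @Logc_le R.
exists (Num.min (d / 2) (e / 12)).
  by rewrite lt_min !divr_gt0 //= gt_min; apply/orP; left; lra.
move=> t; rewrite le_min => /andP[h1 h2].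
by have := hd t (ltac:(lra)); lra.
Qed.

Lemma laurent_poly (I : Type) (s : seq I) (d : I -> int) (c : I -> C) :
  exists (p : {poly C}) M, forall t, t != 0 -> \sum_(i <- s) t ^ d i * c i = p.[t] / t ^+ M.
Proof.
elim: s => [|i s [p [M hp]]].
  by exists 0, 0 => t _; rewrite big_nil horner0 mul0r.
case E : (d i) => [a|a].
  exists ((c i)%:P * 'X^(a + M) + p), M => t t0; have tM : t ^+ M != 0 by rewrite expf_neq0.
  rewrite big_cons hp // E !hornerE exprD mulrDl; congr (_ + _).
  by rewrite -exprnP mulrA mulfK // mulrC.
exists ((c i)%:P * 'X^M + p * 'X^(a.+1)), (M + a.+1)%N => t t0.
have tM : t ^+ M != 0 by rewrite expf_neq0.
have ta : t ^+ a.+1 != 0 by rewrite expf_neq0.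
rewrite big_cons hp // E !hornerE NegzE exprD mulrDl -exprnN; congr (_ + _).
  by rewrite invfM mulrA mulfK // mulrC.
by rewrite invfM [_ * (t ^+ M)^-1]mulrC -mulrA [_ * (t ^+ a.+1)^-1]mulrC; field; rewrite tM ta.
Qed.

Lemma an_expz r (z : int) : r < 1 -> an (1 : C) r (fun t => t ^ z).
Proof.
move=> r1; case: z => n; first exact/an_exp/an_id.
have H : an (1 : C) r (fun t => ('X^(n.+1) : {poly C}).[t]^-1).
  apply: an_poly_inv => t ht; rewrite hornerXn expf_neq0 // near1_neq0 //.
  exact: le_lt_trans r1.
by apply: an_ext H => t _; rewrite hornerXn NegzE.
Qed.

Lemma man_schur k r (s : seq (('I_k -> C) -> C)) l :
  0 <= r -> (forall f, List.In f s -> forall z : int, man r (fun x => f x ^ z)) ->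
  man r (fun x => schur [seq f x | f <- s] l).
Proof.
move=> r0; elim: s l => [|f s IH] l hs; first by case: l => [|a l]; exact: man_cst.
rewrite /=; apply: (@man_sum _ _ _ _ xpredT (fun mu x => f x ^ (sumz l - sumz mu) * _)) => mu _.
by apply: manM => //; [apply: hs; left|apply: IH => g hg; apply: hs; right].
Qed.

End Generic.

(** * Convergence of the ratios at separated points *)

Section RatioLimit.
Variables (R : realType) (lam : nat -> seq int) (m : probability R R) (A : R).
Local Notation C := (R[i] : numClosedFieldType).
Hypotheses (hG : forall N, GT N (lam N)) (hw : weak_conv lam m) (A0 : 0 < A)
  (hA : forall N i, (i < N)%N -> `|scaled_node R (lam N) i| <= A :> R).
Variable Ci : C -> C.
Hypothesis hCi : Cauchy_inverse m Ci.
Implicit Types (t z w : C) (r dl : R).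

Definition sratio k n (x : 'I_k.+1 -> C) : C :=
  schurk lam n x / \prod_i schur1 lam (k + n) (x i).

(** The form in which a pair factor leaves the determinant; [phi2_Psi] matches it with the argument
    of the logarithm in the statement. *)
Definition Psi z w : C := (1 - z) * (1 - w) * (Ci (Logc w) - Ci (Logc z)) / (z - w).

Lemma phi_ucv_all k : exists2 r, 0 < r < 1 & forall q dl, (q < k)%N -> 0 < dl ->
  ucv (fun t : C => dl <= cabs (t - 1) <= r)
    (fun n t => uq (@snode R lam n) q (Logc t) / Logc t ^+ q) (fun t => Ci (Logc t) ^+ q).
Proof.
elim: k => [|k [r /andP[r0 r1] hr]]; first by exists 2^-1 => //; lra.
have [r' r'0 hr'] := phi_ucv hG hw A0 hA hCi k.
exists (Num.min r r'); first by rewrite lt_min r0 r'0 gt_min r1.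
move=> q dl; rewrite ltnS leq_eqVlt => /orP[/eqP-> dl0|qk dl0].
  apply: ucv_mono (hr' dl dl0) => t; rewrite le_min => /andP[h1 /andP[_ h2]].
  by rewrite h1.
apply: ucv_mono (hr q dl qk dl0) => t; rewrite le_min => /andP[h1 /andP[h2 _]].
by rewrite h1.
Qed.

Lemma generic_subr_neq0 k dl r (x : 'I_k -> C) (i j : 'I_k) : 0 < dl ->
  generic dl r x -> (i < j)%N -> x i - x j != 0.
Proof. by move=> d0 [_ h] /h hij; rewrite -cabs_gt0; exact: lt_le_trans hij. Qed.

Lemma vdm_neq0 k dl r (x : 'I_k -> C) : 0 < dl -> generic dl r x ->
  vdm [seq x i | i <- enum 'I_k] != 0.
Proof.
move=> d0 hx; rewrite vdmE; apply/prodf_neq0 => i _; apply/prodf_neq0 => j ij.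
by rewrite -oppr_eq0 opprB; exact: generic_subr_neq0 hx ij.
Qed.

(** The limit determinant is a Vandermonde determinant in the Ci(log x_i); [prod_pairs] distributes
    the power of prod_i (1 - x_i) over pairs, so that each pair collects one factor [Psi]. *)
Lemma sratio_ucv k : exists2 r, 0 < r < 1 & exists2 gamma : nat -> C, (forall n, gamma n != 0) &
  forall dl, 0 < dl -> ucv (generic dl r) (fun n x => gamma n * sratio n x)
    (fun x => \prod_(i < k.+1) \prod_(j < k.+1 | (i < j)%N) Psi (x i) (x j)).
Proof.
have [r1 /andP[r10 r11] h1] := phi_ucv_all k.+1.
have radp : 0 < rad A / 2 ^+ k.+1 by rewrite divr_gt0 ?exprn_gt0 // rad_gt0.
have [r2 /andP[r20 r21] h2] := Logc_small radp.
exists (Num.min r1 r2); first by rewrite lt_min r10 r20 gt_min r11.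
have /choice[g hg] : forall n, exists g : C, g != 0 /\ forall x : 'I_k.+1 -> C,
    (forall i, cabs (x i - 1) < 1) -> (forall i, x i != 1) ->
    (forall i, cabs (Logc (x i)) < rad A / 2 ^+ k.+1) ->
    vdm [seq x i | i <- enum 'I_k.+1] != 0 ->
    g * sratio n x = (\prod_i (1 - x i)) ^+ k / vdm [seq x i | i <- enum 'I_k.+1] *
      \det (\matrix_(i < k.+1, q < k.+1)
        (uq (@snode R lam (k + n)) q (Logc (x i)) / Logc (x i) ^+ q)).
  by move=> n; have [g g0 H] := schur_ratio_det hG A0 hA k n; exists g.
(* The sign between x_j - x_i in [vdm] and x_i - x_j in [Psi]. *)
pose sg : C := \prod_(i < k.+1) \prod_(j < k.+1 | (i < j)%N) (-1).
have sg0 : sg != 0.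
  by apply/prodf_neq0 => i _; apply/prodf_neq0 => j _; rewrite oppr_eq0 oner_eq0.
exists (fun n => sg * g n) => [n|dl dl0]; first by rewrite mulf_neq0 //; case: (hg n).
pose G (x : 'I_k.+1 -> C) := \prod_(i < k.+1) \prod_(j < k.+1 | (i < j)%N)
  ((1 - x i) * (1 - x j) / (x i - x j)).
have EG x : generic dl (Num.min r1 r2) x ->
    sg * ((\prod_i (1 - x i)) ^+ k / vdm [seq x i | i <- enum 'I_k.+1]) = G x.
  move=> hx; rewrite prod_pairs vdmE -prodf_div -big_split /=; apply: eq_bigr => i _.
  rewrite -prodf_div -big_split /=; apply: eq_bigr => j ij.
  have d1 := generic_subr_neq0 dl0 hx ij.
  have d2 : x j - x i != 0 by rewrite -oppr_eq0 opprB.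
  by field; rewrite d1 d2.
apply: (@ucv_ext _ _ _ (fun n x => G x * \det (\matrix_(i < k.+1, q < k.+1)
    (uq (@snode R lam (k + n)) q (Logc (x i)) / Logc (x i) ^+ q))) _
  (fun x => G x * \det (\matrix_(i < k.+1, q < k.+1) Ci (Logc (x i)) ^+ q))).
- exists 0 => n _ x hx; have [_ H] := hg n.
  have [hx1 _] := hx.
  have hxb i : [/\ cabs (x i - 1) < 1, x i != 1 & cabs (x i - 1) <= r2].
    have := hx1 i; rewrite le_min => /andP[k1 /andP[k2 k3]]; split=> //; first lra.
    by rewrite -subr_eq0 -cabs_gt0; exact: lt_le_trans k1.
  rewrite -mulrA H; last exact: vdm_neq0 hx.
  + by rewrite mulrA EG.
  + by move=> i; have [] := hxb i.
  + by move=> i; have [] := hxb i.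
  + by move=> i; have [_ _ /h2] := hxb i.
- move=> x hx.
  have -> : \det (\matrix_(i < k.+1, q < k.+1) Ci (Logc (x i)) ^+ q) =
      \prod_(i < k.+1) \prod_(j < k.+1 | (i < j)%N) (Ci (Logc (x j)) - Ci (Logc (x i))).
    rewrite -det_tr; have := det_Vandermonde (\row_i Ci (Logc (x i))).
    under eq_bigr => i _ do under eq_bigr => j _ do rewrite !mxE.
    by move=> <-; congr (\det _); apply/matrixP => i j; rewrite !mxE.
  rewrite /G -big_split; apply: eq_bigr => i _; rewrite -big_split; apply: eq_bigr => j _ /=.
  by rewrite /Psi mulrAC.
apply: ucvM.
  rewrite /G; apply: (@ucv_prod _ _ _ _ (index_enum _) xpredT
    (fun (i : 'I_k.+1) _ x => \prod_(j < k.+1 | (i < j)%N) ((1 - x i) * (1 - x j) / (x i - x j)))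
    (fun i x => \prod_(j < k.+1 | (i < j)%N) ((1 - x i) * (1 - x j) / (x i - x j)))) => i _.
  apply: (@ucv_prod _ _ _ _ (index_enum _) (fun j : 'I_k.+1 => (i < j)%N)
    (fun (j : 'I_k.+1) _ x => ((1 - x i) * (1 - x j) / (x i - x j)))
    (fun j x => ((1 - x i) * (1 - x j) / (x i - x j)))) => j ij.
  apply: ucv_cst; exists dl^-1 => [|x hx]; first by rewrite invr_ge0 ltW.
  have [hx1 /(_ i j ij) hij] := hx.
  have hb l : cabs (1 - x l) <= 1.
    by have := hx1 l; rewrite le_min cabsBC => /andP[_ /andP[h _]]; lra.
  rewrite cabsM cabsM cabsV -[dl^-1]mul1r -[1 in X in _ <= X]mulr1.
  have dp : 0 < cabs (x i - x j) by exact: lt_le_trans hij.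
  by rewrite !ler_pM ?mulr_ge0 ?cabs_ge0 ?invr_ge0 ?cabs_ge0 // lef_pV2 ?posrE.
apply: ucv_det => i q; have [[M M0 hM] H] := h1 q dl (ltn_ord q) dl0.
have sub x : generic dl (Num.min r1 r2) x -> dl <= cabs (x i - 1) <= r1.
  by move=> [/(_ i)]; rewrite le_min => /andP[-> /andP[->]].
split; first by exists M => // x /sub; exact: hM.
move=> e e0; have [N0 hN] := H e e0; exists N0 => n hn x /sub hx; apply: hN hx.
exact: leq_trans (leq_addl _ _).
Qed.

Lemma schur1_laurent n : exists (p : {poly C}) M,
  forall t, t != 0 -> schur1 lam n t = p.[t] / t ^+ M.
Proof. exact: laurent_poly. Qed.

(** [schur1] is p(t) / t^M, so nonvanishing alone makes its inverse approximable, through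
    [an_poly_inv]. *)
Lemma schur1_man k n r i : 0 <= r -> r < 1 -> (forall t, cabs (t - 1) <= r -> schur1 lam n t != 0) ->
  man r (fun x : 'I_k -> C => schur1 lam n (x i)) /\
  man r (fun x : 'I_k -> C => (schur1 lam n (x i))^-1).
Proof.
move=> r0 r1 hs; have [p [M hp]] := schur1_laurent n.
have t0 t : cabs (t - 1) <= r -> t != 0 by move=> h; apply: near1_neq0; exact: le_lt_trans h r1.
split.
  apply: (@man_one _ _ _ i (schur1 lam n) r0).
  apply: an_ext (anM (an_poly 1 r p) (@an_expz R r (- M%:Z) r1)) => t /t0 tn.
  by rewrite hp // -exprnN.
apply: (@man_one _ _ _ i (fun t => (schur1 lam n t)^-1) r0).
apply: (@an_ext _ _ _ (fun t => p.[t]^-1 * t ^+ M)).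
  by move=> t /t0 tn; rewrite hp // invfM invrK.
apply: anM; last exact/an_exp/an_id.
apply: an_poly_inv => t ht; have := hs t ht; rewrite hp; last exact: t0.
by rewrite mulf_eq0 negb_or => /andP[].
Qed.

Lemma man_schurk k n r : 0 <= r -> r < 1 -> man r (@schurk R lam k n).
Proof.
move=> r0 r1.
have HS := @man_schur R k r ([seq (fun x : 'I_k -> C => x i) | i <- enum 'I_k] ++ nseq n (fun=> 1))
  (lam (k + n)%N) r0.
apply: man_ext (HS _) => [x _|f {HS}].
  rewrite /schurk map_cat map_nseq -map_comp; congr (schur (_ ++ _) _).
rewrite -/(List.In _ _) => hf z.
have : (exists i, f = fun x => x i) \/ f = fun=> 1.
  elim: (enum 'I_k) hf => [|i s IH] /=; last by move=> [<-|/IH //]; left; exists i.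
  by elim: n => [[]|n IH [<-|/IH //]]; right.
move=> [[i ->]|->]; first exact: (man_one i r0 (an_expz z r1)).
by apply: (@man_ext R k r (fun=> 1)) => [x _|]; [rewrite exp1rz|exact: man_cst].
Qed.

Lemma schur1_rad : exists2 r, 0 < r < 1 &
  forall n t, cabs (t - 1) <= r -> schur1 lam n t != 0.
Proof.
have [r /andP[r0 r1] hr] := Logc_small (rad_gt0 A0).
exists r => [|n t ht]; first by rewrite r0.
by apply: (schur1_neq0 hG A0 hA); [exact: le_lt_trans r1|exact/ltW/hr].
Qed.

Lemma sratio_man : exists2 r, 0 < r < 1 & forall k n, man r (@sratio k n).
Proof.
have [r /andP[r0 r1] hr] := schur1_rad; exists r => [|k n]; first by rewrite r0.
apply: (manM (ltW r0)); first exact: man_schurk (ltW r0) r1.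
have H : man r (fun x : 'I_k.+1 -> C => \prod_i (schur1 lam (k + n) (x i))^-1).
  apply: (@man_prod _ _ _ _ xpredT (fun i x => (schur1 lam (k + n) (x i))^-1) r (ltW r0)) => i _.
  by have [] := schur1_man i (ltW r0) r1 (hr (k + n)%N).
by apply: man_ext H => x _; rewrite prodfV.
Qed.

End RatioLimit.

(** * Identification of the limit *)

Section PairLimit.
Variables (R : realType) (Ci Hp : R[i] -> R[i]).
Local Notation C := (R[i] : numClosedFieldType).
Hypothesis Hp1 : exists2 rho : R, 0 < rho & forall z : C, 0 < cabs (z - 1) < rho ->
  Hp z = Ci (Logc z) / z - (z - 1)^-1.
Hypothesis Hpc : {for (1 : C), continuous (Hp : C -> C)}.
Implicit Types (t z w : C) (r dl : R).

Definition pr z w : 'I_2 -> C := fun i => if i == ord0 then z else w.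

Definition phi2 z w : C := 1 - (z - 1) * (w - 1) * divdiff Hp z w.

Lemma cder_limit (f : C -> C) z d (c : C) (K dl : R) : cder f z d -> 0 < dl ->
  (forall h, 0 < cabs h < dl -> cabs (f (z + h) - c) <= K * cabs h) -> f z = c.
Proof.
move=> /cder_lip[dl' dl'0 hf] dl0 hK; apply: eq_cabs_le0 => e e0.
pose M := cabs d + 1 + `|K|; have M0 : 0 < M by have := cabs_ge0 d; have := normr_ge0 K; rewrite /M; lra.
have [t [t0 t1 t2 t3]] : exists t : R, [/\ 0 < t, t < dl, t < dl' & t * M <= e].
  exists (Num.min (dl / 2) (Num.min (dl' / 2) (e / M))); split.
  - by rewrite !lt_min !divr_gt0.
  - by rewrite gt_min; apply/orP; left; lra.
  - by rewrite !gt_min; apply/orP; right; apply/orP; left; lra.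
  - by rewrite -ler_pdivlMr // !ge_min lexx !orbT.
have ct : cabs (t%:C%C : C) = t by rewrite cabs_real gtr0_norm.
have h1 := hf t%:C%C (ltac:(by rewrite ct)); have h2 := hK t%:C%C (ltac:(by rewrite ct t0)).
rewrite ct in h1 h2; have h3 := cabs_tri (f (z + t%:C%C)) (f z) c.
rewrite [cabs (f z - f (z + _))]cabsBC in h3.
have h4 : K * t <= `|K| * t by rewrite ler_wpM2r ?ler_norm // ltW.
have t4 : (cabs d + 1) * t + `|K| * t <= e by rewrite -mulrDl mulrC.
lra.
Qed.

Lemma Hp_bounded : exists K d : R, [/\ 0 <= K, 0 < d & forall z, cabs (z - 1) < d -> cabs (Hp z) <= K].
Proof.
have /cvgrPdist_lt /(_ 1 ltr01) [d /= d0 hd] := Hpc.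
have [dr dE] : exists er : R, d = er%:C%C.
  by have /ger0_Im/= e1 := ltW d0; exists (complex.Re d); case: d e1 {d0 hd} => a b /= ->.
move: d0 hd; rewrite dE ltcR => d0 hd.
exists (cabs (Hp 1) + 1), dr; split=> // [|z hz]; first by have := cabs_ge0 (Hp 1); lra.
have : `|Hp 1 - Hp z| < 1 by apply: hd; rewrite /= -cabs_norm ltcR cabsBC.
rewrite -cabs_norm (_ : 1 = 1%:C%C) // ltcR => h.
by have := cabs_lbB (Hp z) (Hp 1); rewrite cabsBC; lra.
Qed.

(** z / (z - 1) - w / (w - 1) = - (z - w) / ((z - 1) (w - 1)), so the poles subtracted in H'
    contribute exactly what cancels the leading 1 of [phi2]. *)
Lemma phi2_Psi : exists2 rho : R, 0 < rho < 1 & forall z w, cabs (z - 1) < rho -> cabs (w - 1) < rho ->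
  z != 1 -> w != 1 -> z != w -> phi2 z w = Psi Ci z w.
Proof.
have [rho rho0 h] := Hp1; exists (Num.min rho 2^-1).
  by rewrite lt_min rho0 gt_min; apply/andP; split; [lra|apply/orP; right; lra].
move=> z w; rewrite !lt_min => /andP[hz hz2] /andP[hw hw2] z1 w1 zw.
have z0 : z != 0 by apply: near1_neq0; lra.
have w0 : w != 0 by apply: near1_neq0; lra.
move: z1 w1 zw; rewrite -subr_eq0 -(subr_eq0 w 1) -(subr_eq0 z w) => z1 w1 zw.
rewrite /phi2 /divdiff /Psi -(subr_eq0 z w) (negbTE zw) !h ?cabs_gt0 ?z1 ?w1 //.
by field; rewrite z0 w0 z1 w1 zw.
Qed.

Lemma phi2_sym z w : z != w -> phi2 z w = phi2 w z.
Proof.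
move=> zw; rewrite /phi2 /divdiff (negbTE zw) eq_sym (negbTE zw) [(z - 1) * _]mulrC.
by rewrite -(opprB w z) invrN mulrN -mulNr opprB.
Qed.

Section Extension.
Variables (rL : R) (L : ('I_2 -> C) -> C).
Hypotheses (rL0 : 0 < rL) (mL : man rL L)
  (hL : forall z w, cabs (z - 1) <= rL -> cabs (w - 1) <= rL -> z != 1 -> w != 1 -> z != w ->
     L (pr z w) = phi2 z w).

Lemma slice_cder z w : cabs (z - 1) < rL -> cabs (w - 1) < rL ->
  (exists d, cder (fun u => L (pr u w)) z d) /\ (exists d, cder (fun u => L (pr z u)) w d).
Proof.
move=> hz hw.
have hx : opdisc rL (pr z w) by move=> i; rewrite /pr; case: ifP.
have e1 u : upd (pr z w) ord0 u = pr u w by apply/funext => i; rewrite /upd /pr; case: eqP.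
have e2 u : upd (pr z w) (lift ord0 ord0) u = pr z u.
  apply/funext => i; rewrite /upd /pr; case: (unliftP ord0 i) => [j ->|->] //.
  by rewrite (ord1 j) eqxx.
have c1 := man_cder ord0 mL hx; have c2 := man_cder (lift ord0 ord0) mL hx.
split; eexists.
  by apply: cder_local ltr01 _ c1 => u _; rewrite e1.
by apply: cder_local ltr01 _ c2 => u _; rewrite e2.
Qed.

(** For w <> 1, [phi2] tends to 1 as its first argument u tends to 1, because [Hp] is bounded near 1
    and |u - w| stays above |w - 1| / 2. The corner (1, 1) follows by a second limit along the
    edge. *)
Lemma edge_value w : cabs (w - 1) < rL -> L (pr 1 w) = 1.
Proof.
have rL1 : cabs ((1 : C) - 1) < rL by rewrite subrr cabs0.
have key v : cabs (v - 1) < rL -> v != 1 -> L (pr 1 v) = 1.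
  move=> hv v1; have [[d hd] _] := slice_cder rL1 hv.
  have [K [d' [K0 d'0 hK]]] := Hp_bounded.
  have v1' : 0 < cabs (v - 1) by rewrite cabs_gt0 subr_eq0.
  apply: (cder_limit hd (K := 2 * (2 * K + cabs (v * Hp v)))
    (dl := Num.min (Num.min rL (1 : R)) (Num.min d' (cabs (v - 1) / 2)))).
    by rewrite !lt_min rL0 ltr01 d'0 divr_gt0.
  move=> h; rewrite !lt_min => /andP[h0 /andP[/andP[h1 h2] /andP[h3 h4]]].
  have uE : 1 + h - 1 = h by rewrite addrC addKr.
  have uv : cabs (v - 1) / 2 <= cabs (1 + h - v).
    have := cabs_lbB (v - 1) h; rewrite [cabs (v - 1 - h)]cabsBC => k.
    have -> : 1 + h - v = h - (v - 1) by ring.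
    lra.
  have uv0 : 1 + h - v != 0 by rewrite -cabs_gt0; lra.
  rewrite hL ?uE //; [|exact: ltW|exact: ltW|by rewrite -subr_eq0 uE -cabs_gt0|by rewrite -subr_eq0].
  rewrite /phi2 /divdiff -subr_eq0 (negbTE uv0) uE.
  have hu : cabs ((1 + h) * Hp (1 + h)) <= 2 * K.
    rewrite cabsM; apply: ler_pM; rewrite ?cabs_ge0 //; last by apply: hK; rewrite uE.
    by apply: le_trans (cabsD _ _) _; rewrite cabs1; lra.
  have -> : 1 - h * (v - 1) * (((1 + h) * Hp (1 + h) - v * Hp v) / (1 + h - v)) - 1 =
    - (h * ((v - 1) * ((1 + h) * Hp (1 + h) - v * Hp v) / (1 + h - v))) by field.
  rewrite cabsN cabsM mulrC ler_wpM2r ?cabs_ge0 // [leLHS]cabsM [X in X * _]cabsM cabsV.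
  rewrite ler_pdivrMr; last lra.
  have k1 := cabsB_le ((1 + h) * Hp (1 + h)) (v * Hp v).
  set X := cabs (v - 1) in uv v1' *; set Y := cabs (1 + h - v) in uv *.
  set Z := cabs (_ - _) in k1 *; set W := cabs (v * Hp v) in k1 *.
  have W0 : 0 <= W by exact: cabs_ge0.
  apply: (@le_trans _ _ (X * (2 * K + W))); first by rewrite ler_wpM2l ?(ltW v1') //; lra.
  rewrite [2 * _ * Y]mulrAC; apply: ler_wpM2r; lra.
move=> hw; have [->|w1] := eqVneq w 1; last exact: key.
have [_ [d hd]] := slice_cder rL1 rL1.
apply: (cder_limit hd (K := 0) rL0) => h /andP[h0 h1].
have uE : 1 + h - 1 = h by rewrite addrC addKr.
rewrite key ?subrr ?cabs0 ?mul0r ?uE //.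
by rewrite -subr_eq0 uE -cabs_gt0.
Qed.

(** On the diagonal [divdiff] is a [derive1], so u Hp(u) must be shown differentiable at z. Off the
    diagonal (1 - L(u, z)) / (u - 1) is z - 1 times the difference quotient of u Hp(u); as L is
    differentiable, this quotient converges, to [D]. *)
Lemma diag_value z : cabs (z - 1) < rL -> z != 1 -> L (pr z z) = phi2 z z.
Proof.
move=> hz z1; have z1' : z - 1 != 0 by rewrite subr_eq0.
have [[d hd] _] := slice_cder hz hz.
have cg : exists d', cder (fun u => (1 - L (pr u z)) * (u - 1)^-1) z d'.
  eexists; apply: cderM; first exact: (cderB (cder_cst 1 z) hd).
  by apply: cderV => //; exact: (cderB (cder_id z) (cder_cst 1 z)).
have [d' /cder_lip[a a0 ha]] := cg.
have z1p : 0 < cabs (z - 1) by rewrite cabs_gt0.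
pose D := (1 - L (pr z z)) * (z - 1)^-1 * (z - 1)^-1.
have H : cder (fun u => u * Hp u) z D.
  move=> e e0; pose K := (cabs d' + 1) / cabs (z - 1).
  have K0 : 0 < K by rewrite divr_gt0 //; have := cabs_ge0 d'; lra.
  exists (Num.min (Num.min a (e / K)) (Num.min (rL - cabs (z - 1)) (cabs (z - 1)))).
    by rewrite !lt_min a0 divr_gt0 //= z1p andbT subr_gt0.
  move=> h; rewrite !lt_min => /andP[/andP[h1 h2] /andP[h3 h4]].
  have [->|h0] := eqVneq h 0; first by rewrite addr0 mulr0 subrr subr0 cabs0 mulr0.
  have u1 : z + h - 1 != 0.
    by rewrite -cabs_gt0; have := cabs_lb (z - 1) h; rewrite addrAC; lra.
  have hu : cabs (z + h - 1) <= rL by have := cabsD (z - 1) h; rewrite addrAC; lra.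
  have uE : z + h - z = h by rewrite addrC addKr.
  have E : L (pr (z + h) z) = phi2 (z + h) z.
    by apply: hL => //; [exact: ltW|rewrite -subr_eq0|rewrite -subr_eq0 uE].
  have := ha h h1; rewrite E /phi2 /divdiff -subr_eq0 uE (negbTE h0) => hh.
  have -> : (z + h) * Hp (z + h) - z * Hp z - D * h =
    ((1 - (1 - (z + h - 1) * (z - 1) * (((z + h) * Hp (z + h) - z * Hp z) / h))) / (z + h - 1)
     - (1 - L (pr z z)) / (z - 1)) / (z - 1) * h.
    by rewrite /D; field; rewrite u1 z1' h0.
  rewrite cabsM ler_wpM2r ?cabs_ge0 // cabsM cabsV ler_pdivrMr //; apply: le_trans hh _.
  have : cabs h * K <= e by rewrite -ler_pdivlMr // ltW.
  by rewrite /K mulrA ler_pdivrMr // mulrC.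
rewrite /phi2 /divdiff eqxx (cder_derive1 H) /D; field; exact: z1'.
Qed.

End Extension.

Lemma extension rL (L : ('I_2 -> C) -> C) : 0 < rL -> man rL L ->
  (forall z w, cabs (z - 1) <= rL -> cabs (w - 1) <= rL -> z != 1 -> w != 1 -> z != w ->
     L (pr z w) = phi2 z w) ->
  forall z w, cabs (z - 1) < rL -> cabs (w - 1) < rL -> L (pr z w) = phi2 z w.
Proof.
move=> rL0 mL hL z w hz hw.
have [z1|z1] := eqVneq z 1.
  by rewrite z1 (edge_value rL0 mL hL hw) /phi2 subrr !mul0r subr0.
have [w1|w1] := eqVneq w 1.
  rewrite w1 /phi2 subrr mulr0 mul0r subr0.
  (* Exchanging the two variables reduces the edge w = 1 to [edge_value]. *)
  pose s (i : 'I_2) : 'I_2 := if i == ord0 then lift ord0 ord0 else ord0.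
  have sE a b : (fun i => pr a b (s i)) = pr b a.
    by apply/funext => i; rewrite /pr /s; case: (i == ord0).
  have := @edge_value rL (fun x => L (fun i => x (s i))) rL0 (man_sub s mL) _ z hz.
  rewrite sE; apply => a b ha hb a1 b1 ab.
  rewrite sE; have ba : b != a by rewrite eq_sym.
  have k1 := hL _ _ hb ha b1 a1 ba; have k2 := phi2_sym ba.
  by rewrite k1 k2.
have [<-|zw] := eqVneq z w; first exact: (diag_value mL hL hz z1).
by apply: hL => //; exact: ltW.
Qed.

End PairLimit.

(** * Analyticity of the limit and convergence on a full polydisc *)

Section SchurLimit.
Variables (R : realType) (lam : nat -> seq int) (m : probability R R) (A : R).
Local Notation C := (R[i] : numClosedFieldType).
Hypotheses (hG : forall N, GT N (lam N)) (hw : weak_conv lam m) (A0 : 0 < A)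
  (hA : forall N i, (i < N)%N -> `|scaled_node R (lam N) i| <= A :> R).
Variables Ci Hp : C -> C.
Hypothesis hCi : Cauchy_inverse m Ci.
Hypothesis Hp1 : exists2 rho : R, 0 < rho & forall z : C, 0 < cabs (z - 1) < rho ->
  Hp z = Ci (Logc z) / z - (z - 1)^-1.
Hypothesis Hpc : {for (1 : C), continuous Hp}.
Implicit Types (t z w : C) (r dl : R).

Lemma generic_neq1 k dl r (x : 'I_k -> C) i : 0 < dl -> generic dl r x -> x i != 1.
Proof.
by move=> d0 [/(_ i)/andP[h _] _]; rewrite -subr_eq0 -cabs_gt0; exact: lt_le_trans h.
Qed.

Lemma prod_pair2 (F : 'I_2 -> 'I_2 -> C) :
  \prod_(i < 2) \prod_(j < 2 | (i < j)%N) F i j = F ord0 (lift ord0 ord0).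
Proof.
rewrite !big_ord_recl big_ord0 [X in X * _]big_mkcond [X in _ * (X * _)]big_mkcond.
by rewrite !big_ord_recl !big_ord0 /= !mulr1 mul1r.
Qed.

(** The two-variable ratios are Cauchy at separated points, hence on a whole polydisc by
    [man_generic]. Their limit L is approximable by polynomials and is the source of the analyticity
    of [Phi]. *)
Lemma pair_limit : exists2 r, 0 < r & exists2 L : ('I_2 -> C) -> C, man r L &
  forall z w, cabs (z - 1) <= r -> cabs (w - 1) <= r -> z != 1 -> w != 1 -> z != w ->
    L (pr z w) = Psi Ci z w.
Proof.
have [r1 /andP[r10 r11] [g g0 hg]] := sratio_ucv hG hw A0 hA hCi 1.
have [r2 /andP[r20 r21] hm] := sratio_man hG A0 hA.
pose r := Num.min r1 r2.
have r0 : 0 < r by rewrite lt_min r10.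
pose f n (x : 'I_2 -> C) := g n * sratio lam n x.
have mf n : man r (f n).
  apply: manZ; first exact: ltW.
  by apply: man_shrink (hm _ _); rewrite ge_min lexx orbT.
have uf dl : 0 < dl -> forall e : R, 0 < e -> exists N0, forall n, (N0 <= n)%N ->
    forall x, generic dl r x -> cabs (f n x - Psi Ci (x ord0) (x (lift ord0 ord0))) <= e.
  move=> dl0 e e0; have [_ /(_ e e0)[N0 hN]] := hg dl dl0; exists N0 => n hn x hx.
  have := hN n hn x; rewrite (prod_pair2 (fun i j => Psi Ci (x i) (x j))); apply.
  by apply: generic_le hx => //; rewrite ge_min lexx.
have [L hL] : exists L, uconv (r / 4) f L.
  apply: ucauchy_uconv => e e0.
  have [N0 hN] := uf (r / (2 * 2%:R)) (ltac:(lra)) (e / 8) (ltac:(lra)).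
  exists N0 => n n' hn hn' x hx.
  have := @man_generic R 1 r (fun x => f n x - f n' x) (e / 4) r0 (manB (mf n) (mf n')) _ x hx.
  have -> : 2 ^+ 2 * (e / 4) = e by field.
  apply=> y hy; have := hN n hn y hy; have := hN n' hn' y hy.
  set P := Psi _ _ _; have := cabs_tri P (f n y) (f n' y).
  by rewrite [cabs (P - _)]cabsBC; lra.
exists (r / 4); first lra.
exists L; first by apply: uconv_man hL; exists 0 => n _; apply: man_shrink (mf n); lra.
move=> z w hz hw' z1 w1 zw.
have z1' : 0 < cabs (z - 1) by rewrite cabs_gt0 subr_eq0.
have w1' : 0 < cabs (w - 1) by rewrite cabs_gt0 subr_eq0.
have zw' : 0 < cabs (z - w) by rewrite cabs_gt0 subr_eq0.
pose dl := Num.min (cabs (z - 1)) (Num.min (cabs (w - 1)) (cabs (z - w))).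
have dl0 : 0 < dl by rewrite !lt_min z1' w1'.
have hx : pdisc (r / 4) (pr z w) by move=> i; rewrite /pr; case: ifP.
have gx : generic dl r (pr z w).
  split=> [i|i j ij].
    have := hx i; rewrite /pr; case: ifP => _ h; apply/andP; split; try lra.
      by rewrite ge_min lexx.
    by rewrite !ge_min lexx orbT.
  case: (unliftP ord0 j) ij => [j' ->|->] //; case: (unliftP ord0 i) => [i' ->|->] //.
    by rewrite (ord1 i') (ord1 j').
  by move=> _; rewrite /pr /= !ge_min lexx !orbT.
apply: eq_cabs_le0 => e e0; have e2 : 0 < e / 2 by lra.
have [N1 h1] := hL _ e2; have [N2 h2] := uf dl dl0 _ e2.
have k1 := h1 (maxn N1 N2) (leq_maxl _ _) _ hx.
have k2 : cabs (f (maxn N1 N2) (pr z w) - Psi Ci z w) <= e / 2 := h2 _ (leq_maxr _ _) _ gx.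
have := cabs_tri (f (maxn N1 N2) (pr z w)) (L (pr z w)) (Psi Ci z w).
by rewrite [cabs (L _ - f _ _)]cabsBC; lra.
Qed.

Lemma phi2_man : exists2 r, 0 < r & forall k (i j : 'I_k), man r (Phi i j Hp).
Proof.
have [r1 r10 [L mL hL]] := pair_limit; have [r2 /andP[r20 _] h2] := phi2_Psi Hp1.
pose r := Num.min r1 r2 / 2.
have r0 : 0 < r by rewrite divr_gt0 // lt_min r10.
have [ra rb] : r < r1 /\ r < r2.
  by split; rewrite /r ltr_pdivrMr // gt_min; apply/orP; [left|right]; lra.
pose r' := r / 2; have r'0 : 0 < r' by rewrite divr_gt0.
have E z w : cabs (z - 1) < r -> cabs (w - 1) < r -> L (pr z w) = phi2 Hp z w.
  apply: (extension Hpc r0 (man_shrink (ltW ra) mL)) => a b ha hb a1 b1 ab.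
  rewrite h2 //; [|exact: le_lt_trans rb|exact: le_lt_trans rb].
  by apply: hL => //; [exact: le_trans (ltW ra)|exact: le_trans (ltW ra)].
exists r' => // k i j; have rr : r' < r by rewrite /r'; lra.
have H := man_sub (fun l : 'I_2 => if l == ord0 then i else j) mL.
apply: man_ext (man_shrink (ltW (lt_trans rr ra)) H) => x hx.
rewrite -[RHS](E (x i) (x j)); [|exact: le_lt_trans (hx i) rr|exact: le_lt_trans (hx j) rr].
by congr (L _); apply/funext => l; rewrite /pr; case: ifP.
Qed.

(** [Phi] is 1 when x_i = 1, and it is Lipschitz in x_i with a constant independent of x_j. *)
Lemma Phi_near1 (e : R) : 0 < e -> exists2 r, 0 < r &
  forall k (i j : 'I_k) x, pdisc r x -> cabs (1 - Phi i j Hp x) <= e.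
Proof.
move=> e0; have [r r0 hm] := phi2_man.
have m2 := hm 2 ord0 (lift ord0 ord0).
have [M M0 hM] := man_bounded (ltW r0) m2.
pose d := Num.min (r / 2) (e / (8 * M / r + 1)).
have K1 : 0 <= 8 * M / r by rewrite divr_ge0 ?mulr_ge0 // ltW.
have K0 : 0 < 8 * M / r + 1 by exact: ltr_wpDl.
exists d; first by rewrite lt_min !divr_gt0.
move=> k i j x hx.
have hd l : cabs (x l - 1) <= r / 2 by have := hx l; rewrite le_min => /andP[].
have hd' l : cabs (x l - 1) * (8 * M / r + 1) <= e.
  by rewrite -ler_pdivlMr //; have := hx l; rewrite le_min => /andP[].
have P1 : pdisc r (pr 1 (x j)).
  by move=> l; rewrite /pr; case: ifP => _; [rewrite subrr cabs0 ltW|have := hd j; lra].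
have H := man_slice ord0 m2 P1.
have e1 t : upd (pr 1 (x j)) ord0 t = pr t (x j).
  by apply/funext => l; rewrite /upd /pr; case: eqP.
have := an_lip (z := 1) (w := x i) r0 H (fun t ht => hM _ (pdisc_upd ord0 P1 ht)).
rewrite subrr cabs0 !e1 => /(_ (ltac:(lra)) (hd i)).
rewrite (_ : Phi _ _ _ (pr 1 _) = 1); last by rewrite /Phi /pr /= subrr !mul0r subr0.
move=> h; apply: le_trans (hd' i); apply: le_trans h _.
rewrite mulrDr mulr1 mulrC cabsBC lerDl; exact: cabs_ge0.
Qed.

Definition PhiP k (x : 'I_k -> C) : C :=
  \prod_(p : 'I_k * 'I_k | (p.1 < p.2)%N) Phi p.1 p.2 Hp x.

(** [man_generic] is applied to the difference with the product of the [Phi], which [phi2_man] has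
    shown to be approximable. *)
Lemma sratio_uconv k : exists2 r, 0 < r & exists2 g : nat -> C, (forall n, g n != 0) &
  (forall n, man r (fun x : 'I_k.+1 -> C => g n * sratio lam n x)) /\
  uconv r (fun n (x : 'I_k.+1 -> C) => g n * sratio lam n x) (@PhiP k.+1).
Proof.
have [r1 /andP[r10 r11] [g g0 hg]] := sratio_ucv hG hw A0 hA hCi k.
have [r2 /andP[r20 r21] hm] := sratio_man hG A0 hA.
have [r3 /andP[r30 _] h3] := phi2_Psi Hp1; have [r4 r40 h4] := phi2_man.
pose r := Num.min (Num.min r1 r2) (Num.min (r3 / 2) r4).
have r0 : 0 < r by rewrite !lt_min r10 r20 r40 divr_gt0.
have [ra rb rc rd] : [/\ r <= r1, r <= r2, r < r3 & r <= r4].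
  split; rewrite /r; [by rewrite !ge_min lexx|by rewrite !ge_min lexx orbT| |by rewrite !ge_min lexx !orbT].
  by rewrite !gt_min; apply/orP; right; apply/orP; left; lra.
have mf n : man r (fun x : 'I_k.+1 -> C => g n * sratio lam n x).
  by apply: manZ; [exact: ltW|exact: man_shrink (hm _ _)].
exists (r / 4); first lra.
exists g => //; split=> [n|e e0]; first by apply: man_shrink (mf n); lra.
have dl0 : 0 < r / (2 * k.+1%:R) by rewrite divr_gt0 ?mulr_gt0 // ltr0n.
have ee : 0 < e / 2 ^+ k.+1 by rewrite divr_gt0 // exprn_gt0.
have [_ /(_ _ ee)[N0 hN]] := hg _ dl0; exists N0 => n hn x hx.
have -> : e = 2 ^+ k.+1 * (e / 2 ^+ k.+1) by rewrite mulrC divfK // expf_neq0.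
apply: (@man_generic R k r (fun x => g n * sratio lam n x - @PhiP k.+1 x)) hx => //.
  apply: manB; first exact: mf.
  apply: (@man_prod _ _ _ _ (fun p : 'I_k.+1 * 'I_k.+1 => (p.1 < p.2)%N) (fun p => Phi p.1 p.2 Hp) r
    (ltW r0)) => p _.
  exact: man_shrink (h4 _ _ _).
move=> y hy; have gy : generic (r / (2 * k.+1%:R)) r1 y by exact: generic_le hy.
rewrite (_ : PhiP y = \prod_(i < k.+1) \prod_(j < k.+1 | (i < j)%N) Psi Ci (y i) (y j)).
  exact: hN.
rewrite /PhiP -(pair_big_dep xpredT (fun i j : 'I_k.+1 => (i < j)%N) (fun i j => Phi i j Hp y)) /=.
apply: eq_bigr => i _; apply: eq_bigr => j ij; apply: h3.
- by have [/(_ i)/andP[_ h] _] := hy; exact: le_lt_trans h rc.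
- by have [/(_ j)/andP[_ h] _] := hy; exact: le_lt_trans h rc.
- exact: generic_neq1 dl0 hy.
- exact: generic_neq1 dl0 hy.
- by rewrite -subr_eq0; exact: generic_subr_neq0 dl0 hy ij.
Qed.

Lemma near1_nonzero (z : C) : cabs (1 - z) <= 4^-1 -> z != 0.
Proof. by move=> h; apply: near1_neq0; rewrite cabsBC; lra. Qed.

Lemma dlog2_PhiP k : exists2 r0, 0 < r0 & forall r, 0 < r -> r <= r0 ->
  (forall x, pdisc r x -> cabs (1 - @PhiP k x) <= 4^-1) /\
  forall (i j : 'I_k) x, (i < j)%N -> opdisc r x -> dlog2 i j (@PhiP k) x = dlog2 i j (Phi i j Hp) x.
Proof.
have q0 : 0 < 4^-1 :> R by lra.
have [d d0 hd] := @prod_near1 R _ (index_enum _) (fun p : 'I_k * 'I_k => (p.1 < p.2)%N) _ q0.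
have [r1 r10 h1] := Phi_near1 d0; have [r2 r20 h2] := Phi_near1 q0; have [r3 r30 h3] := phi2_man.
exists (Num.min r1 (Num.min r2 r3)); first by rewrite !lt_min r10 r20.
move=> r r0; rewrite !le_min => /andP[ra /andP[rb rc]]; split=> [x hx|i j x ij hx].
  by apply: hd => p; apply: h1; exact: pdisc_le hx.
(* Pairs without i go into [a]. Pairs containing i but different from (i, j) cannot contain j,
   because their entries are increasing; they go into [b]. *)
pose Q (p : 'I_k * 'I_k) := ((p.1 < p.2)%N && (p != (i, j))).
pose T (p : 'I_k * 'I_k) := (p.1 == i) || (p.2 == i).
pose a y := \prod_(p | Q p && ~~ T p) Phi p.1 p.2 Hp y.
pose b y := \prod_(p | Q p && T p) Phi p.1 p.2 Hp y.
have E : @PhiP k = fun y => Phi i j Hp y * (a y * b y).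
  apply/funext => y; rewrite /PhiP (bigD1 (i, j)) //= (bigID T) /=.
  by congr (_ * _); rewrite mulrC.
have nz l l' y : opdisc r y -> Phi l l' Hp y != 0.
  by move=> hy; apply/near1_nonzero/h2; apply: pdisc_le rb _; exact: opdisc_pdisc.
have mP l l' : man r (Phi l l' Hp) by exact: man_shrink (h3 _ _ _).
rewrite E; apply: (@dlog2_mul_indep R k r (Phi i j Hp) a b) => //; [|exact: ltW| | | | |].
- by apply/eqP => ii; move: ij; rewrite ii ltnn.
- apply: (@man_prod _ _ _ _ (fun p => Q p && ~~ T p) (fun p => Phi p.1 p.2 Hp) r (ltW r0)) => p _.
  exact: mP.
- apply: (@man_prod _ _ _ _ (fun p => Q p && T p) (fun p => Phi p.1 p.2 Hp) r (ltW r0)) => p _.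
  exact: mP.
- by move=> y hy; split; [exact: nz|apply/prodf_neq0 => p _; exact: nz|apply/prodf_neq0 => p _; exact: nz].
- move=> y t; apply: eq_bigr => p /andP[_]; rewrite negb_or => /andP[p1 p2].
  by rewrite /Phi !upd_neq.
move=> y t; apply: eq_bigr => -[p p'] /= /andP[/andP[/= pp pij] hT].
rewrite /T /= in hT; rewrite /Phi !upd_neq //; apply/eqP => pj; rewrite {}pj in hT pij pp.
  move: hT => /orP[/eqP h|/eqP h]; first by rewrite h eqxx in pij.
  by rewrite h ltnn in ij.
move: hT => /orP[/eqP h|/eqP h]; first by rewrite h ltnn in ij.
by rewrite h ltnNge (ltnW ij) in pp.
Qed.

End SchurLimit.

(** * Mixed logarithmic derivatives of Schur functions *)

Section SchurDlog.
Variables (R : realType) (lam : nat -> seq int) (m : probability R R) (A : R).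
Local Notation C := (R[i] : numClosedFieldType).
Hypotheses (hG : forall N, GT N (lam N)) (hw : weak_conv lam m) (A0 : 0 < A)
  (hA : forall N i, (i < N)%N -> `|scaled_node R (lam N) i| <= A :> R).
Variables Ci Hp : C -> C.
Hypothesis hCi : Cauchy_inverse m Ci.
Hypothesis Hp1 : exists2 rho : R, 0 < rho & forall z : C, 0 < cabs (z - 1) < rho ->
  Hp z = Ci (Logc z) / z - (z - 1)^-1.
Hypothesis Hpc : {for (1 : C), continuous Hp}.
Implicit Types (t z w c : C) (r : R).

Lemma dlog2_local k r (f g : ('I_k -> C) -> C) i j x : opdisc r x ->
  (forall y, opdisc r y -> f y = g y) -> dlog2 i j f x = dlog2 i j g x.
Proof.
move=> hx fg; apply: (pd_local i hx) => y hy.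
have e1 := fg y hy; have e2 := pd_local j hy fg.
exact: (congr2 (fun a b => a / b) e2 e1).
Qed.

(** Only the factor h(x_i) contains x_i, and it is free of x_j. *)
Lemma dlog2_one k r (f : ('I_k -> C) -> C) (h : C -> C) c i j x : i != j -> 0 <= r -> man r f ->
  (forall l : 'I_k, man r (fun y => h (y l))) -> c != 0 -> (forall y, opdisc r y -> f y != 0) ->
  (forall t, cabs (t - 1) < r -> h t != 0) -> opdisc r x ->
  dlog2 i j (fun y => f y * (c * \prod_l h (y l))) x = dlog2 i j f x.
Proof.
move=> ij r0 mf mh c0 nf nh hx.
have -> : (fun y : 'I_k -> C => f y * (c * \prod_l h (y l))) =
    fun y => f y * ((\prod_(l | l != i) h (y l)) * (c * h (y i))).
  by apply/funext => y; rewrite (bigD1 i) //=; ring.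
apply: (@dlog2_mul_indep R k r f (fun y => \prod_(l | l != i) h (y l)) (fun y => c * h (y i))) => //.
- exact: (@man_prod _ _ _ _ (fun l => l != i) (fun l y => h (y l)) r r0).
- exact: manZ.
- move=> y hy; split; [exact: nf| |by rewrite mulf_neq0 // nh].
  by apply/prodf_neq0 => l _; exact: nh.
- by move=> y t; apply: eq_bigr => l li; rewrite upd_neq.
- by move=> y t; rewrite upd_neq.
Qed.

Lemma schur_ratioE k n g (x : 'I_k.+1 -> C) : g != 0 ->
  (forall i, schur1 lam (k + n) (x i) != 0) ->
  schur_ratio lam (k.+1 + n) x = g * sratio lam n x *
    ((g * schur (nseq (k.+1 + n) 1) (lam (k.+1 + n)%N))^-1 * \prod_l schur1 lam (k + n) (x l)).
Proof.
move=> g0 hs; have [p hp] := schur_ones R (hG (k.+1 + n)%N).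
rewrite /schur_ratio /sratio /schurk addKn hp; move: (schur _ _) => S.
have P0 : \prod_l schur1 lam (k + n) (x l) != 0 by apply/prodf_neq0 => l _; exact: hs.
have q0 : p.+1%:R != 0 :> C by rewrite pnatr_eq0.
move: (\prod_l _) P0 (p.+1%:R) q0 => P P0 q q0.
by field; rewrite P0 q0 g0.
Qed.

(** For three indices, d_j d_l log of the limit is that of [Phi j l] alone, which is independent of
    x_i. *)
Lemma schur_dlog k : exists2 r, 0 < r &
  (forall i j : 'I_k.+1, (i < j)%N ->
     uconv r (fun N => dlog2 i j (@schur_ratio R lam k.+1 N)) (dlog2 i j (Phi i j Hp))) /\
  (forall i j l : 'I_k.+1, (j < l)%N -> i != j -> i != l ->
     uconv r (fun N => dlog3 i j l (@schur_ratio R lam k.+1 N)) (fun=> 0)).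
Proof.
have [r1 r10 [g g0 [mg ug]]] := sratio_uconv hG hw A0 hA hCi Hp1 Hpc k.
have [r2 r20 h2] := dlog2_PhiP hG hw A0 hA hCi Hp1 Hpc k.+1.
have [r3 /andP[r30 r31] h3] := schur1_rad hG A0 hA.
pose r := Num.min r1 (Num.min r2 r3).
have r0 : 0 < r by rewrite !lt_min r10 r20.
have [ra rb rc] : [/\ r <= r1, r <= r2 & r <= r3].
  by split; rewrite /r !ge_min lexx ?orbT.
have [P1 PD] := h2 r r0 rb.
pose f n (x : 'I_k.+1 -> C) := g n * sratio lam n x.
have mf n : man r (f n) by exact: man_shrink (mg n).
have uf : uconv r f (@PhiP R Hp k.+1) by exact: uconv_shrink ug.
(* From N1 on, [f n] is within 1/2 of 1, hence nonzero as its logarithmic derivatives require. *)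
have [N1 hN1] := uf 4^-1 (ltac:(lra)).
have nf n y : (N1 <= n)%N -> opdisc r y -> f n y != 0.
  move=> hn /opdisc_pdisc hy; apply: near1_neq0.
  have := hN1 n hn y hy; have := P1 y hy; have := cabs_tri (@PhiP R Hp k.+1 y) (f n y) 1.
  by rewrite [cabs (_ - 1)]cabsBC [cabs (_ - 1)]cabsBC; lra.
have hs n t : cabs (t - 1) < r -> schur1 lam n t != 0.
  by move=> ht; apply: h3; apply: le_trans rc; exact: ltW.
have key n i j x : (N1 <= n)%N -> i != j -> opdisc r x ->
    dlog2 i j (@schur_ratio R lam k.+1 (k.+1 + n)) x = dlog2 i j (f n) x.
  move=> hn ij hx.
  have S0 : schur (nseq (k.+1 + n) (1 : C)) (lam (k.+1 + n)%N) != 0.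
    by have [p ->] := schur_ones R (hG (k.+1 + n)%N); rewrite pnatr_eq0.
  rewrite (@dlog2_local _ _ _ _ i j x hx (fun y hy => schur_ratioE (g0 n) (fun l => hs _ _ (hy l)))).
  apply: dlog2_one ij (ltW r0) (mf n) _ _ (fun y => nf n y hn) (hs (k + n)%N) hx.
    move=> l; have hs' t : cabs (t - 1) <= r -> schur1 lam (k + n) t != 0.
      by move=> ht; apply: h3; exact: le_trans rc.
    exact: (schur1_man l (ltW r0) (le_lt_trans rc r31) hs').1.
  by rewrite invr_eq0; exact: mulf_neq0 (g0 n) S0.
have ef : eman r f by exists 0.
exists (r / 2 / 2 / 2); first lra.
split=> [i j ij|i j l jl ij il].
  have nij : i != j by apply/eqP => h; move: ij; rewrite h ltnn.
  have [_ [_ H]] := dlog2_conv i j r0 ef uf P1.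
  (* [schur_ratio] is indexed by the number N of all variables, [f] by the number of those set to 1;
     the lower bound on N makes the truncated subtraction exact. *)
  move=> e e0; have [N0 hN] := H e e0; exists (k.+1 + maxn N0 N1)%N => N hNN x hx.
  have -> : N = (k.+1 + (N - k.+1))%N by rewrite subnKC // (leq_trans _ hNN) // leq_addr.
  have hn : (maxn N0 N1 <= N - k.+1)%N by rewrite leq_subRL // (leq_trans _ hNN) // leq_addr.
  move: hn; rewrite geq_max => /andP[hn0 hn1].
  have hx1 : pdisc (r / 2 / 2) x by apply: pdisc_le hx; lra.
  have hx2 : opdisc r x by apply: pdisc_opdisc hx; lra.
  rewrite key // -(PD i j x ij hx2); exact: hN.
have njl : j != l by apply/eqP => h; move: jl; rewrite h ltnn.
have H := dlog3_conv i j l r0 ef uf P1.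
move=> e e0; have [N0 hN] := H e e0; exists (k.+1 + maxn N0 N1)%N => N hNN x hx.
have -> : N = (k.+1 + (N - k.+1))%N by rewrite subnKC // (leq_trans _ hNN) // leq_addr.
have hn : (maxn N0 N1 <= N - k.+1)%N by rewrite leq_subRL // (leq_trans _ hNN) // leq_addr.
move: hn; rewrite geq_max => /andP[hn0 hn1].
have hx2 : opdisc r x by apply: pdisc_opdisc hx; lra.
have Z : dlog3 i j l (@PhiP R Hp k.+1) x = 0.
  rewrite [LHS](pd_local i hx2 (fun y hy => PD j l y jl hy)); apply: pd_indep.
  have iP : indep i (Phi j l Hp) by move=> y t; rewrite /Phi !upd_neq // eq_sym.
  exact: (indep_pd ij (indep_div (indep_pd il iP) iP)).
have -> : dlog3 i j l (@schur_ratio R lam k.+1 (k.+1 + (N - k.+1))) x = dlog3 i j l (f (N - k.+1)%N) x.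
  exact: (pd_local i hx2 (fun y hy => key _ j l y hn1 njl hy)).
rewrite -Z; exact: hN.
Qed.

Lemma uconv_near1 k r (F : nat -> ('I_k -> C) -> C) f : 0 < r -> uconv r F f -> unif_conv_near1 F f.
Proof.
move=> r0 h; exists r => // e e0; have [N0 hN] := h (e / 2) (ltac:(lra)).
exists N0 => N /hN H x hx; apply: le_lt_trans (H x _) _; last lra.
by move=> i; exact: ltW.
Qed.

End SchurDlog.

Unset Implicit Arguments.
Set Strict Implicit.

Theorem mainTheorem17 (R : realType) (lam : nat -> seq int)
  (m : probability R R) (Hp : R[i] -> R[i]) :
  (forall N : nat, GT N (lam N)) ->
  regular R lam ->
  weak_conv lam m ->
  Hprime m Hp ->
  (forall k : nat,
     unif_conv_near1
       (fun N => dlog2 (inord 0) (inord 1) (@schur_ratio R lam k.+2 N))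
       (dlog2 (inord 0) (inord 1) (Phi (inord 0) (inord 1) Hp)))
  /\
  (forall k : nat,
     unif_conv_near1
       (fun N => dlog3 (inord 0) (inord 1) (inord 2) (@schur_ratio R lam k.+3 N))
       (fun _ => 0)).
Proof.
move=> hG hr hw [Ci [hCi Hp1 Hpc]].
have [A A0 hA] := regular_bounded hG hr.
split=> k.
  have [r r0 [H _]] := schur_dlog hG hw A0 hA hCi Hp1 Hpc k.+1.
  apply: (uconv_near1 r0); apply: H.
  by rewrite !inordK.
have [r r0 [_ H]] := schur_dlog hG hw A0 hA hCi Hp1 Hpc k.+2.
apply: (uconv_near1 r0); apply: H.
- by rewrite !inordK.
- by rewrite -val_eqE /= !inordK.
- by rewrite -val_eqE /= !inordK.
Qed.
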